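(* The annular bracket polynomial of an annular multi-knotoid diagram $K$ is a well-defined 4-variable Laurent polynomial $\langle K\rangle\in\mathbb{Z}[A^{\pm1},x,v,t]$. Moreover, the annular bracket polynomial is a regular isotopy invariant, that is, invariant under Reidemeister moves R2 and R3.
   Context: $\mathcal{A}=S^1\times D^1$ is the annulus, viewed as a disc with a hole, with an inner and an outer boundary circle. An annular multi-knotoid diagram is a generic smooth immersion of one interval $[0,1]$ and finitely many (possibly zero) circles in the interior of $\mathcal{A}$ whose only singularities are transversal double points (crossings) with over/under information; the images of $0$ and $1$ (leg and head) are distinct from each other and from the crossings. Diagrams are considered up to surface isotopies of $\mathcal{A}$ and Reidemeister moves performed away from the endpoints (moving a strand over or under an endpoint is forbidden). Regular isotopy is the equivalence generated by surface isotopies, R2 and R3. The trivial knotoid is an embedded interval. The A-smoothing of a crossing replaces it by two disjoint arcs so as to merge the two regions swept when the overstrand is rotated counterclockwise towards the understrand; the B-smoothing is the other one. A state (all crossings smoothed) consists of a trivial knotoid and disjoint simple closed curves of four kinds: $k$ null-homotopic circles (bounding a disc not containing the trivial knotoid), $m$ non-essential circles enclosing the trivial knotoid (bounding a disc containing it), $n$ inner essential circles (between the inner boundary and the trivial knotoid, i.e. not enclosing the trivial knotoid), and $l$ outer essential circles (enclosing all the rest). The annular bracket polynomial is defined by the rules: (i)-(ii) $\langle D\rangle=A\langle D_A\rangle+A^{-1}\langle D_B\rangle$, where $D_A,D_B$ are obtained from $D$ by A- and B-smoothing of a crossing; (iii) $\langle L\sqcup\mathrm{O}^k\rangle=d^k\langle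 L\rangle$, where $d=-A^2-A^{-2}$ and $\mathrm{O}^k$ stands for $k$ null-homotopic circles; (iv) a state without null-homotopic circles, having $n$ inner essential circles, $m$ non-essential circles enclosing the trivial knotoid and $l$ outer essential circles, has value $x^nv^mt^l$ times the bracket of the trivial knotoid; (v) the trivial knotoid has value $1$. *)

(* Defs.v *)
From mathcomp Require Import all_boot all_order all_algebra.
From mathcomp Require Import mpoly.

Set Implicit Arguments.
Unset Strict Implicit.
Unset Printing Implicit Defensive.

Import GRing.Theory.
Local Open Scope ring_scope.

(* Annular diagrams up to isotopy, as combinatorial maps.                     *)
(* The annulus is the sphere minus two discs, one in the region [inner] and   *)
(* one in the region [outer] (possibly the same region).  A diagram is a      *)
(* graph on the sphere, given by its darts (half-edges): [edge] exchanges the *)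
(* two halves of an edge, [node] turns counterclockwise around a vertex.      *)
(* The vertices are the two endpoints of the interval (degree 1), the         *)
(* crossings (degree 4), and marking points on the strands (degree 2), which  *)
(* carry no information but let a circle without crossings have darts.        *)
(* [is_over x] says that the strand through the crossing dart x is the upper  *)
(* one; [reg x] is the region of the corner between x and [node x], i.e. the  *)
(* region to the left of x when one leaves the vertex along x.  Diagrams may  *)
(* be disconnected and regions need not be discs, so [reg] is part of the     *)
(* data: it records how the components of the graph are nested.               *)
Record diagram_data := DiagramData {
  dart : finType;
  edge : dart -> dart;
  node : dart -> dart;
  is_over : pred dart;
  region : finType;
  reg : dart -> region;
  inner : region;
  outer : region;
  leg_end : dart;
  head_end : dart
}.

Section Validity.
Variable D : diagram_data.
Implicit Types x y : dart D.

Definition opposite x := node (node x).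
Definition prev_node x := node (node (node x)).

(* Next corner of the region of x, along the same boundary component.         *)
Definition face x := edge (node x).

Definition is_endpoint x := node x == x.
Definition is_crossing x := opposite x != x.

Definition linked : rel (dart D) := fun x y => (edge x == y) || (node x == y).

Definition component x : {set dart D} := [set y | connect linked x y].

Definition region_linked : rel (dart D) :=
  fun x y => linked x y || (reg x == reg y).

(* #V + #R = #E + #C + 1, where R is the set of regions and C the set of      *)
(* components.  If H is the bipartite graph of components and regions whose   *)
(* edges are the faces (orbits of [face]) then #V - #E + #F = 2 #C - 2 g with *)
(* g the sum of the genera, so the formula says #C + #R - #F = 1 + 2 g; when  *)
(* H is connected this forces g = 0 and H to be a tree, i.e. the data is that *)
(* of a graph on the sphere.                                                  *)
Definition euler_planar :=
  (fcard (@node D) (dart D) + #|[set reg x | x : dart D]| ==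
     fcard (@edge D) (dart D) + n_comp linked (dart D) + 1)%N.

Definition is_diagram :=
  [&& [forall x : dart D, (edge x != x) && (edge (edge x) == x)],
      [forall x : dart D, node (prev_node x) == x],
      leg_end D != head_end D,
      [forall x : dart D,
         is_endpoint x == ((x == leg_end D) || (x == head_end D))],
      [forall x : dart D, is_crossing x ==> (is_over (node x) == ~~ is_over x)],
      [forall x : dart D, reg (face x) == reg x],
      inner D \in [set reg x | x : dart D],
      outer D \in [set reg x | x : dart D],
      [forall x : dart D, forall y : dart D, connect region_linked x y] &
      euler_planar].

End Validity.

(* Annular multi-knotoid diagrams.                                            *)
Record diagram := Diagram {
  data :> diagram_data;
  diagramP : is_diagram data
}.

(* Two regions become one.                                                    *)
Definition relabel (D : diagram_data) (a b : region D) (r : region D) :=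
  if r == b then a else r.

Definition merge_regions (D : diagram_data) (a b : region D) : diagram_data :=
  DiagramData (@edge D) (@node D) (@is_over D)
    (fun x => relabel a b (reg x)) (relabel a b (inner D)) (relabel a b (outer D))
    (leg_end D) (head_end D).

(* Smoothing of the crossing of x that joins the corner between x and         *)
(* [node x] to the opposite one: the crossing becomes two vertices of degree  *)
(* 2, {node x, opposite x} and {prev_node x, x}.                              *)
Definition smooth (D : diagram_data) (x : dart D) : diagram_data :=
  let M := merge_regions (reg x) (reg (opposite x)) in
  DiagramData (@edge D)
    (fun y => if (y == x) || (y == opposite x) then prev_node y else node y)
    (@is_over D) (@reg M) (inner M) (outer M) (leg_end D) (head_end D).

(* D is D' with the set S of darts removed (S closed under edge and node).    *)
(* [is_over] is only meaningful at crossings, and regions only matter through *)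
(* the corners and boundary circles that they contain.                        *)
Definition iso_off (D D' : diagram_data) (S : {set dart D'}) : Prop :=
  exists f : dart D -> dart D',
  [/\ injective f /\ (forall y, (y \in codom f) = (y \notin S)),
      (forall x, f (edge x) = edge (f x)) /\ (forall x, f (node x) = node (f x)),
      (forall x, is_crossing x -> is_over (f x) = is_over x),
      f (leg_end D) = leg_end D' /\ f (head_end D) = head_end D' &
      [/\ forall x y, (reg (f x) == reg (f y)) = (reg x == reg y),
          forall x, (reg (f x) == inner D') = (reg x == inner D) &
          forall x, (reg (f x) == outer D') = (reg x == outer D)]].

(* The two edges at a vertex {x, node x} of degree 2 are joined into one, and *)
(* x and [node x] are left forming a separate edge.                           *)
Definition bypass (D : diagram_data) (x : dart D) : diagram_data :=
  DiagramData
    (fun y => if y == x then node x else if y == node x then x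
              else if y == edge x then edge (node x)
              else if y == edge (node x) then edge x else edge y)
    (@node D) (@is_over D) (@reg D) (inner D) (outer D) (leg_end D) (head_end D).

Definition marking_point (D : diagram_data) (x : dart D) :=
  ~~ is_endpoint x && ~~ is_crossing x.

(* The region of x is a disc without boundary circle of the annulus, and its  *)
(* corners are exactly those in s.                                            *)
Definition empty_region (D : diagram_data) (x : dart D) (s : seq (dart D)) :=
  [&& reg x != inner D, reg x != outer D &
      [forall y, (reg y == reg x) ==> (y \in s)]].

Definition same_vertex (D : diagram_data) (x y : dart D) :=
  y \in [:: x; node x; opposite x; prev_node x].

(* R2: the region of x is a bigon between two distinct crossings, one of its  *)
(* two sides being the upper strand at both.                                  *)
Definition is_bigon (D : diagram_data) (x : dart D) :=
  let y := face x in
  [&& is_crossing x, is_crossing y, ~~ same_vertex x y, face y == x,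
      empty_region x [:: x; y] & is_over (node x) == is_over y].

(* Removing the bigon pulls the two strands apart, which opens both crossings *)
(* so that the bigon joins the regions opposite to it.                        *)
Definition R2_remove (D : diagram_data) (x : dart D) : diagram_data :=
  @smooth (smooth x) (@face D x).

(* R3: the region of x is a triangle with three distinct crossings; the last  *)
(* condition says that its sides are not cyclically over one another, i.e.    *)
(* that there are a top, a middle and a bottom strand.                        *)
Definition triangle_corners (D : diagram_data) (x : dart D) :=
  [:: x; face x; face (face x)].

Definition is_triangle (D : diagram_data) (x : dart D) :=
  let y := face x in let z := face y in
  [&& [&& is_crossing x, is_crossing y & is_crossing z],
      [&& ~~ same_vertex x y, ~~ same_vertex x z & ~~ same_vertex y z],
      face z == x, empty_region x [:: x; y; z] &
      ~~ ((is_over x == is_over y) && (is_over y == is_over z))].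

(* Let c be a corner of the triangle and c' = face c.  The strand along the   *)
(* side from c to c' meets prev_node c, node c, c', opposite c' in this       *)
(* order.  After R3 it meets the two crossings in the other order, so that    *)
(* prev_node c and c' exchange their roles, as do node c and opposite c'.     *)
Definition R3_swap (D : diagram_data) (x y : dart D) : dart D :=
  let t := triangle_corners x in
  if y \in t then prev_node (face (face y))
  else if node y \in t then face (node y)
  else if opposite y \in t then node (face (face (opposite y)))
  else if prev_node y \in t then opposite (face (prev_node y))
  else y.

(* The new triangle is at the corners opposite to the old one.  The old       *)
(* corner c is now in the region across the side of the triangle opposite to  *)
(* c, and the two side corners are in the regions that were vertically        *)
(* opposite to the triangle at the other two crossings.                       *)
Definition R3_move (D : diagram_data) (x : dart D) : diagram_data :=
  let t := triangle_corners x in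
  DiagramData
    (fun y => R3_swap x (edge (R3_swap x y))) (@node D) (@is_over D)
    (fun y =>
       if y \in t then reg (node (face y))
       else if node y \in t then reg (opposite (face (face (node y))))
       else if opposite y \in t then reg (opposite y)
       else if prev_node y \in t then reg (opposite (face (prev_node y)))
       else reg y)
    (inner D) (outer D) (leg_end D) (head_end D).

(* Surface isotopy is generated by the first two moves: isomorphism, and      *)
(* removal of a marking point.                                                *)
Inductive regular_isotopic : diagram -> diagram -> Prop :=
| ri_iso (D D' : diagram) :
    @iso_off D D' set0 -> regular_isotopic D D'
| ri_unmark (D D' : diagram) (x : dart D) :
    marking_point x -> edge x != node x ->
    @iso_off D' (bypass x) [set x; node x] -> regular_isotopic D D'
| ri_R2 (D D' : diagram) (x : dart D) :
    is_bigon x -> data D' = R2_remove x -> regular_isotopic D D'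
| ri_R3 (D D' : diagram) (x : dart D) :
    is_triangle x -> data D' = R3_move x -> regular_isotopic D D'
| ri_sym (D D' : diagram) :
    regular_isotopic D D' -> regular_isotopic D' D
| ri_trans (D D' D'' : diagram) :
    regular_isotopic D D' -> regular_isotopic D' D'' -> regular_isotopic D D''.

Section Circles.
Variable D : diagram_data.
Implicit Types (x c : dart D) (r s : region D).

(* c lies on a simple closed curve, i.e. a closed component without crossings.*)
Definition is_circle c := [forall x in component c, marking_point x].

Definition across c : rel (region D) :=
  fun r s => [exists x, [&& x \notin component c, reg x == r & reg (edge x) == s]].

(* r is on the side of the circle of c which does not contain the outer       *)
(* boundary of the annulus.                                                   *)
Definition encloses c r := ~~ connect (across c) r (outer D).

Definition essential c := encloses c (inner D).
Definition encloses_knotoid c := encloses c (reg (leg_end D)).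

Definition null_homotopic c :=
  [&& is_circle c, ~~ essential c & ~~ encloses_knotoid c].
Definition enclosing_nonessential c :=
  [&& is_circle c, ~~ essential c & encloses_knotoid c].
Definition inner_essential c :=
  [&& is_circle c, essential c & ~~ encloses_knotoid c].
Definition outer_essential c :=
  [&& is_circle c, essential c & encloses_knotoid c].

Definition ncircles (P : pred (dart D)) := #|[set component c | c in P]|.

Definition is_state := [forall x, ~~ @is_crossing D x].

Definition is_trivial_knotoid := is_state && [forall c, ~~ is_circle c].

End Circles.

(* D = L u O, for the null-homotopic circle O on which c lies: L is obtained  *)
(* by deleting O, so that its two sides become one region.  Disjoint unions   *)
(* with k such circles are iterated ones.                                     *)
Definition disjoint_null_circle (L D : diagram_data) (c : dart D) :=
  null_homotopic c /\
  @iso_off L (merge_regions (reg c) (reg (edge c))) (component c).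

(* Z[A^+-1, x, v, t] inside its field of fractions.                           *)
Notation coeff_field := {fraction {mpoly int[4]}}.

Definition varA : coeff_field := tofrac ('X_(inord 0)).
Definition varx : coeff_field := tofrac ('X_(inord 1)).
Definition varv : coeff_field := tofrac ('X_(inord 2)).
Definition vart : coeff_field := tofrac ('X_(inord 3)).

Definition is_laurent (q : coeff_field) : Prop :=
  exists (p : {mpoly int[4]}) (k : nat), q = tofrac p / varA ^+ k.

Definition loop_value : coeff_field := - varA ^+ 2 - varA ^- 2.

(* At an upper dart x, the corners of x and [opposite x] are those swept by   *)
(* the upper strand when it turns counterclockwise, so [smooth x] is the      *)
(* A-smoothing and [smooth (node x)] the B-smoothing.                         *)
Record annular_bracket (br : diagram -> coeff_field) : Prop := AnnularBracket {
  bracket_smoothing : forall (D DA DB : diagram) (x : dart D),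
    is_crossing x -> is_over x ->
    data DA = smooth x -> data DB = smooth (node x) ->
    br D = varA * br DA + varA^-1 * br DB;
  bracket_null_circle : forall (L D : diagram) (c : dart D),
    disjoint_null_circle L c -> br D = loop_value * br L;
  bracket_state : forall D O : diagram,
    is_state D -> ncircles (@null_homotopic D) = 0%N -> is_trivial_knotoid O ->
    br D = varx ^+ ncircles (@inner_essential D)
         * varv ^+ ncircles (@enclosing_nonessential D)
         * vart ^+ ncircles (@outer_essential D) * br O;
  bracket_trivial : forall O : diagram, is_trivial_knotoid O -> br O = 1
}.

(* Main.v *)
Require Import Defs.
From mathcomp Require Import all_boot all_order all_algebra.
From mathcomp Require Import mpoly.
From mathcomp Require Import zify ring.

Set Implicit Arguments.
Unset Strict Implicit.
Unset Printing Implicit Defensive.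

Import GRing.Theory.
Local Open Scope ring_scope.

(* Smoothing a crossing keeps the darts and the edges, so a state of a diagram *)
(* is just a second involution on its darts, and its circles are orbits.       *)
(* The Euler formula says exactly that every cycle modulo 2 is the coboundary  *)
(* of a function on the regions.  Hence the parity of the number of times that *)
(* a circle of a state meets a path of regions from the outer boundary to a    *)
(* region r depends only on r, and it tells whether the circle encloses r.     *)
(* With one path to the inner boundary and one to the leg, fixed in the        *)
(* initial diagram, the two parities of a circle give its kind, and the        *)
(* bracket is the sum over all states of the products of the values of their   *)
(* circles.  For R2 and R3 the paths can be moved off the sides of the bigon   *)
(* or triangle; what remains is Kauffman's local computation, in which every   *)
(* inner edge is cut off as a loop of value d.  Uniqueness holds because       *)
(* smoothings and deletions of circles again have no cycle modulo 2 besides    *)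
(* the coboundaries, and so are diagrams.                                      *)

(** * Loops of a pair of involutions *)

(** The bracket is Kauffman's state sum, with each circle of a state weighted according to its kind.
    The difficulty is to read off the kind of a circle without following how regions merge from one
    smoothing to the next. By [planarP], Euler's formula for the initial diagram amounts to the
    vanishing of its first cohomology modulo 2, so a circle C of any state is the set of edges
    across which some two-colouring phi of the regions changes. Every path from the outer boundary
    to a region r then meets C with the same parity, phi r + phi outer, and [circle_sum] shows that
    for a component without crossings this parity says whether it encloses r. Two paths
    ([dual_pair]), towards the inner boundary and towards the leg, thus attach to each loop an
    element of F_2 x F_2, and [state_sum_indep] removes the choice of the paths.

    The same paths serve after a smoothing ([dual_pair_smooth]), which gives the skein rule
    [annular_skein]. The rules for null-homotopic circles and for states hold because loops factor
    out of the sum ([annular_null_circle], [annular_state]).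

    For R2 and R3 the paths are moved off the sides of the bigon or triangle. [loop_product_cut]
    then cuts these sides off as loops of value d, so that a smoothing of the tangle counts only
    through the way it connects the outer ends; what is left is a finite computation ([bracket_R2],
    [bracket_R3]). Removal of a marking point ([annular_unmark]) uses the same cut. Factors d are
    cancelled, which is legitimate since d is nonzero in the field of fractions.

    Uniqueness ([annular_bracket_unique]) is an induction along the rules, once smoothings and
    deletions of circles are known to be diagrams ([smooth_axioms], [delete_circle_axioms]). Values
    are Laurent polynomials because only sums and products of A, A^-1, d, x, v, t occur
    ([annular_state_sum_closed]). *)

Lemma connect_map (T T' : finType) (r : rel T) (r' : rel T') (h : T -> T') :
  (forall x y, r x y -> connect r' (h x) (h y)) ->
  forall x y, connect r x y -> connect r' (h x) (h y).
Proof.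
move=> hr x y /connectP [p pp ->]; elim: p x pp => [|z p IH] x //= /andP [xz pp].
exact: connect_trans (hr _ _ xz) (IH _ pp).
Qed.

Lemma connect_ind (T : finType) (r : rel T) (Q : T -> Prop) (x : T) :
  Q x -> (forall y z, Q y -> r y z -> Q z) -> forall y, connect r x y -> Q y.
Proof.
move=> Qx step y /connectP [p pp ->]; elim: p x Qx pp => [|z p IH] x Qx //=.
by case/andP => xz; apply: IH; apply: step xz.
Qed.

Lemma back_connect_sym (T : finType) (r : rel T) :
  (forall x y, r x y -> connect r y x) -> connect_sym r.
Proof.
move=> back; suff sub x y : connect r x y -> connect r y x by move=> x y; apply/idP/idP; apply: sub.
by apply: (@connect_ind _ r (fun z => connect r z x)) => // u v ux /back /connect_trans; apply.
Qed.

Lemma eq_imset_dom (T U : finType) (f g : T -> U) (A B : pred T) :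
  f =1 g -> A =1 B -> [set f x | x in A] = [set g x | x in B].
Proof.
move=> fg AB; apply/setP => y; apply/imsetP/imsetP => -[x xA ->];
  by exists x; rewrite // unfold_in ?AB // -AB.
Qed.

Section Orbits.
Variable T : finType.
Implicit Types (e s : T -> T) (x y : T).

Definition link e s : rel T := fun x y => (e x == y) || (s x == y).
Definition orb e s x : {set T} := [set y | connect (link e s) x y].

Lemma link_sym e s : injective e -> injective s -> connect_sym (link e s).
Proof.
move=> ei si; apply: back_connect_sym => x y /orP [] /eqP <-.
  have: fconnect e (e x) x by rewrite (fconnect_sym ei) fconnect1.
  by apply: connect_sub => u v /eqP uv; apply: connect1; rewrite /link uv eqxx.
have: fconnect s (s x) x by rewrite (fconnect_sym si) fconnect1.
by apply: connect_sub => u v /eqP uv; apply: connect1; rewrite /link uv eqxx orbT.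
Qed.

Lemma orb_refl e s x : x \in orb e s x.
Proof. by rewrite inE. Qed.

Lemma orb_eq e s x y : injective e -> injective s ->
  (orb e s x == orb e s y) = connect (link e s) x y.
Proof.
move=> ei si; apply/eqP/idP => [|xy].
  by move/setP/(_ y); rewrite !inE connect0.
by apply/setP => z; rewrite !inE (same_connect (link_sym ei si) xy).
Qed.

Lemma orb_id e s x y : injective e -> injective s -> y \in orb e s x ->
  orb e s x = orb e s y.
Proof. by move=> ei si; rewrite inE -orb_eq // => /eqP. Qed.

Lemma orb_edge e s x y : y \in orb e s x -> e y \in orb e s x.
Proof.
by rewrite !inE => /connect_trans; apply; apply: connect1; rewrite /link eqxx.
Qed.

Lemma orb_node e s x y : y \in orb e s x -> s y \in orb e s x.
Proof.
by rewrite !inE => /connect_trans; apply; apply: connect1; rewrite /link eqxx orbT.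
Qed.

(** The interval ends at darts fixed by the vertex map; excluding fixed points keeps the circles of
    a state and discards that arc. *)
Definition closed_at e s x := [forall y in orb e s x, (e y != y) && (s y != y)].

Lemma closed_atE e s x : (x \in closed_at e s) = closed_at e s x.
Proof. by []. Qed.

Definition loops e s : {set {set T}} := [set orb e s x | x in closed_at e s].

Lemma closed_at_eq e s x y : injective e -> injective s -> y \in orb e s x ->
  closed_at e s x = closed_at e s y.
Proof. by move=> ei si yx; rewrite /closed_at (orb_id ei si yx). Qed.

Lemma linkC e s : link e s =2 link s e.
Proof. by move=> x y; rewrite /link orbC. Qed.

Lemma orb_swap e s x : orb e s x = orb s e x.
Proof. by apply/setP => y; rewrite !inE (eq_connect (linkC e s)). Qed.

Lemma loopsC e s : loops e s = loops s e.
Proof.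
apply: eq_imset_dom => x; first exact: orb_swap.
by rewrite /closed_at orb_swap; apply: eq_forallb => y; rewrite [(e y != y) && _]andbC.
Qed.

Lemma eq_link e e' s s' : e =1 e' -> s =1 s' -> link e s =2 link e' s'.
Proof. by move=> ee ss x y; rewrite /link ee ss. Qed.

Lemma eq_orb e e' s s' x : e =1 e' -> s =1 s' -> orb e s x = orb e' s' x.
Proof. by move=> ee ss; apply/setP => y; rewrite !inE (eq_connect (eq_link ee ss)). Qed.

Lemma eq_loops e e' s s' : e =1 e' -> s =1 s' -> loops e s = loops e' s'.
Proof.
move=> ee ss; apply: eq_imset_dom => x; first exact: eq_orb.
by rewrite /closed_at (eq_orb _ ee ss); apply: eq_forallb => y; rewrite ee ss.
Qed.

(* The edge {x, e x} becomes a loop, and the two strands that entered it from  *)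
(* outside are joined to each other.                                          *)
Definition cut e x s y :=
  if y == x then e x else if y == e x then x
  else if y == s x then s (e x) else if y == s (e x) then s x else s y.

End Orbits.

(** * Products of loop values under embeddings and cuts *)

Section LoopProduct.
Variables (F : comNzRingType) (G : zmodType) (w : G -> F).

Definition loop_product (T : finType) (e s : T -> T) (P : T -> G) : F :=
  \prod_(C in loops e s) w (\sum_(x in C) P x).

Lemma loop_productC (T : finType) (e s : T -> T) P :
  loop_product e s P = loop_product s e P.
Proof. by rewrite /loop_product loopsC. Qed.

Lemma eq_loop_product (T : finType) (e e' s s' : T -> T) P :
  e =1 e' -> s =1 s' -> loop_product e s P = loop_product e' s' P.
Proof. by move=> ee ss; rewrite /loop_product (eq_loops ee ss). Qed.

(** The image of [f] is stable under both involutions, so every orbit lies in it or in its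
    complement [S], and the product splits. *)
Lemma loop_product_embed (T T' : finType) (e s : T -> T) (e' s' : T' -> T')
    (f : T -> T') (S : {set T'}) P :
  involutive e' -> involutive s' -> injective f ->
  (forall y, (y \in codom f) = (y \notin S)) ->
  (forall x, f (e x) = e' (f x)) -> (forall x, f (s x) = s' (f x)) ->
  loop_product e' s' P =
    (\prod_(C in [set orb e' s' x | x in [set x in S | closed_at e' s' x]])
        w (\sum_(x in C) P x)) * loop_product e s (P \o f).
Proof.
move=> ei' si' fi fS fe fs.
have ej := inv_inj ei'; have sj := inv_inj si'.
have fN x : f x \notin S by rewrite -fS codom_f.
have ei : involutive e by move=> x; apply: fi; rewrite !fe ei'.
have si : involutive s by move=> x; apply: fi; rewrite !fs si'.
have ij := inv_inj ei; have hj := inv_inj si.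
have orbE x : orb e' s' (f x) = f @: orb e s x.
  apply/setP => y; apply/idP/imsetP => [|[z + ->]]; rewrite !inE.
    move: y; apply: connect_ind => [|y z [u + ->]]; first by exists x; rewrite // orb_refl.
    by move=> ux /orP [] /eqP <-; [exists (e u); rewrite ?fe ?orb_edge | exists (s u); rewrite ?fs ?orb_node].
  apply: connect_map => u v /orP [] /eqP <-; apply: connect1.
    by rewrite /link fe eqxx.
  by rewrite /link fs eqxx orbT.
have clE x : closed_at e' s' (f x) = closed_at e s x.
  apply/forall_inP/forall_inP => cl y yx.
    by have := cl (f y); rewrite orbE imset_f // -fe -fs !(inj_eq fi); apply.
  by move: yx; rewrite orbE => /imsetP [z zx ->]; rewrite -fe -fs !(inj_eq fi) cl.
rewrite /loop_product (bigID (fun C : {set T'} => C \subset S)) /=; congr (_ * _).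
  apply: eq_bigl => C; apply/andP/imsetP.
    move=> [/imsetP [x xc ->] /subsetP sub]; exists x => //.
    by rewrite inE sub ?orb_refl.
  move=> [x]; rewrite inE => /andP [xS xc] ->; split; first by apply/imsetP; exists x.
  apply/subsetP => y yx; apply: contraLR xS; rewrite -!fS => /codomP [z yE].
  move: yx; rewrite inE (link_sym ej sj) => yx.
  have : x \in orb e' s' (f z) by rewrite inE -yE.
  by rewrite orbE => /imsetP [u _ ->]; apply: codom_f.
have -> : \prod_(C in loops e' s' | ~~ (C \subset S)) w (\sum_(x in C) P x) =
          \prod_(C in [set f @: C | C : {set T} in loops e s]) w (\sum_(x in C) P x).
  apply: eq_bigl => C; apply/andP/imsetP.
    move=> [/imsetP [x xc ->] /subsetPn [y yx]]; rewrite -fS => /codomP [z yE].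
    subst y; rewrite (orb_id ej sj yx) orbE; exists (orb e s z) => //.
    by apply/imsetP; exists z; rewrite // closed_atE -clE -(closed_at_eq ej sj yx).
  move=> [_ /imsetP [x xc ->] ->]; rewrite -orbE; split.
    by apply/imsetP; exists (f x); rewrite // closed_atE clE.
  by apply/subsetPn; exists (f x); rewrite ?orb_refl ?fN.
rewrite big_imset /=; last by move=> C1 C2 _ _; apply: imset_inj.
by apply: eq_bigr => C _; rewrite big_imset //= => x y _ _; apply: fi.
Qed.

Lemma loop_product_iso (T T' : finType) (e s : T -> T) (e' s' : T' -> T')
    (f : T -> T') P :
  involutive e' -> involutive s' -> bijective f ->
  (forall x, f (e x) = e' (f x)) -> (forall x, f (s x) = s' (f x)) ->
  loop_product e' s' P = loop_product e s (P \o f).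
Proof.
move=> ei si fb fe fs; have [g _ gK] := fb.
have fS y : (y \in codom f) = (y \notin set0) by rewrite inE -[y]gK codom_f.
rewrite (loop_product_embed P ei si (bij_inj fb) fS fe fs).
rewrite big1 ?mul1r // => C /imsetP [x].
by rewrite !inE.
Qed.

(** The values of [P] on the two halves of the edge cancel, so taking them out changes the value of
    no other loop, and together they form a new loop of value [w 0]. If [s x = e x], the edge is
    already such a loop and the cut does nothing. *)
Lemma loop_product_cut (T : finType) (e s : T -> T) (P : T -> G) x :
  involutive e -> involutive s -> e x != x -> s x != x -> s (e x) != e x ->
  P x + P (e x) = 0 ->
  loop_product e (cut e x s) P =
    (if s x == e x then 1 else w 0) * loop_product e s P.
Proof.
move=> eK sK ex sx sex Px; have ei := inv_inj eK; have si := inv_inj sK.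
have [sxex|sxex] := eqVneq (s x) (e x).
  rewrite mul1r; apply: eq_loop_product => // y; rewrite /cut.
  case: (y =P x) => [->|_] //; case: (y =P e x) => [->|/eqP yex].
    by rewrite -sxex sK.
  rewrite sxex (negPf yex) -[in s (e x)]sxex sK; case: eqP => [->|//].
  by rewrite sxex.
set a := x; set b := e x; set p := s x; set q := s (e x).
have ab : a != b by rewrite eq_sym.
have pq : p != q by rewrite (inj_eq si) eq_sym.
have ap : a != p by rewrite eq_sym.
have bp : b != p by rewrite eq_sym.
have bq : b != q by rewrite eq_sym.
have aq : a != q by apply: contraNneq bp => /(congr1 s); rewrite sK /p => ->.
have eb : e b = a by rewrite /b eK.
have sp : s p = a by rewrite /p sK.
have sq : s q = b by rewrite /q sK.
set s' := cut e x s.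
have s'a : s' a = b by rewrite /s' /cut eqxx.
have s'b : s' b = a by rewrite /s' /cut eq_sym (negPf ab) eqxx.
have s'p : s' p = q by rewrite /s' /cut eq_sym (negPf ap) eq_sym (negPf bp) eqxx.
have s'q : s' q = p.
  by rewrite /s' /cut eq_sym (negPf aq) eq_sym (negPf bq) eq_sym (negPf pq) eqxx.
have s'E y : y != a -> y != b -> y != p -> y != q -> s' y = s y.
  by rewrite /s' /cut => /negPf -> /negPf -> /negPf -> /negPf ->.
have s'K : involutive s'.
  move=> y; have [->|ya] := eqVneq y a; first by rewrite s'a s'b.
  have [->|yb] := eqVneq y b; first by rewrite s'b s'a.
  have [->|yp] := eqVneq y p; first by rewrite s'p s'q.
  have [->|yq] := eqVneq y q; first by rewrite s'q s'p.
  rewrite s'E // s'E ?sK //.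
  - by apply: contraNneq yp => syE; rewrite -(inj_eq si) syE sp.
  - by apply: contraNneq yq => syE; rewrite -(inj_eq si) syE sq.
  - by rewrite (inj_eq si).
  - by rewrite (inj_eq si).
have s'i := inv_inj s'K.
have e_ab y : (e y == a) || (e y == b) = (y == a) || (y == b).
  by rewrite -(inj_eq ei y a) -(inj_eq ei y b) eb orbC.
have orb_ab : orb e s' a = [set a; b].
  apply/setP => y; rewrite !inE; apply/idP/orP => [|[]/eqP->]; first 1 last.
  - exact: connect0.
  - by apply: connect1; rewrite /link s'a eqxx orbT.
  move: y; apply: connect_ind; first by left.
  by move=> y z /orP; rewrite -e_ab => + /orP [] /eqP <-; last rewrite e_ab;
     move=> /orP []/eqP ->; rewrite ?s'a ?s'b ?eqxx; auto.
(* Away from the cut edge connectivity is unchanged: the new link from [p] to [q] replaces the old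
   path through [a] and [b], and conversely [r] pushes [a] to [p] and [b] to [q]. *)
have to_old y z : y \notin [set a; b] -> z \notin [set a; b] ->
    connect (link e s') y z = connect (link e s) y z.
  have ce u : connect (link e s) u (e u) by apply: connect1; rewrite /link eqxx.
  have cs u : connect (link e s) u (s u) by apply: connect1; rewrite /link eqxx orbT.
  have ce' u : connect (link e s') u (e u) by apply: connect1; rewrite /link eqxx.
  have cs' u : connect (link e s') u (s' u) by apply: connect1; rewrite /link eqxx orbT.
  have cab : connect (link e s) a b by apply: ce.
  have cap : connect (link e s) a p by apply: cs.
  have cbq : connect (link e s) b q by apply: cs.
  have cs_sym := link_sym ei si; have cs_sym' := link_sym ei s'i.
  have cpq : connect (link e s) p q.
    rewrite cs_sym in cap; apply: connect_trans cap _; exact: connect_trans cab cbq.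
  move=> yab zab; apply/idP/idP.
    apply: connect_map => u v /orP [] /eqP <-; first exact: ce.
    have [->|ua] := eqVneq u a; first by rewrite s'a.
    have [->|ub] := eqVneq u b; first by rewrite s'b cs_sym.
    have [->|up] := eqVneq u p; first by rewrite s'p.
    have [->|uq] := eqVneq u q; first by rewrite s'q cs_sym.
    by rewrite s'E.
  have cpq' : connect (link e s') p q by rewrite -s'p.
  pose r u := if u == a then p else if u == b then q else u.
  have ra : r a = p by rewrite /r eqxx.
  have rb : r b = q by rewrite /r eq_sym (negPf ab) eqxx.
  have rE u : u \notin [set a; b] -> r u = u.
    by rewrite !inE negb_or /r => /andP [/negPf -> /negPf ->].
  rewrite -{2}(rE _ yab) -{2}(rE _ zab).
  apply: connect_map => u v /orP [] /eqP <-.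
    have [->|ua] := eqVneq u a; first by rewrite ra rb.
    have [->|ub] := eqVneq u b; first by rewrite eb ra rb cs_sym'.
    by rewrite !rE // !inE ?e_ab ?negb_or ?ua ?ub.
  have [->|ua] := eqVneq u a.
    by rewrite ra rE // !inE negb_or ![p == _]eq_sym ap bp.
  have [->|ub] := eqVneq u b.
    by rewrite rb rE // !inE negb_or ![q == _]eq_sym aq bq.
  have [->|up] := eqVneq u p.
    by rewrite sp ra rE // !inE negb_or ![p == _]eq_sym ap bp.
  have [->|uq] := eqVneq u q.
    by rewrite sq rb rE // !inE negb_or ![q == _]eq_sym aq bq.
  rewrite !rE ?inE ?negb_or ?ua ?ub //; first by rewrite -s'E.
  apply/andP; split; first by apply: contraNneq up => suE; rewrite -(inj_eq si) suE sp.
  by apply: contraNneq uq => suE; rewrite -(inj_eq si) suE sq.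
have orbE y : y \notin [set a; b] -> orb e s' y = orb e s y :\: [set a; b].
  move=> yab; apply/setP => z; rewrite in_setD andbC.
  have [zab|zab] := boolP (z \in [set a; b]); last by rewrite andbT [LHS]inE to_old // inE.
  rewrite andbF; apply: contraNF yab => zy.
  have az : z \in orb e s' a by rewrite orb_ab.
  by rewrite -orb_ab (orb_id ei s'i az) -(orb_id ei s'i zy) orb_refl.
have p_nab : p \notin [set a; b] by rewrite !inE negb_or ![p == _]eq_sym ap.
have q_nab : q \notin [set a; b] by rewrite !inE negb_or ![q == _]eq_sym aq.
have fixE z : (s' z == z) = (s z == z).
  have [->|za] := eqVneq z a; first by rewrite s'a -/b eq_sym (negPf ab) (negPf sx).
  have [->|zb] := eqVneq z b; first by rewrite s'b (negPf ab) (negPf sex).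
  have [->|zp] := eqVneq z p; first by rewrite s'p sp eq_sym (negPf pq) (negPf ap).
  have [->|zq] := eqVneq z q; first by rewrite s'q sq (negPf pq) (negPf bq).
  by rewrite s'E.
have clE y : y \notin [set a; b] -> closed_at e s' y = closed_at e s y.
  move=> yab; rewrite /closed_at orbE //; apply/forall_inP/forall_inP => cl z zy.
    have [zab|zab] := boolP (z \in [set a; b]).
      by move: zab; rewrite !inE => /orP [] /eqP ->; rewrite ?eb ?ex ?ab.
    by rewrite -fixE cl // inE zab.
  by rewrite fixE cl //; move: zy; rewrite inE => /andP [].
have cl_ab : closed_at e s' a.
  apply/forall_inP => y; rewrite orb_ab !inE => /orP [] /eqP ->.
    by rewrite ex s'a eq_sym.
  by rewrite eb s'b ab.
(* No old orbit is contained in {a, b}; hence removing these two darts maps the old loops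
   bijectively to the new ones other than {a, b}. *)
have esc x' : exists2 y, y \in orb e s x' & y \notin [set a; b].
  have [|x'ab] := boolP (x' \in [set a; b]); last by exists x'; rewrite ?orb_refl.
  by rewrite !inE => /orP [] /eqP ->; [exists p | exists q]; rewrite // orb_node ?orb_refl.
pose cutC (C : {set T}) := C :\: [set a; b].
have loopsE : loops e s' = [set a; b] |: [set cutC C | C : {set T} in loops e s].
  apply/setP => C; rewrite in_setU1; apply/imsetP/orP.
    move=> [y yc ->]; have [yab|yab] := boolP (y \in [set a; b]).
      by left; rewrite -(@orb_id _ e s' a y) ?orb_ab.
    right; apply/imsetP; exists (orb e s y); rewrite ?orbE //.
    by apply/imsetP; exists y; rewrite // closed_atE -clE.
  move=> [/eqP ->|/imsetP [_ /imsetP [y yc ->] ->]]; first by exists a; rewrite ?orb_ab.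
  have [z zy zab] := esc y; exists z; last by rewrite (orb_id ei si zy) orbE.
  by rewrite closed_atE clE // -(closed_at_eq ei si zy).
rewrite /loop_product loopsE big_setU1; last first.
  apply/imsetP => -[C _ /setP /(_ a)]; rewrite !inE eqxx //=.
rewrite big_imset /=; last first.
  move=> _ _ /imsetP [y1 _ ->] /imsetP [y2 _ ->].
  have [z1 z1y z1ab] := esc y1; have [z2 z2y z2ab] := esc y2.
  rewrite (orb_id ei si z1y) (orb_id ei si z2y) /cutC => eqz; apply/eqP.
  rewrite orb_eq // -to_old // -orb_eq //; apply/eqP.
  by rewrite !orbE.
rewrite big_setU1 ?big_set1 ?inE //= Px; congr (_ * _).
apply: eq_bigr => _ /imsetP [y _ ->]; congr (w _); rewrite [RHS](bigID (mem [set a; b])) /=.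
rewrite -[LHS]add0r; congr (_ + _); last first.
  by apply: eq_bigl => z; rewrite !inE andbC.
have abE : (a \in orb e s y) = (b \in orb e s y).
  by apply/idP/idP => /(@orb_edge _ e); rewrite ?eb.
have [ay|ay] := boolP (a \in orb e s y).
  rewrite (eq_bigl (mem [set a; b])); last first.
    by move=> z; rewrite andb_idl // in_set2 => /orP [] /eqP -> //; rewrite -abE.
  by rewrite big_setU1 ?inE //= big_set1 Px.
rewrite big1 // => z /andP [zy]; rewrite !inE => /orP [] /eqP zE.
  by rewrite -zE zy in ay.
by rewrite abE -zE zy in ay.
Qed.

End LoopProduct.

(** * State sums of four-valent graphs *)

(* The map n turns around vertices of degree 1, 2 or 4, so n^4 = id.          *)
Section Smoothings.
Variables (T : finType) (n : T -> T).
Implicit Types (x y : T) (K : {set T}).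

Definition crossing_at x := n (n x) != x.

(** Joining the corner between [x] and [n x] to the opposite one separates these two darts, so [x]
    is paired with n^-1 x, which is n^3 x. *)
Definition smoothed x y := if (y == x) || (y == n (n x)) then n (n (n y)) else n y.

(* A choice of smoothings, encoded by the set of the corners that it joins. *)
Definition is_choice K :=
  [forall y, if crossing_at y then (n y \in K) == (y \notin K) else y \notin K].

Definition strand K y := if y \in K then n (n (n y)) else n y.

Definition vertex x : {set T} := [set x; n x; n (n x); n (n (n x))].

Hypothesis n4 : forall y, n (n (n (n y))) = y.

Lemma node_inj : injective n.
Proof. by apply: (can_inj (g := fun y => n (n (n y)))). Qed.

Lemma vertexP x y :
  reflect [\/ y = x, y = n x, y = n (n x) | y = n (n (n x))] (y \in vertex x).
Proof.
rewrite !inE -!orbA; apply: (iffP or4P) => -[] H.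
- by constructor 1; apply/eqP.
- by constructor 2; apply/eqP.
- by constructor 3; apply/eqP.
- by constructor 4; apply/eqP.
- by constructor 1; apply/eqP.
- by constructor 2; apply/eqP.
- by constructor 3; apply/eqP.
- by constructor 4; apply/eqP.
Qed.

Lemma vertex_node x y : (n y \in vertex x) = (y \in vertex x).
Proof.
apply/vertexP/vertexP => -[] E.
- by constructor 4; rewrite -E n4.
- by constructor 1; apply: node_inj.
- by constructor 2; apply: node_inj.
- by constructor 3; apply: node_inj.
- by constructor 2; rewrite E.
- by constructor 3; rewrite E.
- by constructor 4; rewrite E.
- by constructor 1; rewrite E n4.
Qed.

Lemma crossing_node y : crossing_at (n y) = crossing_at y.
Proof. by rewrite /crossing_at (inj_eq node_inj). Qed.

Lemma crossing_vertex x y : y \in vertex x -> crossing_at y = crossing_at x.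
Proof. by case/vertexP => ->; rewrite ?crossing_node. Qed.

Lemma crossing_neq1 x : crossing_at x -> n x != x.
Proof. by apply: contraNneq => nx; rewrite !nx. Qed.

Lemma crossing_neq3 x : crossing_at x -> n (n (n x)) != x.
Proof.
move=> cx; apply: contraNneq (crossing_neq1 cx) => nx.
by have := n4 x; rewrite nx => ->.
Qed.

Lemma is_choice_opposite K y : is_choice K -> (n (n y) \in K) = (y \in K).
Proof.
move=> /forallP cK; have := cK (n y); have := cK y; rewrite crossing_node.
rewrite /crossing_at; case: eqP => [->//|_] /= /eqP -> /eqP ->.
by rewrite negbK.
Qed.

Lemma strand_invol K : is_choice K -> involutive (strand K).
Proof.
move=> cK y; rewrite /strand; have /forallP /(_ y) := cK.
rewrite /crossing_at; case: eqP => /= [nny /negPf yK|_ /eqP nyK].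
  by rewrite yK; case: ifP => _; rewrite ?n4 ?nny.
case yK: (y \in K) nyK => /= nyK; last by rewrite nyK n4.
by rewrite is_choice_opposite // nyK n4.
Qed.

Lemma strand_noncrossing K y : is_choice K -> ~~ crossing_at y -> strand K y = n y.
Proof.
by move=> /forallP /(_ y) + /negPf ncy; rewrite ncy /strand => /negPf ->.
Qed.

Section OneCrossing.
Variable x : T.
Hypothesis cx : crossing_at x.

Lemma vertex_corner y : y \in vertex x ->
  ((y == x) || (y == n (n x))) = (y != n x) && (y != n (n (n x))).
Proof.
have x1 := crossing_neq1 cx; have x3 := crossing_neq3 cx.
have e1 := negPf x1; have e3 := negPf x3; have e2 := negPf cx.
have inj := inj_eq node_inj.
case/vertexP => ->; rewrite ?eqxx ?orbT ?andbF /=.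
- by rewrite ![x == _]eq_sym e1 e3.
- by rewrite e1 inj eq_sym e1.
- by rewrite !inj e1 eq_sym e1.
- by rewrite e3 !inj e1.
Qed.

Lemma smoothed_off y : y \notin vertex x -> smoothed x y = n y.
Proof.
move=> yx; rewrite /smoothed; case: ifP => // /orP [] /eqP yE;
  by rewrite yE !inE eqxx ?orbT in yx.
Qed.

Lemma smoothed_on y : y \in vertex x -> smoothed x (smoothed x y) = y.
Proof.
have x1 := crossing_neq1 cx; have x3 := crossing_neq3 cx.
have S0 : smoothed x x = n (n (n x)) by rewrite /smoothed eqxx.
have S2 : smoothed x (n (n x)) = n x by rewrite /smoothed eqxx orbT n4.
have S1 : smoothed x (n x) = n (n x).
  by rewrite /smoothed (negPf x1) (inj_eq node_inj) [x == _]eq_sym (negPf x1).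
have S3 : smoothed x (n (n (n x))) = x.
  by rewrite /smoothed (negPf x3) !(inj_eq node_inj) (negPf x1) /= n4.
by case/vertexP => ->; rewrite ?S0 ?S1 ?S2 ?S3 ?S0 ?S1 ?S2 ?S3.
Qed.

End OneCrossing.
End Smoothings.

Section SmoothedNode.
Variables (T : finType) (n : T -> T).
Hypothesis n4 : forall y, n (n (n (n y))) = y.
Variable x : T.
Hypothesis cx : crossing_at n x.
Let n' := smoothed n x.

Lemma smoothed4 y : n' (n' (n' (n' y))) = y.
Proof.
have [yx|yx] := boolP (y \in vertex n x).
  by rewrite /n' !smoothed_on.
by rewrite /n' !smoothed_off ?vertex_node // n4.
Qed.

Lemma crossing_smoothed y :
  crossing_at n' y = crossing_at n y && (y \notin vertex n x).
Proof.
rewrite /crossing_at; have [yx|yx] := boolP (y \in vertex n x).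
  by rewrite andbF /n' smoothed_on // eqxx.
by rewrite andbT /n' !smoothed_off ?vertex_node.
Qed.

(** Adding the two corners at [x] identifies the choices of the smoothed graph with the choices that
    join [x]. The second conjunct says that [K] avoids these corners, in the shape produced by
    [reindex_onto]. *)
Lemma choice_add (K : {set T}) :
  is_choice n' K = is_choice n (K :|: [set x; n (n x)])
                   && ((K :|: [set x; n (n x)]) :\: [set x; n (n x)] == K).
Proof.
have x1 := crossing_neq1 cx; have x3 := crossing_neq3 n4 cx.
have xv : x \in vertex n x by rewrite !inE eqxx.
have xxv : n (n x) \in vertex n x by rewrite !inE eqxx ?orbT.
have KU z : (z \in K :|: [set x; n (n x)]) = (z \in K) || ((z == x) || (z == n (n x))).
  by rewrite !inE.
rewrite setDUl setDv setU0; apply/idP/andP => [/forallP cK|[/forallP cK /eqP KE]].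
  have Kv y : y \in vertex n x -> y \notin K.
    by move=> yx; have := cK y; rewrite crossing_smoothed yx andbF.
  split.
    apply/forallP => y; have [yx|yx] := boolP (y \in vertex n x).
      rewrite (crossing_vertex n4 yx) cx !KU !(negPf (Kv _ _)) ?vertex_node //=.
      have nyx : n y \in vertex n x by rewrite vertex_node.
      rewrite (vertex_corner n4 cx nyx) !(inj_eq (node_inj n4)).
      by rewrite negb_or.
    have Kx z : z \notin vertex n x -> (z \in K :|: [set x; n (n x)]) = (z \in K).
      move=> zx; rewrite KU orb_idr // => /orP [] /eqP zE;
      by rewrite zE ?xv ?xxv in zx.
    have := cK y; rewrite crossing_smoothed yx andbT.
    by rewrite /n' smoothed_off // !Kx ?vertex_node.
  apply/eqP/setP => y; rewrite in_setD in_set2 andb_idl // => yK.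
  by apply: contraL yK => /orP [] /eqP ->; apply: Kv.
have Kv y : y \in vertex n x -> y \notin K.
  move=> yx; rewrite -KE in_setD in_set2; have := cK y.
  rewrite (crossing_vertex n4 yx) cx !KU.
  have := vertex_corner n4 cx yx; case: (_ || _) => //= /esym /negbT.
  rewrite negb_and !negbK => /orP [] /eqP yE; case yK: (y \in K) => // /eqP.
    by rewrite yE eqxx !orbT.
  by rewrite yE n4 eqxx !orbT.
apply/forallP => y; rewrite crossing_smoothed andbC.
have [yx|yx] /= := boolP (y \in vertex n x); first exact: Kv.
have Kx z : z \notin vertex n x -> (z \in K :|: [set x; n (n x)]) = (z \in K).
  move=> zx; rewrite KU orb_idr // => /orP [] /eqP zE;
  by rewrite zE ?xv ?xxv in zx.
by have := cK y; rewrite /n' smoothed_off // !Kx ?vertex_node.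
Qed.

Lemma strand_add (K : {set T}) : is_choice n' K ->
  strand n (K :|: [set x; n (n x)]) =1 strand n' K.
Proof.
move=> /forallP cK y; rewrite /strand.
have Kv z : z \in vertex n x -> z \notin K.
  by move=> zx; have := cK z; rewrite crossing_smoothed zx andbF.
have [yx|yx] := boolP (y \in vertex n x).
  by rewrite in_setU in_set2 (negPf (Kv _ yx)).
rewrite /n' !smoothed_off ?vertex_node // in_setU in_set2 orb_idr //.
by case/orP => /eqP yE; rewrite yE !inE eqxx ?orbT in yx.
Qed.

End SmoothedNode.

(** * The state sum and its skein relation *)

Section Bracket.
Variables (F : fieldType) (A : F) (G : zmodType) (w : G -> F).
Hypothesis A0 : A != 0.

(* A smoothed crossing has two joined corners, hence the halves.              *)
Definition weight (T : finType) (ov : pred T) (K : {set T}) : F :=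
  A ^+ #|[set y in K | ov y]|./2 * A ^- #|[set y in K | ~~ ov y]|./2.

Definition bracket (T : finType) (e n : T -> T) (ov : pred T) (P : T -> G) : F :=
  \sum_(K | is_choice n K) weight ov K * loop_product w e (strand n K) P.

Definition corner_weight (b : bool) : F := if b then A else A^-1.

Variables (T : finType) (e n : T -> T) (ov : pred T) (P : T -> G).
Hypothesis n4 : forall y, n (n (n (n y))) = y.

Lemma card_pair_add (K : {set T}) (p : pred T) x y :
  x != y -> x \notin K -> y \notin K -> p x = p y ->
  #|[set z in K :|: [set x; y] | p z]|./2 = (p x + #|[set z in K | p z]|./2)%N.
Proof.
move=> xy xK yK pxy.
have -> : [set z in K :|: [set x; y] | p z] =
   if p x then x |: (y |: [set z in K | p z]) else [set z in K | p z].
  apply/setP => z; case: ifP => px; rewrite !inE.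
    have [->|zx] := eqVneq z x; first by rewrite px !orbT.
    have [->|zy] := eqVneq z y; first by rewrite -pxy px !orbT.
    by rewrite !orbF.
  have [->|zx] := eqVneq z x; first by rewrite px !andbF.
  have [->|zy] := eqVneq z y; first by rewrite -pxy px !andbF.
  by rewrite !orbF.
case: (p x) => //; rewrite !cardsU1 !inE (negPf xy) (negPf xK) (negPf yK) /=.
by rewrite !add1n.
Qed.

(** The choices that join the corner [x] are those of the graph smoothed there; the corners [x] and
    [n (n x)] together contribute one factor of the weight. *)
Lemma skein_half x : crossing_at n x -> ov (n (n x)) = ov x ->
  \sum_(K | is_choice n K && (x \in K))
     weight ov K * loop_product w e (strand n K) P =
  corner_weight (ov x) * bracket e (smoothed n x) ov P.
Proof.
move=> cx ovx.
rewrite (reindex_onto (fun K : {set T} => K :|: [set x; n (n x)])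
                      (fun K => K :\: [set x; n (n x)])) /=; last first.
  move=> K /andP [cK xK]; apply/setP => y; rewrite !inE orbC.
  case: (y =P x) => [->|_] /=; first by rewrite xK.
  by case: (y =P _) => [->|_] //=; rewrite is_choice_opposite ?xK.
rewrite /bracket big_distrr /=; apply: eq_big => [K|K cK].
  by rewrite choice_add // !inE eqxx orbT andbT.
have {}cK : is_choice (smoothed n x) K by move: cK; rewrite choice_add // => /andP [/andP [-> _] ->].
rewrite mulrA; congr (_ * _); last first.
  by apply: eq_loop_product => // y; apply: strand_add.
have Kv z : z \in vertex n x -> z \notin K.
  by move=> zx; have /forallP /(_ z) := cK; rewrite crossing_smoothed // zx andbF.
have xK : x \notin K by rewrite Kv // !inE eqxx.
have xxK : n (n x) \notin K by rewrite Kv // !inE eqxx ?orbT.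
rewrite /weight !card_pair_add // ?ovx //; try by rewrite eq_sym.
case: (ov x) => /=; rewrite add0n add1n.
  by rewrite exprS mulrA.
by rewrite exprS invfM mulrCA.
Qed.

Lemma skein x : crossing_at n x -> ov (n x) = ~~ ov x ->
  ov (n (n x)) = ov x -> ov (n (n (n x))) = ~~ ov x ->
  bracket e n ov P = corner_weight (ov x) * bracket e (smoothed n x) ov P
    + corner_weight (~~ ov x) * bracket e (smoothed n (n x)) ov P.
Proof.
move=> cx o1 o2 o3; rewrite {1}/bracket (bigID (fun K : {set T} => x \in K)) /= skein_half //.
congr (_ + _); rewrite -o1 -skein_half ?o3 ?o1 ?crossing_node //.
apply: eq_bigl => K; apply: andb_id2l => /forallP /(_ x).
by rewrite cx => /eqP ->.
Qed.

End Bracket.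

(** * Tangles with prescribed strands *)

Section Alternating.
Variables (F : fieldType) (A : F) (G : zmodType) (w : G -> F).
Variables (T : finType) (e n : T -> T) (ov : pred T) (P : T -> G).
Hypothesis n4 : forall y, n (n (n (n y))) = y.

Definition alternating (m : T -> T) := forall y, crossing_at m y -> ov (m y) = ~~ ov y.

Lemma alternating_smoothed x :
  alternating n -> crossing_at n x -> alternating (smoothed n x).
Proof.
move=> alt cx y; rewrite crossing_smoothed // => /andP [cy yx].
by rewrite smoothed_off // alt.
Qed.

Definition smoothing (b : bool) (m : T -> T) x := smoothed m (if b then x else m x).

Lemma skein_alternating x : alternating n -> crossing_at n x ->
  bracket A w e n ov P =
    corner_weight A (ov x) * bracket A w e (smoothing true n x) ov P
    + corner_weight A (~~ ov x) * bracket A w e (smoothing false n x) ov P.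
Proof.
move=> alt cx; apply: skein => //; rewrite ?alt ?crossing_node ?negbK //.
Qed.

End Alternating.

(** * Strands of a tangle as matchings of positions *)

Section LocalModel.
Variable T : finType.
Implicit Types (l : seq T) (t : seq nat) (s : T -> T).

(* A tangle is the list l of its darts; its strands are then maps t between   *)
(* positions in l, on which cuts are computed.                                *)
Definition extend l t s y := if y \in l then nth y l (nth 0%N t (index y l)) else s y.

Definition is_local l s := forall y, y \notin l -> s y \notin l.

Definition cut_positions i k t :=
  [seq if j == i then k else if j == k then i
       else if j == nth 0%N t i then nth 0%N t k
       else if j == nth 0%N t k then nth 0%N t i else nth 0%N t j
  | j <- iota 0 (size t)].

(** Fixed-point-free involutions of the positions, as a boolean, so that concrete tables are checked
    by computation. *)
Definition matching N t :=
  [&& size t == N, all (fun j => j < N)%N t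
    & all (fun j => (nth 0%N t (nth 0%N t j) == j) && (nth 0%N t j != j)) (iota 0 N)].

Definition cycle4 (n : T -> T) x := [:: x; n x; n (n x); n (n (n x))].

Lemma extend_nth l t s y j : uniq l -> (j < size l)%N -> (nth 0%N t j < size l)%N ->
  extend l t s (nth y l j) = nth y l (nth 0%N t j).
Proof.
by move=> ul jl tl; rewrite /extend mem_nth // index_uniq //; apply: set_nth_default.
Qed.

Lemma extend_off l t s y : y \notin l -> extend l t s y = s y.
Proof. by rewrite /extend => /negPf ->. Qed.

Lemma eq_extend l t s s' : (forall y, y \notin l -> s y = s' y) ->
  extend l t s =1 extend l t s'.
Proof. by move=> ss y; rewrite /extend; case: ifPn => // /ss. Qed.

Lemma matchingP N t j : matching N t -> (j < N)%N ->
  [/\ (nth 0 t j < N)%N, nth 0%N t (nth 0%N t j) = j & nth 0%N t j <> j].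
Proof.
case/and3P => /eqP st /allP lt /allP inv jN.
have /andP [/eqP i1 /eqP i2] := inv j (ltac:(by rewrite mem_iota add0n)).
by split=> //; apply: lt; rewrite mem_nth ?st.
Qed.

Lemma extend_involK l t s y : uniq l -> matching (size l) t -> y \in l ->
  extend l t s (extend l t s y) = y.
Proof.
move=> ul mt yl; rewrite -(nth_index y yl); set j := index y l.
have jl : (j < size l)%N by rewrite index_mem.
have [t1 t2 _] := matchingP mt jl.
by rewrite !extend_nth ?t2.
Qed.

Lemma extend_neq l t s y : uniq l -> matching (size l) t -> y \in l ->
  extend l t s y != y.
Proof.
move=> ul mt yl; rewrite -(nth_index y yl); set j := index y l.
have jl : (j < size l)%N by rewrite index_mem.
have [t1 t2 /eqP t3] := matchingP mt jl.
by rewrite extend_nth // nth_uniq.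
Qed.

Lemma cut_extend (e s : T -> T) l t i k x0 : uniq l -> matching (size l) t ->
  (i < size l)%N -> (k < size l)%N -> is_local l s ->
  e (nth x0 l i) = nth x0 l k ->
  cut e (nth x0 l i) (extend l t s) =1 extend l (cut_positions i k t) s.
Proof.
move=> ul mt il kl sl eE y.
have [t1 _ _] := matchingP mt il; have [u1 _ _] := matchingP mt kl.
have /eqP st : size t == size l by case/and3P: mt.
have [yl|yl] := boolP (y \in l); last first.
  rewrite (extend_off _ _ yl) /cut eE !extend_nth // extend_off //.
  by rewrite !ifN //; apply: contraNneq yl => ->; rewrite mem_nth.
rewrite -[y](nth_index x0 yl); set j := index y l.
have jl : (j < size l)%N by rewrite index_mem.
have [v1 _ _] := matchingP mt jl.
have cE : nth 0%N (cut_positions i k t) j =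
  if j == i then k else if j == k then i
       else if j == nth 0%N t i then nth 0%N t k
       else if j == nth 0%N t k then nth 0%N t i else nth 0%N t j.
  by rewrite (nth_map 0%N) ?size_iota ?st // nth_iota ?st.
rewrite extend_nth ?cE //; last by do 4!case: ifP => _ //.
rewrite /cut eE !extend_nth // !nth_uniq //.
by do 4!case: ifP => _ //.
Qed.

Lemma extend_cat l1 l2 t1 t2 s : uniq (l1 ++ l2) -> matching (size l1) t1 ->
  matching (size l2) t2 ->
  extend l2 t2 (extend l1 t1 s) =1
  extend (l1 ++ l2) (t1 ++ [seq (size l1 + j)%N | j <- t2]) s.
Proof.
move=> ul m1 m2 y; have := ul; rewrite cat_uniq => /and3P [ul1 /hasPn dis ul2].
have /eqP s1 : size t1 == size l1 by case/and3P: m1.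
have /eqP s2 : size t2 == size l2 by case/and3P: m2.
rewrite {1 3}/extend mem_cat; have [y2|y2] := boolP (y \in l2).
  have y1 : y \notin l1 by apply: dis.
  have jl : (index y l2 < size l2)%N by rewrite index_mem.
  have [v1 _ _] := matchingP m2 jl.
  rewrite orbT index_cat (negPf y1) nth_cat s1 ltnNge leq_addr /= addKn.
  rewrite (nth_map 0%N) ?s2 // nth_cat ltnNge leq_addr /= addKn.
  by [].
rewrite orbF /extend; case: ifP => // y1.
have jl : (index y l1 < size l1)%N by rewrite index_mem.
have [v1 _ _] := matchingP m1 jl.
by rewrite index_cat y1 nth_cat s1 jl nth_cat v1.
Qed.

Lemma smoothed_extend (n : T -> T) x b : (forall y, n (n (n (n y))) = y) ->
  crossing_at n x ->
  smoothing b n x =1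
  extend (cycle4 n x) (if b then [:: 3; 2; 1; 0] else [:: 1; 0; 3; 2])%N n.
Proof.
move=> n4 cx y; have x1 := negPf (crossing_neq1 cx).
have x3 := negPf (crossing_neq3 n4 cx); have x2 := negPf cx.
have inj := inj_eq (node_inj n4).
have D : (((n x == x) = false) * ((x == n x) = false) * ((n (n x) == x) = false)
  * ((x == n (n x)) = false) * ((n (n (n x)) == x) = false) * ((x == n (n (n x))) = false)
  * ((n x == n (n x)) = false) * ((n (n x) == n x) = false)
  * ((n x == n (n (n x))) = false) * ((n (n (n x)) == n x) = false)
  * ((n (n x) == n (n (n x))) = false) * ((n (n (n x)) == n (n x)) = false))%type.
  by rewrite !inj ![x == _]eq_sym x1 x2 x3.
rewrite /extend /cycle4; have [|yx] := boolP (y \in _); last first.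
  have yv : y \notin vertex n x by move: yx; rewrite !inE -!orbA.
  case: b; first exact: smoothed_off.
  rewrite /smoothing smoothed_off //; apply: contra yv => /vertexP [] ->;
  by rewrite ?n4 !inE eqxx ?orbT.
rewrite !inE => /or4P [] /eqP ->; case: b; rewrite /smoothing /smoothed /= ?D /= ?eqxx /= ?n4 ?D ?eqxx //=.
Qed.

End LocalModel.

(* The cuts rs, with the number of those that add a loop of value w 0.        *)
Fixpoint reduce (rs : seq (nat * nat)) (t : seq nat) : seq nat * nat :=
  if rs is (i, k) :: rs' then
    let r := reduce rs' (cut_positions i k t) in (r.1, r.2 + (nth 0 t i != k))%N
  else (t, 0%N).

(** The side conditions of all successive cuts, again to be checked by computation on concrete
    tables. *)
Fixpoint reducible N (rs : seq (nat * nat)) (t : seq nat) : bool :=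
  matching N t &&
  (if rs is (i, k) :: rs' then
     [&& (i < N)%N, (k < N)%N, i != k & reducible N rs' (cut_positions i k t)]
   else true).

Section LocalBracket.
Variables (F : fieldType) (A : F) (G : zmodType) (w : G -> F).
Variables (T : finType) (e n : T -> T) (ov : pred T) (P : T -> G).
Hypothesis n4 : forall y, n (n (n (n y))) = y.
Hypothesis eK : involutive e.
Variable l : seq T.
Hypothesis ul : uniq l.
Hypothesis nl : is_local l n.

Definition off_choice (K : {set T}) :=
  [forall y, if (y \notin l) && crossing_at n y then (n y \in K) == (y \notin K)
             else y \notin K].

(** The smoothings outside the tangle stay free while its strands are prescribed; tangles with the
    same outside can then be compared through their matchings alone. *)
Definition local_bracket (t : seq nat) : F :=
  \sum_(K | off_choice K)
     weight A ov K * loop_product w e (extend l t (strand n K)) P.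

Lemma is_choice_extend m t K : matching (size l) t -> m =1 extend l t n ->
  is_choice m K = off_choice K.
Proof.
move=> mt mE; apply: eq_forallb => y; rewrite /crossing_at !mE.
have [yl|yl] := boolP (y \in l); first by rewrite extend_involK // eqxx.
by rewrite !extend_off ?nl.
Qed.

Lemma strand_extend m t K : matching (size l) t -> m =1 extend l t n ->
  off_choice K -> strand m K =1 extend l t (strand n K).
Proof.
move=> mt mE /forallP cK y; rewrite /strand !mE.
have [yl|yl] := boolP (y \in l).
  by have := cK y; rewrite yl /= => /negPf ->; rewrite /extend yl.
by rewrite !extend_off ?nl.
Qed.

Lemma extend_strand_invol t K : matching (size l) t -> off_choice K ->
  involutive (extend l t (strand n K)).
Proof.
move=> mt cK; pose m := extend l t n.
have mE : m =1 extend l t n by [].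
have m4 y : m (m (m (m y))) = y.
  have [yl|yl] := boolP (y \in l); first by rewrite /m !extend_involK.
  by rewrite /m !extend_off ?nl // n4.
have cmK : is_choice m K by rewrite (is_choice_extend _ mt mE).
have := strand_invol m4 cmK => sK y.
by rewrite -!(strand_extend mt mE cK) sK.
Qed.

Lemma bracket_extend m t : matching (size l) t -> m =1 extend l t n ->
  bracket A w e m ov P = local_bracket t.
Proof.
move=> mt mE; apply: eq_big => [K|K cK]; first exact: is_choice_extend mE.
congr (_ * _); apply: eq_loop_product => //; apply: strand_extend => //.
by rewrite -(is_choice_extend _ mt mE).
Qed.

Lemma strand_local K : off_choice K -> is_local l (strand n K).
Proof. by move=> cK y yl; rewrite /strand; case: ifP; rewrite !nl. Qed.

(** Whether the cut creates a loop depends on the matching only, so the same factor comes out of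
    every outside state. *)
Lemma local_bracket_cut i k t x0 : matching (size l) t ->
  (i < size l)%N -> (k < size l)%N -> i != k ->
  e (nth x0 l i) = nth x0 l k -> P (nth x0 l i) + P (nth x0 l k) = 0 ->
  local_bracket (cut_positions i k t) =
  w 0 ^+ (nth 0%N t i != k) * local_bracket t.
Proof.
move=> mt il kl ik eE PE; rewrite /local_bracket big_distrr /=.
apply: eq_bigr => K cK; rewrite mulrCA; congr (_ * _).
rewrite -(eq_loop_product _ _ (frefl e) (cut_extend _ mt il kl (strand_local cK) eE)) //.
have [t1 _ /eqP t2] := matchingP mt il.
rewrite loop_product_cut ?eE //.
- by rewrite extend_nth // nth_uniq //; case: eqP.
- exact: extend_strand_invol.
- by rewrite nth_uniq // eq_sym.
- by rewrite extend_neq ?mem_nth.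
- by rewrite extend_neq ?mem_nth.
Qed.

(** Once the inner edges are cut off, the matching remembers only how the outer ends are connected.
    Smoothings with equal connections thus agree up to powers of [w 0]. *)
Lemma local_bracket_reduce rs t x0 : reducible (size l) rs t ->
  (forall r, r \in rs -> e (nth x0 l r.1) = nth x0 l r.2 /\
                         P (nth x0 l r.1) + P (nth x0 l r.2) = 0) ->
  local_bracket (reduce rs t).1 = w 0 ^+ (reduce rs t).2 * local_bracket t.
Proof.
elim: rs t => [|[i k] rs IH] t /=; first by rewrite mul1r.
case/andP => mt /and4P [il kl ik red] rsP.
have [eE PE] := rsP (i, k) (mem_head _ _).
rewrite IH // => [|r rrs]; last by apply: rsP; rewrite inE rrs orbT.
by rewrite (local_bracket_cut mt il kl ik eE PE) mulrA exprD.
Qed.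

End LocalBracket.

(** * Reidemeister moves for state sums *)

Section LocalMoves.
Variables (F : fieldType) (A : F) (G : zmodType) (w : G -> F).
Variables (T : finType) (n : T -> T) (ov : pred T).
Hypothesis n4 : forall y, n (n (n (n y))) = y.

Definition smoothed_positions (b : bool) : seq nat :=
  if b then [:: 3; 2; 1; 0]%N else [:: 1; 0; 3; 2]%N.

Definition positions2 b1 b2 :=
  smoothed_positions b1 ++ [seq (4 + j)%N | j <- smoothed_positions b2].

Definition positions3 b1 b2 b3 :=
  positions2 b1 b2 ++ [seq (8 + j)%N | j <- smoothed_positions b3].

Lemma cycle4_local x : is_local (cycle4 n x) n.
Proof.
move=> y; have E z : (z \in cycle4 n x) = (z \in vertex n x) by rewrite !inE -!orbA.
by rewrite !E vertex_node.
Qed.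

Lemma cat_local l1 l2 : is_local l1 n -> is_local l2 n -> is_local (l1 ++ l2) n.
Proof.
by move=> h1 h2 y; rewrite !mem_cat !negb_or => /andP [/h1 -> /h2 ->].
Qed.

Lemma crossing_off (m : T -> T) l t y : m =1 extend l t n -> is_local l n ->
  y \notin l -> crossing_at n y -> crossing_at m y.
Proof. by move=> mE nl yl cy; rewrite /crossing_at !mE !extend_off ?nl. Qed.

Lemma smoothing_extend (m : T -> T) l t y b :
  m =1 extend l t n -> is_local l n -> (forall z, m (m (m (m z))) = z) ->
  crossing_at n y -> uniq (l ++ cycle4 n y) -> matching (size l) t ->
  smoothing b m y =1
  extend (l ++ cycle4 n y) (t ++ [seq (size l + j)%N | j <- smoothed_positions b]) n.
Proof.
move=> mE nl m4 cy ul mt z.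
have yl : y \notin l.
  by move: ul; rewrite cat_uniq => /and3P [_ /hasPn /(_ y) + _] /=; apply; rewrite inE eqxx.
have c4 : cycle4 m y = cycle4 n y.
  by rewrite /cycle4 !mE !(@extend_off _ l) ?nl.
rewrite smoothed_extend //; last exact: crossing_off mE _ _ _.
rewrite c4 -extend_cat //; last by case: b.
exact: eq_extend.
Qed.

Lemma smoothing4 m x b : (forall z, m (m (m (m z))) = z) -> crossing_at m x ->
  forall z : T, let m' := smoothing b m x in m' (m' (m' (m' z))) = z.
Proof.
by move=> m4 cx z; apply: smoothed4 => //; case: b; rewrite ?crossing_node.
Qed.

Lemma alternating_smoothing m x b : (forall z, m (m (m (m z))) = z) ->
  alternating ov m -> crossing_at m x -> alternating ov (smoothing b m x).
Proof.
by move=> m4 alt cx; apply: alternating_smoothed => //; case: b; rewrite ?crossing_node.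
Qed.

Section TwoCrossings.
Hypothesis alt : alternating ov n.
Variables (x y : T).
Hypotheses (cx : crossing_at n x) (cy : crossing_at n y).
Let l := cycle4 n x ++ cycle4 n y.
Hypothesis ul : uniq l.

Lemma smoothing2_extend b1 b2 :
  smoothing b2 (smoothing b1 n x) y =1 extend l (positions2 b1 b2) n.
Proof.
apply: smoothing_extend => //; first exact: smoothed_extend.
- exact: cycle4_local.
- exact: smoothing4.
- by case: b1.
Qed.

Lemma bracket_smoothing2 e P b1 b2 :
  bracket A w e (smoothing b2 (smoothing b1 n x) y) ov P =
  local_bracket A w e n ov P l (positions2 b1 b2).
Proof.
apply: bracket_extend => //; last exact: smoothing2_extend.
  by apply: cat_local; apply: cycle4_local.
by case: b1; case: b2.
Qed.

Lemma bracket_expand2 e P :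
  let B b1 b2 := local_bracket A w e n ov P l (positions2 b1 b2) in
  let c b := corner_weight A b in
  bracket A w e n ov P =
    c (ov x) * (c (ov y) * B true true + c (~~ ov y) * B true false) +
    c (~~ ov x) * (c (ov y) * B false true + c (~~ ov y) * B false false).
Proof.
move=> B c; rewrite (skein_alternating _ _ _ _ n4 alt cx) /B -!bracket_smoothing2 /c.
have yl : y \notin cycle4 n x.
  by move: ul; rewrite cat_uniq => /and3P [_ /hasPn /(_ y) + _] /=; apply; rewrite inE eqxx.
have cy1 b : crossing_at (smoothing b n x) y.
  exact: crossing_off (smoothed_extend _ n4 cx) (@cycle4_local _) yl cy.
have s1 b := smoothing4 b n4 cx.
have a1 b : alternating ov (smoothing b n x) := alternating_smoothing n4 alt cx.
by congr (_ * _ + _ * _); rewrite (skein_alternating _ _ _ _ (s1 _) (a1 _) (cy1 _)).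
Qed.

End TwoCrossings.

Section ThreeCrossings.
Hypothesis alt : alternating ov n.
Variables (x y z : T).
Hypotheses (cx : crossing_at n x) (cy : crossing_at n y) (cz : crossing_at n z).
Let l := (cycle4 n x ++ cycle4 n y) ++ cycle4 n z.
Hypothesis ul : uniq l.

Lemma uniq2 : uniq (cycle4 n x ++ cycle4 n y).
Proof. by move: ul; rewrite cat_uniq => /and3P []. Qed.

Lemma bracket_expand3 e P :
  let B b1 b2 b3 := local_bracket A w e n ov P l (positions3 b1 b2 b3) in
  let c b := corner_weight A b in
  bracket A w e n ov P =
    c (ov x) * (c (ov y) * (c (ov z) * B true true true + c (~~ ov z) * B true true false)
       + c (~~ ov y) * (c (ov z) * B true false true + c (~~ ov z) * B true false false)) +
    c (~~ ov x) * (c (ov y) * (c (ov z) * B false true true + c (~~ ov z) * B false true false)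
       + c (~~ ov y) * (c (ov z) * B false false true + c (~~ ov z) * B false false false)).
Proof.
have ul2 := uniq2.
have l2 : is_local (cycle4 n x ++ cycle4 n y) n by apply: cat_local; apply: cycle4_local.
have B3 b1 b2 b3 : bracket A w e (smoothing b3 (smoothing b2 (smoothing b1 n x) y) z) ov P =
    local_bracket A w e n ov P l (positions3 b1 b2 b3).
  apply: bracket_extend => //.
  - by apply: cat_local => //; apply: cycle4_local.
  - by case: b1; case: b2; case: b3.
  - apply: smoothing_extend => //; first exact: smoothing2_extend.
      apply: smoothing4; first exact: smoothing4.
      apply: crossing_off (smoothed_extend _ n4 cx) (@cycle4_local _) _ cy.
      by move: ul2; rewrite cat_uniq => /and3P [_ /hasPn /(_ y) + _] /=; apply; rewrite inE eqxx.
    by case: b1; case: b2.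
move=> B c; rewrite (skein_alternating _ _ _ _ n4 alt cx) /B -!B3 /c.
have yl : y \notin cycle4 n x.
  by move: ul2; rewrite cat_uniq => /and3P [_ /hasPn /(_ y) + _] /=; apply; rewrite inE eqxx.
have zl : z \notin cycle4 n x ++ cycle4 n y.
  by move: ul; rewrite cat_uniq => /and3P [_ /hasPn /(_ z) + _] /=; apply; rewrite inE eqxx.
have cy1 b : crossing_at (smoothing b n x) y.
  exact: crossing_off (smoothed_extend _ n4 cx) (@cycle4_local _) yl cy.
have cz2 b b' : crossing_at (smoothing b' (smoothing b n x) y) z.
  exact: crossing_off (smoothing2_extend cx cy ul2 b b') l2 zl cz.
have s1 b := smoothing4 b n4 cx.
have a1 b : alternating ov (smoothing b n x) := alternating_smoothing n4 alt cx.
have s2 b b' := smoothing4 b' (s1 b) (cy1 b).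
have a2 b b' : alternating ov (smoothing b' (smoothing b n x) y) :=
  alternating_smoothing (s1 b) (a1 b) (cy1 b).
congr (_ * _ + _ * _).
all: rewrite (skein_alternating _ _ _ _ (s1 _) (a1 _) (cy1 _)).
all: by congr (_ * _ + _ * _); rewrite (skein_alternating _ _ _ _ (s2 _ _) (a2 _ _) (cz2 _ _)).
Qed.

End ThreeCrossings.
End LocalMoves.

(** * Kauffman's computations for R2 and R3 *)

Section Reidemeister.
Variables (F : fieldType) (A : F) (G : zmodType) (w : G -> F).
Hypothesis A0 : A != 0.
Hypothesis w0E : w 0 = - A ^+ 2 - A ^- 2.
Hypothesis w00 : w 0 != 0.
Variables (T : finType) (e n : T -> T) (ov : pred T) (P : T -> G).
Hypothesis n4 : forall y, n (n (n (n y))) = y.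
Hypothesis eK : involutive e.
Hypothesis alt : alternating ov n.

(** All smoothings but the one that opens both crossings connect the outer ends of the bigon alike.
    Up to a common value they contribute A^2, A^-2 and [w 0], whose sum is 0. *)
Lemma bracket_R2 x y : crossing_at n x -> crossing_at n y ->
  uniq (cycle4 n x ++ cycle4 n y) -> e (n x) = y -> e (n y) = x ->
  ov (n x) = ov y -> P (n x) + P y = 0 -> P (n y) + P x = 0 ->
  bracket A w e n ov P = bracket A w e (smoothing true (smoothing true n x) y) ov P.
Proof.
move=> cx cy ul ex ey oxy Px Py.
rewrite (bracket_expand2 _ _ n4 alt cx cy ul) (bracket_smoothing2 _ _ _ n4 cx cy ul).
set l := _ ++ _ in ul *.
have l2 : is_local l n by apply: cat_local; apply: cycle4_local.
(* Positions 0 to 3 are the darts around [x], 4 to 7 those around [y]; the sides of the bigon are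
   the edges 1-4 and 5-0. *)
have red b1 b2 : let r := reduce [:: (1, 4); (5, 0)]%N (positions2 b1 b2) in
    local_bracket A w e n ov P l r.1 = w 0 ^+ r.2 * local_bracket A w e n ov P l (positions2 b1 b2).
  apply: (@local_bracket_reduce _ _ _ _ _ _ _ _ _ n4 eK _ ul l2 _ _ x).
    by case: b1; case: b2.
  by move=> r; rewrite !inE => /orP [] /eqP ->.
(* These three reductions end in the same matching, with one new loop for the closed bigon and two
   for the others. *)
have := red false false; have := red true false; have := red false true.
rewrite /= expr1 expr2 => -> /(mulfI (mulf_neq0 w00 w00)) <-.
rewrite -mulrA => /(mulfI w00) <-.
rewrite w0E -oxy alt //; case: (ov x) => /=; field; exact: A0.
Qed.

(* Position 4 i + k is the dart node^k c of the i-th corner c of the triangle. *)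
(* Conjugation by swap turns the state sum of the new triangle into a sum over *)
(* matchings of the same darts.  Cutting the sides leaves five matchings: Mid  *)
(* is reached from at most one joined corner before the move and from three    *)
(* after it, Mrot conversely, and the other three are the same on both sides.  *)
Lemma bracket_R3 (swap : T -> T) x y z :
  crossing_at n x -> crossing_at n y -> crossing_at n z ->
  uniq ((cycle4 n x ++ cycle4 n y) ++ cycle4 n z) ->
  e (n x) = y -> e (n y) = z -> e (n z) = x ->
  ~~ ((ov x == ov y) && (ov y == ov z)) ->
  P (n x) + P y = 0 -> P (n y) + P z = 0 -> P (n z) + P x = 0 ->
  swap =1 extend ((cycle4 n x ++ cycle4 n y) ++ cycle4 n z)
            [:: 11; 6; 9; 4; 3; 10; 1; 8; 7; 2; 5; 0]%N id ->
  bracket A w e n ov P =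
  bracket A w (fun u => swap (e (swap u))) n ov (P \o swap).
Proof.
move=> cx cy cz; set l := _ ++ _ => ul ex ey ez oxyz Px Py Pz swapE.
have nl : is_local l n.
  by apply: cat_local; [apply: cat_local|]; apply: cycle4_local.
set rho := (X in extend l X) in swapE.
have swapK : involutive swap.
  move=> u; rewrite !swapE; have [ul'|ul'] := boolP (u \in l).
    by rewrite extend_involK.
  by rewrite !extend_off.
(* Mapping over [rho] itself makes the k-th entry rho (t (rho k)). *)
pose conj_positions t := [seq nth 0%N rho (nth 0%N t j) | j <- rho].
pose B b1 b2 b3 := local_bracket A w e n ov P l (positions3 b1 b2 b3).
pose B' b1 b2 b3 := local_bracket A w e n ov P l (conj_positions (positions3 b1 b2 b3)).
have conjE b1 b2 b3 :
  local_bracket A w (fun u => swap (e (swap u))) n ov (P \o swap) l (positions3 b1 b2 b3)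
  = B' b1 b2 b3.
  apply: eq_bigr => K cK; congr (_ * _).
  set t := positions3 b1 b2 b3.
  have mt : matching (size l) t by rewrite /t; move: (b1) (b2) (b3); do 3!case.
  have mt' : matching (size l) (conj_positions t).
    by rewrite /t; move: (b1) (b2) (b3); do 3!case.
  have := @loop_product_iso F G w T T (fun u => swap (e (swap u)))
     (extend l t (strand n K)) e (extend l (conj_positions t) (strand n K)) swap P.
  move=> -> //.
  - exact: extend_strand_invol.
  - by exists swap.
  move=> u; rewrite !swapE; have [ul'|ul'] := boolP (u \in l); last first.
    have sl := strand_local nl cK.
    by rewrite !(extend_off _ _ ul') ?extend_off ?sl.
  rewrite -(nth_index x ul'); set j := index u l.
  have jl : (j < size l)%N by rewrite index_mem.
  have mr : matching (size l) rho by [].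
  have [v1 v2 _] := matchingP mt jl; have [r1 r2 _] := matchingP mr jl.
  have [q1 q2 _] := matchingP mr v1.
  have ct k : (k < 12)%N -> nth 0%N (conj_positions t) k = nth 0%N rho (nth 0%N t (nth 0%N rho k)).
    by move=> k12; rewrite (nth_map 0%N).
  by rewrite !extend_nth ?ct ?r2.
rewrite (bracket_expand3 _ _ n4 alt cx cy cz ul).
rewrite (bracket_expand3 _ _ n4 alt cx cy cz ul) /= !conjE -/(B _ _ _).
pose rs := [:: (1, 4); (5, 8); (9, 0)]%N.
have rsP r : r \in rs -> e (nth x l r.1) = nth x l r.2 /\ P (nth x l r.1) + P (nth x l r.2) = 0.
  by rewrite !inE => /or3P [] /eqP ->.
have red t rt := @local_bracket_reduce F A G w T e n ov P n4 eK l ul nl rs t x rt rsP.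
(* Cutting the three sides creates three loops, except when they already close up into one; after
   division by the cube only that smoothing keeps a factor [w 0]. *)
pose N t := w 0 ^- 3 * local_bracket A w e n ov P l t.
have w30 : w 0 ^+ 3 != 0 by rewrite expf_neq0.
have red3 t M : reducible 12 rs t && (reduce rs t == (M, 3%N)) ->
    local_bracket A w e n ov P l t = N M.
  case/andP => rt /eqP r3; rewrite /N; have := red _ rt; rewrite r3 /= => ->.
  by rewrite mulrA mulVf ?mul1r.
have red2 t M : reducible 12 rs t && (reduce rs t == (M, 2%N)) ->
    local_bracket A w e n ov P l t = w 0 * N M.
  case/andP => rt /eqP r2; rewrite /N; have := red _ rt; rewrite r2 /= => ->.
  by move: (local_bracket _ _ _ _ _ _ _ _) => L; field.
pose Mid := [:: 9; 4; 3; 2; 1; 8; 7; 6; 5; 0; 11; 10]%N.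
pose Mrot := [:: 9; 4; 7; 10; 1; 8; 11; 2; 5; 0; 3; 6]%N.
pose Mxy := [:: 9; 4; 7; 6; 1; 8; 3; 2; 5; 0; 11; 10]%N.
pose Myz := [:: 9; 4; 3; 2; 1; 8; 11; 10; 5; 0; 7; 6]%N.
pose Mzx := [:: 9; 4; 11; 10; 1; 8; 7; 6; 5; 0; 3; 2]%N.
rewrite {}/B {conjE}/B'.
rewrite (red3 (positions3 true true true) Mrot) //.
rewrite (red3 (conj_positions (positions3 true true true)) Mid) //.
rewrite (red3 (positions3 true true false) Mxy) //.
rewrite (red3 (conj_positions (positions3 true true false)) Mxy) //.
rewrite (red3 (positions3 true false true) Mzx) //.
rewrite (red3 (conj_positions (positions3 true false true)) Mzx) //.
rewrite (red3 (positions3 true false false) Mid) //.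
rewrite (red3 (conj_positions (positions3 true false false)) Mrot) //.
rewrite (red3 (positions3 false true true) Myz) //.
rewrite (red3 (conj_positions (positions3 false true true)) Myz) //.
rewrite (red3 (positions3 false true false) Mid) //.
rewrite (red3 (conj_positions (positions3 false true false)) Mrot) //.
rewrite (red3 (positions3 false false true) Mid) //.
rewrite (red3 (conj_positions (positions3 false false true)) Mrot) //.
rewrite (red2 (positions3 false false false) Mid) //.
rewrite (red2 (conj_positions (positions3 false false false)) Mrot) //.
move: {red red2 red3} (N Mid) (N Mrot) (N Mxy) (N Myz) (N Mzx) => N1 N2 N3 N4 N5.
rewrite w0E.
(* The coefficients of [Mid] on the two sides, and likewise those of [Mrot], agree for the six
   patterns left once [oxyz] excludes the two cyclic ones. *)
by case: (ov x) (ov y) (ov z) oxyz => -[] [] //= _; field.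
Qed.

End Reidemeister.

(** * Planarity as vanishing of the first cohomology modulo 2 *)

Section Pullback.
Variables (F : fieldType) (T : finType).
Local Notation N := #|T|.

Definition vec_fun (u : 'rV[F]_N) (x : T) : F := u 0 (enum_rank x).
Definition fun_vec (g : T -> F) : 'rV[F]_N := \row_i g (enum_val i).

(** Composition with [r] as a matrix on row vectors. For idempotent [r] its row space consists of
    the functions constant on the fibres of [r]; with [r] choosing orbit representatives, the
    numbers in Euler's formula become ranks. *)
Definition pullback (r : T -> T) : 'M[F]_N :=
  \matrix_(i, j) (r (enum_val j) == enum_val i)%:R.

Lemma fun_vecK g : vec_fun (fun_vec g) =1 g.
Proof. by move=> x; rewrite /vec_fun mxE enum_rankK. Qed.

Lemma vec_fun_inj u v : vec_fun u =1 vec_fun v -> u = v.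
Proof. by move=> uv; apply/rowP => i; have := uv (enum_val i); rewrite /vec_fun enum_valK. Qed.

Lemma vec_fun_pullback u r x : vec_fun (u *m pullback r) x = vec_fun u (r x).
Proof.
rewrite /vec_fun mxE (bigD1 (enum_rank (r x))) //= mxE !enum_rankK eqxx mulr1.
rewrite big1 ?addr0 // => i; rewrite mxE enum_rankK => ix.
by case: (r x =P _) ix => [->|_ _]; rewrite ?enum_valK ?eqxx //= mulr0.
Qed.

Lemma vec_funD u v x : vec_fun (u + v) x = vec_fun u x + vec_fun v x.
Proof. by rewrite /vec_fun mxE. Qed.

Lemma vec_fun_dot u v : (u *m v^T) 0 0 = \sum_x vec_fun u x * vec_fun v x.
Proof.
rewrite mxE (reindex (@enum_rank T)) /=; last exact/onW_bij/enum_rank_bij.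
by apply: eq_bigr => x _; rewrite mxE.
Qed.

Lemma sub_pullback u r : r \o r =1 r ->
  reflect (forall x, vec_fun u (r x) = vec_fun u x) (u <= pullback r)%MS.
Proof.
move=> rr; apply: (iffP idP) => [/submxP [v ->] x|ur].
  by rewrite !vec_fun_pullback; congr vec_fun; apply: rr.
by apply/submxP; exists u; apply: vec_fun_inj => x; rewrite vec_fun_pullback.
Qed.

(** An idempotent factors through its fixed points: [pullback r] is [D *m C] where [C *m D] is the
    identity, and [C] is in turn a multiple of [pullback r]. *)
Lemma rank_pullback r : r \o r =1 r -> \rank (pullback r) = #|[set x | r x == x]|.
Proof.
move=> rr; set X := [set x | r x == x].
pose f (a : 'I_#|X|) : T := enum_val a.
have rf a : r (f a) = f a by have := enum_valP a; rewrite inE => /eqP.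
pose C : 'M[F]_(#|X|, N) := \matrix_(a, j) (r (enum_val j) == f a)%:R.
pose D : 'M[F]_(N, #|X|) := \matrix_(j, a) (enum_val j == f a)%:R.
have CD : C *m D = 1%:M.
  apply/matrixP => a b; rewrite !mxE (bigD1 (enum_rank (f b))) //= !mxE enum_rankK eqxx mulr1 rf.
  rewrite big1 ?addr0 => [|j]; first by rewrite (inj_eq enum_val_inj) eq_sym.
  by rewrite !mxE -[j]enum_valK (inj_eq enum_rank_inj) enum_valK => /negPf ->; rewrite mulr0.
have <- : \rank C = #|X| by apply/eqP/row_freeP; exists D.
have CE : C = D^T *m pullback r.
  apply/matrixP => a j; rewrite !mxE (bigD1 (enum_rank (f a))) //= !mxE enum_rankK eqxx mul1r.
  rewrite big1 ?addr0 // => i; rewrite !mxE -[i]enum_valK (inj_eq enum_rank_inj) enum_valK.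
  by move/negPf ->; rewrite mul0r.
have RE : pullback r = D *m C.
  apply/matrixP => i j; rewrite !mxE.
  have rX : r (enum_val j) \in X by rewrite inE; apply/eqP/rr.
  rewrite (bigD1 (enum_rank_in rX (r (enum_val j)))) //= !mxE /f enum_rankK_in // eqxx mulr1.
  rewrite big1 ?addr0 => [|a ne]; first by rewrite eq_sym.
  rewrite !mxE; have [rE|] := eqVneq (r (enum_val j)) (f a); last by rewrite mulr0.
  by have := congr1 (enum_rank_in rX) rE; rewrite /f enum_valK_in => aE; rewrite aE eqxx in ne.
by apply/eqP; rewrite eqn_leq {1}RE mxrankM_maxr /= CE mxrankM_maxr.
Qed.

End Pullback.

Lemma root_idem (T : finType) (r : rel T) : connect_sym r ->
  fingraph.root r \o fingraph.root r =1 fingraph.root r.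
Proof. by move=> rs x /=; rewrite root_root. Qed.

Lemma card_root (T : finType) (r : rel T) :
  #|[set x | fingraph.root r x == x]| = n_comp r T.
Proof. by rewrite /n_comp_mem; apply: eq_card => x; rewrite !inE andbT. Qed.

Lemma F2_addxx (x : 'F_2) : x + x = 0.
Proof. by case: x => [[|[|m]] i] //; apply/val_inj. Qed.

Lemma F2_opp (x : 'F_2) : - x = x.
Proof. by apply/eqP; rewrite eq_sym -addr_eq0 F2_addxx. Qed.

Lemma F2_add_eq0 (x y : 'F_2) : (x + y == 0) = (x == y).
Proof. by rewrite addr_eq0 F2_opp. Qed.

Section Planarity.
Variables (T R : finType) (e n : T -> T) (reg : T -> R).
Hypothesis eK : involutive e.
Hypothesis e_neq : forall x, e x != x.
Hypothesis n_inj : injective n.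
Hypothesis reg_face : forall x, reg (e (n x)) = reg x.
Hypothesis reg_conn :
  forall x y, connect (fun u v => link e n u v || (reg u == reg v)) x y.

(** Tested on the indicator of a vertex, the second clause says that z has even degree there;
    testing on all vertex functions states it as an orthogonality between row spaces. *)
Definition mod2_cycle (z : T -> 'F_2) :=
  (forall x, z (e x) = z x) /\
  (forall g : T -> 'F_2, (forall x, g (n x) = g x) -> \sum_x z x * g x = 0).

Definition coboundary (phi : R -> 'F_2) x := phi (reg x) + phi (reg (e x)).

(** The region of a corner is counted once for each of the two darts bounding the corner, with the
    same value of [g], and twice is zero. *)
Lemma sum_coboundary phi (g : T -> 'F_2) : (forall x, g (n x) = g x) ->
  \sum_x coboundary phi x * g x = 0.
Proof.
move=> gn; rewrite /coboundary; under eq_bigr do rewrite mulrDl.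
rewrite big_split /= [X in _ + X](reindex_inj n_inj) /=.
by under [X in _ + X]eq_bigr do rewrite reg_face gn; rewrite F2_addxx.
Qed.

Lemma coboundary_cycle phi : mod2_cycle (coboundary phi).
Proof.
split=> [x|]; last exact: sum_coboundary.
by rewrite /coboundary eK addrC.
Qed.

Local Notation pullb := (pullback 'F_2).
(** [S] adds up the two halves of each edge; its kernel is the space of functions on the edges. *)
Let S : 'M['F_2]_#|T| := 1%:M + pullb e.
Let nu := fingraph.root (frel n).

Let vS u x : vec_fun (u *m S) x = vec_fun u x + vec_fun u (e x).
Proof. by rewrite /S mulmxDr mulmx1 vec_funD vec_fun_pullback. Qed.

Let kerS u : reflect (forall x, vec_fun u (e x) = vec_fun u x) (u <= kermx S)%MS.
Proof.
apply: (iffP sub_kermxP) => [uS x|uS].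
  have := congr1 (fun v => vec_fun v x) uS; rewrite /= vS [RHS]mxE => /eqP.
  by rewrite F2_add_eq0 => /eqP.
apply: vec_fun_inj => x; rewrite vS uS F2_addxx.
by rewrite /vec_fun mxE.
Qed.

Let rootE (r : rel T) (g : T -> 'F_2) : connect_sym r ->
  (forall x, g (fingraph.root r x) = g x) <-> (forall x y, r x y -> g y = g x).
Proof.
move=> rs; split=> [gr x y xy|gr x].
  rewrite -gr -[RHS]gr; congr g; apply/eqP; rewrite root_connect //.
  by rewrite rs connect1.
have := connect_root r x; move: (fingraph.root r x); apply: connect_ind => // y z <-.
exact: gr.
Qed.

Let n_sym : connect_sym (frel n) := fconnect_sym n_inj.
Let e_sym : connect_sym (frel e) := fconnect_sym (inv_inj eK).
Let l_sym : connect_sym (link e n) := link_sym (inv_inj eK) n_inj.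

Let nuK : nu \o nu =1 nu. Proof. exact: root_idem. Qed.

Let sub_nu u : reflect (forall x, vec_fun u (n x) = vec_fun u x) (u <= pullb nu)%MS.
Proof.
apply: (iffP (sub_pullback _ nuK)) => [/(rootE _ n_sym) h x|h].
  by apply: h; rewrite /= eqxx.
by apply/(rootE _ n_sym) => x y /eqP <-.
Qed.

Let card_T : #|T| = (fcard e T * 2)%N.
Proof.
symmetry; apply: fcard_order_set => //; first exact: inv_inj.
apply/subsetP => x _; rewrite inE; apply/eqP.
apply: (@order_cycle _ e [:: x; e x]).
- by rewrite /= eqxx eK eqxx.
- by rewrite /= inE eq_sym e_neq.
- by rewrite inE eqxx.
Qed.

Let rank_ker : \rank (kermx S) = fcard e T.
Proof.
rewrite -card_root -(rank_pullback 'F_2 (root_idem e_sym)).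
apply: eqmx_rank; apply/rV_eqP => u.
apply/kerS/(sub_pullback _ (root_idem e_sym)) => [h|/(rootE _ e_sym) h x].
  by apply/(rootE _ e_sym) => x y /eqP <-.
by apply: h; rewrite /= eqxx.
Qed.

(** The vertex functions killed by [S] are those constant on the components. *)
Let rank_nu : (\rank (pullb nu *m S) + n_comp (link e n) T = fcard n T)%N.
Proof.
rewrite -[RHS]card_root -(rank_pullback 'F_2 nuK) -(mxrank_mul_ker (pullb nu) S); congr addn.
rewrite -card_root -(rank_pullback 'F_2 (root_idem l_sym)).
apply: eqmx_rank; apply/rV_eqP => u; rewrite sub_capmx.
apply/(sub_pullback _ (root_idem l_sym))/andP => [/(rootE _ l_sym) h|[/sub_nu h /kerS h']].
  split; first by apply/sub_nu => x; apply: h; rewrite /link eqxx orbT.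
  by apply/kerS => x; apply: h; rewrite /link eqxx.
by apply/(rootE _ l_sym) => x y /orP [] /eqP <-.
Qed.

Let rho x := odflt x [pick y | reg y == reg x].

Let reg_rho x : reg (rho x) = reg x.
Proof. by rewrite /rho; case: pickP => //= y /eqP. Qed.

Let rho_reg x y : reg x = reg y -> rho x = rho y.
Proof.
move=> xy; rewrite /rho (eq_pick (Q := fun z => reg z == reg y)); last by move=> z; rewrite xy.
by case: pickP => //= /(_ y); rewrite eqxx.
Qed.

Let rhoK : rho \o rho =1 rho.
Proof. by move=> x; apply: rho_reg; rewrite reg_rho. Qed.

Let rank_rho : \rank (pullb rho) = #|[set reg x | x : T]|.
Proof.
rewrite rank_pullback // -(card_in_imset (f := reg)) => [|x y].
  apply: eq_card => r; apply/imsetP/imsetP => -[x _ ->]; first by exists x.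
  by exists (rho x); rewrite ?reg_rho // inE; apply/eqP/rhoK.
by rewrite !inE => /eqP {2}<- /eqP {2}<- /rho_reg.
Qed.

(** The region functions killed by [S] are constant, because darts are connected through links and
    common regions. *)
Let rank_coboundary (x0 : T) : (\rank (pullb rho *m S) + 1 = #|[set reg x | x : T]|)%N.
Proof.
rewrite -rank_rho -(mxrank_mul_ker (pullb rho) S); congr addn.
pose k := fun _ : T => x0; have x0K : k \o k =1 k by [].
transitivity (\rank (pullb k)).
  rewrite rank_pullback //; symmetry; apply/eqP/cards1P; exists x0.
  by apply/setP => x; rewrite !inE eq_sym.
apply: eqmx_rank; apply/rV_eqP => u; rewrite sub_capmx.
apply/(sub_pullback _ x0K)/andP => [h|[/(sub_pullback _ rhoK) h /kerS h']].
  split; last by apply/kerS => x; rewrite -(h (e x)) -(h x).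
  by apply/(sub_pullback _ rhoK) => x; rewrite -(h (rho x)) -(h x).
move=> x; apply: esym; have := reg_conn x0 x; move: x; apply: connect_ind => // x y <-.
rewrite /k in h *; have hr z z' : reg z = reg z' -> vec_fun u z' = vec_fun u z.
  by move=> /rho_reg zz; rewrite -(h z') -zz h.
case/orP => [/orP [] /eqP <-|/eqP /hr] //.
by rewrite -[LHS]h'; apply: hr; rewrite reg_face.
Qed.

Definition cycle_mx := kermx (S *m (pullb nu)^T) *m S.

(** As [S] is symmetric, the product of [S] with the transpose of [pullb nu] has rank V - C. Its
    kernel has dimension 2E - (V - C) and contains the kernel of [S], of dimension E. *)
Let rank_cycle : (\rank cycle_mx + fcard n T = fcard e T + n_comp (link e n) T)%N.
Proof.
have ST : S^T = S.
  rewrite /S linearD /= trmx1; congr (_ + _); apply/matrixP => i j; rewrite !mxE.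
  by rewrite -(inj_eq (inv_inj eK)) eK eq_sym.
have rk : \rank (S *m (pullb nu)^T) = \rank (pullb nu *m S).
  by rewrite -mxrank_tr trmx_mul trmxK ST.
have := mxrank_mul_ker (kermx (S *m (pullb nu)^T)) S; rewrite -/cycle_mx.
have -> : \rank (kermx (S *m (pullb nu)^T) :&: kermx S) = fcard e T.
  rewrite -rank_ker; apply/eqmx_rank/eqmxP/capmx_idPr.
  by apply/sub_kermxP; rewrite mulmxA mulmx_ker mul0mx.
rewrite mxrank_ker rk; have := rank_nu; have := rank_leq_row (pullb nu *m S).
have := card_T; move: (\rank (pullb nu *m S)) => r.
lia.
Qed.

Let cycle_mxP (z : 'rV_#|T|) : reflect (mod2_cycle (vec_fun z)) (z <= cycle_mx)%MS.
Proof.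
have inner g : (forall x, g (n x) = g x) -> fun_vec g *m pullb nu = fun_vec g.
  move=> gn; apply: vec_fun_inj => x; rewrite vec_fun_pullback.
  have /sub_nu : forall y, vec_fun (fun_vec g) (n y) = vec_fun (fun_vec g) y.
    by move=> y; rewrite !fun_vecK gn.
  by move=> /(sub_pullback _ nuK).
apply: (iffP idP) => [/submxP [v]|[ze zn]].
  rewrite mulmxA; set u := v *m _ => zE.
  have uS0 : z *m (pullb nu)^T = 0 by rewrite zE -mulmxA /u -(mulmxA v) mulmx_ker mulmx0.
  split=> [x|g gn]; first by rewrite zE !vS eK addrC.
  transitivity ((z *m (fun_vec g)^T) 0 0).
    by rewrite vec_fun_dot; apply: eq_bigr => x _; rewrite fun_vecK.
  by rewrite -inner // trmx_mul mulmxA uS0 mul0mx mxE.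
(* [u] keeps z on one chosen half of each edge, so that adding up both halves gives z back. *)
pose u := fun_vec (fun x => if fingraph.root (frel e) x == x then vec_fun z x else 0).
have uS : z = u *m S.
  apply: vec_fun_inj => x; rewrite vS !fun_vecK.
  have re : fingraph.root (frel e) (e x) = fingraph.root (frel e) x.
    by apply/eqP; rewrite root_connect // e_sym; apply: connect1; rewrite /= eqxx.
  have : fingraph.root (frel e) x = x \/ fingraph.root (frel e) x = e x.
    have := connect_root (frel e) x; move: (fingraph.root _ x).
    apply: connect_ind; first by left.
    by move=> y y' [] -> /eqP <-; rewrite ?eK; auto.
  rewrite re => -[] ->; rewrite ?eqxx ?(negPf (e_neq x)) ?ze ?add0r //.
  by rewrite eq_sym (negPf (e_neq x)) addr0.
apply/submxP; have : (u <= kermx (S *m (pullb nu)^T))%MS; last first.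
  by move=> /submxP [v uE]; exists v; rewrite mulmxA -uE.
apply/sub_kermxP; rewrite mulmxA -uS; apply/rowP => j.
transitivity ((z *m (row j (pullb nu))^T) 0 0).
  by rewrite mxE [RHS]mxE; apply: eq_bigr => i _; rewrite !mxE.
rewrite vec_fun_dot zn ?mxE //; apply/sub_nu; exact: row_sub.
Qed.

Lemma eq_cycle z z' : z =1 z' -> mod2_cycle z -> mod2_cycle z'.
Proof.
move=> zz [ze zn]; split=> [x|g gn]; first by rewrite -!zz.
by rewrite -[RHS](zn g gn); apply: eq_bigr => x _; rewrite zz.
Qed.

Let region_fun (f : T -> 'F_2) : exists phi : R -> 'F_2, forall x, phi (reg x) = f (rho x).
Proof.
exists (fun r => if [pick y | reg y == r] is Some y then f (rho y) else 0) => x.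
by case: pickP => [y /eqP /rho_reg ->//|/(_ x)]; rewrite eqxx.
Qed.

(* With V vertices, E edges, R regions and C components, cycles have dimension *)
(* E - V + C and coboundaries, which are cycles, have dimension R - 1.         *)
Theorem planarP (x0 : T) :
  reflect (forall z, mod2_cycle z -> exists phi, z =1 coboundary phi)
    (fcard n T + #|[set reg x | x : T]| == fcard e T + n_comp (link e n) T + 1)%N.
Proof.
have cobE v : exists phi, vec_fun (v *m (pullb rho *m S)) =1 coboundary phi.
  have [phi phiE] := region_fun (vec_fun v); exists phi => x.
  by rewrite mulmxA vS !vec_fun_pullback /coboundary !phiE.
have sub : (pullb rho *m S <= cycle_mx)%MS.
  apply/rV_subP => z /submxP [v ->]; apply/cycle_mxP.
  have [phi vE] := cobE v; apply: eq_cycle (coboundary_cycle phi) => x.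
  by rewrite vE.
have -> : (fcard n T + #|[set reg x | x : T]| == fcard e T + n_comp (link e n) T + 1)%N
     = (cycle_mx <= pullb rho *m S)%MS.
  rewrite -(mxrank_leqif_sup sub).2 -rank_coboundary // -rank_cycle.
  by rewrite addnA eqn_add2r addnC eqn_add2r.
apply: (iffP idP) => [le z zc|h].
  have zv : (fun_vec z <= cycle_mx)%MS.
    by apply/cycle_mxP; apply: eq_cycle zc => x; rewrite fun_vecK.
  have /submxP [v zE] := submx_trans zv le; have [phi vE] := cobE v.
  by exists phi => x; rewrite -vE -zE fun_vecK.
apply/rV_subP => z /cycle_mxP /h [phi zE].
apply/submxP; exists (fun_vec (phi \o reg)); apply: vec_fun_inj => x.
by rewrite zE mulmxA vS !vec_fun_pullback !fun_vecK /= !reg_rho.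
Qed.

End Planarity.

(** * Dual paths *)

(** Euler's formula appears here in the form [planar]: it provides the colourings directly and
    passes to smoothings and deletions without any counting of orbits. *)
Record diagram_axioms (D : diagram_data) : Prop := DiagramAxioms {
  edgeK : involutive (@edge D);
  edge_neq : forall x : dart D, edge x != x;
  node4 : forall x : dart D, node (node (node (node x))) = x;
  leg_head : leg_end D != head_end D;
  endpointE : forall x : dart D, (node x == x) = (x == leg_end D) || (x == head_end D);
  node_over : alternating (@is_over D) (@node D);
  reg_face : forall x : dart D, reg (edge (node x)) = reg x;
  inner_reg : exists x : dart D, reg x = inner D;
  outer_reg : exists x : dart D, reg x = outer D;
  region_conn : forall x y : dart D,
    connect (fun u v => link (@edge D) (@node D) u v || (reg u == reg v)) x y;
  planar : forall z : dart D -> 'F_2, mod2_cycle (@edge D) (@node D) z ->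
    exists phi, z =1 coboundary (@edge D) (@reg D) phi
}.

Lemma is_diagramP (D : diagram_data) : is_diagram D <-> diagram_axioms D.
Proof.
have pl : (involutive (@edge D)) -> (forall x : dart D, edge x != x) ->
   (forall x : dart D, node (node (node (node x))) = x) ->
   (forall x : dart D, reg (edge (node x)) = reg x) ->
   (forall x y : dart D,
    connect (fun u v => link (@edge D) (@node D) u v || (reg u == reg v)) x y) ->
   reflect (forall z : dart D -> 'F_2, mod2_cycle (@edge D) (@node D) z ->
    exists phi, z =1 coboundary (@edge D) (@reg D) phi) (euler_planar D).
  move=> eK en n4 rf rc.
  exact: (planarP eK en (node_inj n4) rf rc (leg_end D)).
split.
  case/and5P => /forallP e /forallP n lh /forallP ep /and5P [].
  move=> /forallP ov /forallP rf /imsetP [i _ iE] /imsetP [o _ oE] /andP [/forallP rc eu].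
  have eK : involutive (@edge D) by move=> x; have /andP [_ /eqP] := e x.
  have en (x : dart D) : edge x != x by have /andP [] := e x.
  have n4 (x : dart D) : node (node (node (node x))) = x by apply/eqP/n.
  have rf' (x : dart D) : reg (edge (node x)) = reg x by apply/eqP/rf.
  have rc' (x y : dart D) :
    connect (fun u v => link (@edge D) (@node D) u v || (reg u == reg v)) x y.
    by have /forallP /(_ y) := rc x.
  split=> //.
  - by move=> x; exact: (eqP (ep x)).
  - by move=> x cx; exact: (eqP (implyP (ov x) cx)).
  - by exists i.
  - by exists o.
  - exact/(pl eK en n4 rf' rc').
case=> eK en n4 lh ep ov rf [i iE] [o oE] rc pn.
have rcb : [forall x : dart D, forall y, connect (@region_linked D) x y].
  by apply/forallP => x; apply/forallP => y; apply: rc.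
apply/and5P; split=> //.
- by apply/forallP => x; rewrite en eK eqxx.
- by apply/forallP => x; apply/eqP/n4.
- by apply/forallP => x; apply/eqP/ep.
apply/and5P; split.
- by apply/forallP => x; apply/implyP => cx; apply/eqP/ov.
- by apply/forallP => x; apply/eqP/rf.
- by apply/imsetP; exists i.
- by apply/imsetP; exists o.
- by rewrite rcb /=; apply/(pl eK en n4 rf rc).
Qed.

Lemma diagram_ax (D : diagram) : diagram_axioms D.
Proof. exact/is_diagramP/diagramP. Qed.

Section DualChains.
Variable D : diagram_data.
Implicit Types (P : dart D -> 'F_2) (a b : region D).
Local Notation cob := (coboundary (@edge D) (@reg D)).

(* Modulo 2, P is the set of edges crossed by a path of regions from b to a.  *)
Definition dual_chain P a b :=
  forall phi, \sum_x P x * cob phi x = phi a + phi b.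

Lemma dual_chain0 a : dual_chain (fun=> 0) a a.
Proof. by move=> phi; rewrite F2_addxx big1 // => x _; rewrite mul0r. Qed.

Lemma dual_chain_add P a b (y : dart D) a' :
  dual_chain P a b -> (forall phi, cob phi y = phi a + phi a') ->
  dual_chain (fun x => P x + (x == y)%:R) a' b.
Proof.
move=> Pab ya phi; under eq_bigr do rewrite mulrDl.
rewrite big_split /= Pab (bigD1 y) //= eqxx mul1r ya big1 ?addr0 => [|x /negPf ->].
  by rewrite addrACA F2_addxx add0r addrC.
by rewrite mul0r.
Qed.

Hypothesis axD : diagram_axioms D.

(** The path follows a chain of darts: each step by [edge] or [node] crosses one edge, and a step
    inside a region crosses none. *)
Lemma dual_chain_exists a b :
  (exists x : dart D, reg x = a) -> (exists x : dart D, reg x = b) ->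
  exists P, dual_chain P a b.
Proof.
move=> [x <-] [y <-]; have := region_conn axD y x; move: x.
apply: connect_ind; first by exists (fun=> 0); apply: dual_chain0.
move=> u v [P Pu] /orP [/orP [] /eqP <-|/eqP <-]; last by exists P.
  by eexists; apply: dual_chain_add Pu _ => phi; reflexivity.
eexists; apply: (dual_chain_add (y := node u)) Pu _ => phi.
by rewrite /coboundary (reg_face axD) addrC.
Qed.

(** [g] adds small loops around vertices, which are orthogonal to every coboundary. *)
Lemma dual_chain_vertex P a b (g : dart D -> 'F_2) :
  dual_chain P a b -> (forall x, g (node x) = g x) ->
  dual_chain (fun x => P x + g x) a b.
Proof.
move=> Pab gn phi; under eq_bigr do rewrite mulrDl.
rewrite big_split /= Pab -[RHS]addr0; congr (_ + _).
under eq_bigr do rewrite mulrC.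
exact: sum_coboundary (node_inj (node4 axD)) (reg_face axD) _ _ gn.
Qed.

Lemma sum_edges P phi :
  \sum_x P x * cob phi x = \sum_x (P x + P (edge x)) * phi (reg x).
Proof.
rewrite /coboundary; under eq_bigr do rewrite mulrDr.
under [RHS]eq_bigr do rewrite mulrDl.
rewrite !big_split /=; congr (_ + _).
rewrite [LHS](reindex_inj (inv_inj (edgeK axD))).
by under eq_bigr do rewrite (edgeK axD).
Qed.

(** A coboundary takes the same value on both halves of an edge, so only the total weight of the
    edge matters. *)
Lemma dual_chain_edges P P' a b :
  dual_chain P a b -> (forall x, P x + P (edge x) = P' x + P' (edge x)) ->
  dual_chain P' a b.
Proof.
move=> Pab PP phi; rewrite -Pab !sum_edges.
by apply: eq_bigr => x _; rewrite PP.
Qed.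

(** A path that ends elsewhere enters and leaves the region evenly: take the indicator of [r] as
    test function. *)
Lemma dual_chain_region P a b (r : region D) (s : seq (dart D)) :
  dual_chain P a b -> r != a -> r != b -> uniq s ->
  (forall x, (reg x == r) = (x \in s)) ->
  \sum_(x <- s) (P x + P (edge x)) = 0.
Proof.
move=> /(_ (fun r' => (r == r')%:R)) + ra rb us rs.
rewrite sum_edges (negPf ra) (negPf rb) addr0 => s0; rewrite -[RHS]s0.
rewrite big_uniq // big_mkcond; apply: eq_bigr => x _.
by rewrite -rs eq_sym; case: eqP; rewrite ?mulr1 ?mulr0.
Qed.

Lemma sum_dual_chain (C : {set dart D}) P a b phi :
  dual_chain P a b -> (fun x => (x \in C)%:R) =1 cob phi ->
  \sum_(x in C) P x = phi a + phi b.
Proof.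
move=> Pab Cphi; rewrite -Pab big_mkcond; apply: eq_bigr => x _.
by rewrite -Cphi; case: ifP => _; rewrite ?mulr1 ?mulr0.
Qed.

End DualChains.

Lemma sum_fixfree (T : finType) (s : T -> T) (C : {set T}) (g : T -> 'F_2) :
  {in C, forall x, [/\ s x \in C, s (s x) = x, s x != x & g (s x) = g x]} ->
  \sum_(x in C) g x = 0.
Proof.
move=> sC; rewrite (bigID (fun x => enum_rank x < enum_rank (s x))%N) /=.
rewrite [X in _ + X](reindex_onto s s) /= => [|x /andP [xC _]]; last by have [] := sC x xC.
rewrite [X in _ + X](_ : _ = \sum_(x in C | (enum_rank x < enum_rank (s x))%N) g x) ?F2_addxx //.
apply: eq_big => [x|x /andP [/andP [sxC lt] /eqP ssx]].
  apply/andP/andP => [[/andP [sxC lt] /eqP ssx]|[xC lt]].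
    have [xC _ ne _] := sC _ sxC; rewrite ssx in xC ne lt; split=> //.
    by rewrite ltn_neqAle leqNgt lt andbT; apply: contra ne => /eqP/ord_inj/enum_rank_inj/eqP.
  have [sxC ssx ne _] := sC x xC; split; last by rewrite ssx.
  by rewrite sxC ssx -leqNgt ltnW.
by have [_ _ _] := sC _ sxC; rewrite ssx.
Qed.

(** [s] pairs off the darts of [C] at each vertex, so [C] has even degree everywhere. *)
Lemma closed_set_cycle (D : diagram_data) (s : dart D -> dart D) (C : {set dart D}) :
  diagram_axioms D -> {in C, forall x, edge x \in C} ->
  {in C, forall x, [/\ s x \in C, s (s x) = x, s x != x
                     & s x = node x \/ s x = node (node (node x))]} ->
  mod2_cycle (@edge D) (@node D) (fun x => (x \in C)%:R).
Proof.
move=> ax eC sC; split=> [x|g gn].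
  by congr (_%:R); congr nat_of_bool; apply/idP/idP => /eC //; rewrite (edgeK ax).
rewrite -[RHS](@sum_fixfree _ s C g) => [|x xC].
  by rewrite [RHS]big_mkcond; apply: eq_bigr => x _; case: ifP => _; rewrite ?mul1r ?mul0r.
by have [sx ssx ne [E|E]] := sC x xC; split=> //; rewrite E !gn.
Qed.

Lemma loop_cycle (D : diagram_data) (K C : {set dart D}) :
  diagram_axioms D -> is_choice (@node D) K ->
  C \in loops (@edge D) (strand (@node D) K) ->
  mod2_cycle (@edge D) (@node D) (fun x => (x \in C)%:R).
Proof.
move=> ax cK /imsetP [c /forall_inP cl ->]; have n4 := node4 ax.
apply: (@closed_set_cycle _ (strand (@node D) K)) => // [x|x xC]; first exact: orb_edge.
have /andP [_ ne] := cl x xC.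
by split; rewrite ?orb_node ?strand_invol // /strand; case: ifP => _; auto.
Qed.

(** * State sums of disjoint unions *)

Section BracketEmbed.
Variables (F : fieldType) (A : F) (G : zmodType) (w : G -> F).
Variables (T T' : finType) (e n : T -> T) (e' n' : T' -> T') (ov : pred T) (ov' : pred T').
Variables (f : T -> T') (S : {set T'}) (P : T' -> G).
Hypothesis n4' : forall y, n' (n' (n' (n' y))) = y.
Hypothesis eK' : involutive e'.
Hypothesis f_inj : injective f.
Hypothesis fS : forall y, (y \in codom f) = (y \notin S).
Hypothesis fe : forall x, f (e x) = e' (f x).
Hypothesis fn : forall x, f (n x) = n' (f x).
Hypothesis f_ov : forall x, crossing_at n x -> ov' (f x) = ov x.
Hypothesis S_smooth : forall y, y \in S -> ~~ crossing_at n' y.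

Let f_crossing x : crossing_at n' (f x) = crossing_at n x.
Proof. by rewrite /crossing_at -!fn (inj_eq f_inj). Qed.

Let choice_off K : is_choice n' K -> forall y, y \in S -> y \notin K.
Proof. by move=> /forallP cK y /S_smooth /negPf cy; have := cK y; rewrite cy. Qed.

Let S_edge y : y \in S -> e' y \in S.
Proof.
apply: contraLR; rewrite -!fS => /codomP [x /(congr1 e')]; rewrite eK' -fe => ->.
exact: codom_f.
Qed.

Let S_node y : y \in S -> n' y \in S.
Proof.
apply: contraLR; rewrite -!fS => /codomP [x nyx].
by have := n4' y; rewrite nyx -!fn => <-; apply: codom_f.
Qed.

Lemma choice_image K : is_choice n K = is_choice n' (f @: K).
Proof.
apply/forallP/forallP => cK y; last first.
  by have := cK (f y); rewrite f_crossing -fn !(mem_imset _ _ f_inj).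
have [yS|] := boolP (y \in S).
  rewrite (negPf (S_smooth yS)); apply/imsetP => -[x _ yx].
  by have := fS y; rewrite yS yx codom_f.
rewrite -fS => /codomP [x ->].
by rewrite f_crossing -fn !(mem_imset _ _ f_inj).
Qed.

Lemma weight_image K : is_choice n K -> weight A ov' (f @: K) = weight A ov K.
Proof.
move=> /forallP cK.
have ovK x : x \in K -> ov' (f x) = ov x.
  by move=> xK; apply: f_ov; have := cK x; case: ifP => // _; rewrite xK.
have card_eq (p : pred T) (p' : pred T') : {in K, forall x, p' (f x) = p x} ->
    #|[set y in f @: K | p' y]| = #|[set x in K | p x]|.
  move=> pp; rewrite -(card_imset _ f_inj); apply: eq_card => y.
  apply/idP/imsetP; rewrite inE.
    by case/andP=> /imsetP [x xK ->]; rewrite pp // => px; exists x; rewrite // inE xK.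
  by move=> [x]; rewrite inE => /andP [xK px] ->; rewrite imset_f ?pp.
rewrite /weight (card_eq ov ov') // (card_eq (fun x => ~~ ov x) (fun y => ~~ ov' y)) //.
by move=> x xK; rewrite ovK.
Qed.

(** There are no crossings in [S], so both sides have the same choices, and every state has the same
    additional loops. *)
Lemma bracket_embed :
  bracket A w e' n' ov' P =
    (\prod_(C in [set orb e' n' x | x in [set x in S | closed_at e' n' x]])
        w (\sum_(x in C) P x)) * bracket A w e n ov (P \o f).
Proof.
rewrite {1}/bracket (reindex_onto (fun K : {set T} => f @: K) (fun K => f @^-1: K)) /=; last first.
  move=> K cK; apply/setP => y; apply/imsetP/idP => [[x + ->]|yK]; first by rewrite inE.
  have /codomP [x yx] : y \in codom f.
    by rewrite fS; apply: contraL yK; apply: choice_off.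
  by exists x; rewrite // inE -yx.
rewrite /bracket big_distrr /=; apply: eq_big => [K|K /andP [cK _]].
  rewrite -choice_image; apply: andb_idr => _; apply/eqP/setP => x.
  by rewrite inE (mem_imset _ _ f_inj).
have cK' := cK; rewrite -choice_image in cK'.
rewrite weight_image // mulrCA; congr (_ * _).
have strE y : y \in S -> strand n' (f @: K) y = n' y.
  by move=> yS; rewrite /strand (negPf (choice_off cK yS)).
have orbE x : x \in S -> orb e' (strand n' (f @: K)) x = orb e' n' x.
  move=> xS; have lE y z : y \in S -> link e' (strand n' (f @: K)) y z = link e' n' y z.
    by move=> yS; rewrite /link strE.
  have lS y z : y \in S -> link e' n' y z -> z \in S.
    by move=> yS /orP [] /eqP <-; [apply: S_edge | apply: S_node].
  apply/setP => y; rewrite !inE; apply/idP/idP => /connectP [p + ->];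
    elim: p x xS => [|z p IH] x xS //= /andP [xz pz].
    by rewrite lE // in xz; apply: connect_trans (connect1 xz) (IH _ (lS _ _ xS xz) pz).
  have xz' := xz; rewrite -lE // in xz'.
  exact: connect_trans (connect1 xz') (IH _ (lS _ _ xS xz) pz).
have orbS x y : x \in S -> y \in orb e' n' x -> y \in S.
  move=> xS; rewrite inE; move: y; apply: connect_ind => // y z yS.
  by case/orP => /eqP <-; [apply: S_edge | apply: S_node].
have setE : [set orb e' (strand n' (f @: K)) x |
      x in [set x in S | closed_at e' (strand n' (f @: K)) x]] =
    [set orb e' n' x | x in [set x in S | closed_at e' n' x]].
  apply/setP => D; apply/imsetP/imsetP => -[x]; rewrite inE => /andP [xS cx] ->; exists x;
    rewrite ?orbE // inE xS /=; move: cx; rewrite /closed_at orbE // => /forall_inP cx;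
    by apply/forall_inP => y yx; have := cx y yx; rewrite strE // (orbS x).
rewrite (@loop_product_embed F G w T T' e (strand n K) e' (strand n' (f @: K)) f S) ?setE //.
- exact: strand_invol.
- by move=> x; rewrite /strand (mem_imset _ _ f_inj) -!fn; case: ifP.
Qed.

Lemma bracket_embed0 : S = set0 ->
  bracket A w e' n' ov' P = bracket A w e n ov (P \o f).
Proof.
move=> S0; rewrite bracket_embed big1 ?mul1r // => C /imsetP [x].
by rewrite S0 !inE.
Qed.

Lemma bracket_embed_loop c : injective n' -> S = orb e' n' c -> closed_at e' n' c ->
  bracket A w e' n' ov' P = w (\sum_(x in S) P x) * bracket A w e n ov (P \o f).
Proof.
move=> ni SE cl; have ei := inv_inj eK'; rewrite bracket_embed; congr (_ * _).
have -> : [set orb e' n' x | x in [set x in S | closed_at e' n' x]] = [set S].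
  apply/setP => C; rewrite in_set1; apply/imsetP/eqP => [[x + ->]|->].
    by rewrite inE SE => /andP [xc _]; rewrite (orb_id ei ni xc).
  by exists c; rewrite // inE SE orb_refl.
by rewrite big_set1.
Qed.

End BracketEmbed.

(** * The annular bracket *)

Lemma F2_neq_add (x y : 'F_2) : x + y = (x != y)%:R.
Proof.
have [->|xy] := eqVneq x y; first exact: F2_addxx.
have : x + y != 0 by rewrite F2_add_eq0.
by case: (x + y) => [[|[|m]] i] //= _; apply/val_inj.
Qed.

Lemma sum_fst (I : finType) (C : pred I) (P : I -> 'F_2 * 'F_2) :
  (\sum_(i | C i) P i).1 = \sum_(i | C i) (P i).1.
Proof. exact: (big_morph (fun p : 'F_2 * 'F_2 => p.1) (fun x y => erefl) erefl). Qed.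

Lemma sum_snd (I : finType) (C : pred I) (P : I -> 'F_2 * 'F_2) :
  (\sum_(i | C i) P i).2 = \sum_(i | C i) (P i).2.
Proof. exact: (big_morph (fun p : 'F_2 * 'F_2 => p.2) (fun x y => erefl) erefl). Qed.

Section DualPairs.
Variable D : diagram_data.
Local Notation weights := (dart D -> 'F_2 * 'F_2).

Definition dual_pair (P : weights) :=
  dual_chain (fun x => (P x).1) (inner D) (outer D) /\
  dual_chain (fun x => (P x).2) (reg (leg_end D)) (outer D).

(** Finite functions make the condition decidable, so that [pick] can choose the two paths. *)
Definition dual_pairb (P : {ffun dart D -> 'F_2 * 'F_2}) : bool :=
  [forall phi : {ffun region D -> 'F_2},
    (\sum_x (P x).1 * coboundary (@edge D) (@reg D) phi x ==
        phi (inner D) + phi (outer D)) &&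
    (\sum_x (P x).2 * coboundary (@edge D) (@reg D) phi x ==
        phi (reg (leg_end D)) + phi (outer D))].

Lemma dual_pairP (P : {ffun dart D -> 'F_2 * 'F_2}) :
  reflect (dual_pair P) (dual_pairb P).
Proof.
apply: (iffP forallP) => [h|[h1 h2] phi]; last by rewrite h1 h2 !eqxx.
split=> phi; have /andP [/eqP h1 /eqP h2] := h [ffun r => phi r].
  rewrite !ffunE in h1; rewrite -h1; apply: eq_bigr => x _.
  by rewrite /coboundary !ffunE.
rewrite !ffunE in h2; rewrite -h2; apply: eq_bigr => x _.
by rewrite /coboundary !ffunE.
Qed.

Hypothesis axD : diagram_axioms D.

Lemma dual_pair_exists : exists P, dual_pair P.
Proof.
have [P1 h1] := dual_chain_exists axD (inner_reg axD) (outer_reg axD).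
have [P2 h2] := @dual_chain_exists D axD (reg (leg_end D)) (outer D)
   (ex_intro _ (leg_end D) erefl) (outer_reg axD).
by exists (fun x => (P1 x, P2 x)).
Qed.

Lemma sum_dual_pair (C : {set dart D}) P phi :
  dual_pair P -> (fun x => (x \in C)%:R) =1 coboundary (@edge D) (@reg D) phi ->
  \sum_(x in C) P x = (phi (inner D) + phi (outer D), phi (reg (leg_end D)) + phi (outer D)).
Proof.
case=> h1 h2 Cphi; rewrite [LHS]surjective_pairing sum_fst sum_snd.
by rewrite (sum_dual_chain h1 Cphi) (sum_dual_chain h2 Cphi).
Qed.

End DualPairs.

(** * Circles and the regions that they enclose *)

Section Circles.
Variable D : diagram_data.
Hypothesis axD : diagram_axioms D.
Variable c : dart D.
Hypothesis circle_c : is_circle c.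

Lemma circle_marking x : x \in component c -> node x != x /\ node (node x) = x.
Proof.
move=> xc; have /forall_inP /(_ x xc) /andP [ne] := circle_c.
by rewrite negbK => /eqP.
Qed.

Lemma circle_edge x : (edge x \in component c) = (x \in component c).
Proof. by apply/idP/idP => /(@orb_edge _ (@edge D)); rewrite ?(edgeK axD). Qed.

Lemma circle_node x : (node x \in component c) = (x \in component c).
Proof.
apply/idP/idP => [|/(@orb_node _ _ (@node D))] // xc.
by have := orb_node (orb_node (orb_node xc)); rewrite (node4 axD).
Qed.

Lemma circle_closed : closed_at (@edge D) (@node D) c.
Proof.
by apply/forall_inP => x /circle_marking [ne _]; rewrite (edge_neq axD).
Qed.

Lemma circle_coboundary : exists phi,
  (fun x => (x \in component c)%:R) =1 coboundary (@edge D) (@reg D) phi.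
Proof.
apply: (planar axD); apply: (@closed_set_cycle _ (@node D)) => // x xc.
  by rewrite circle_edge.
by have [ne nn] := circle_marking xc; split; rewrite ?circle_node; auto.
Qed.

Lemma circle_sides x : x \in component c ->
  (reg x = reg c /\ reg (edge x) = reg (edge c)) \/
  (reg x = reg (edge c) /\ reg (edge x) = reg c).
Proof.
rewrite inE => cx.
suff : x \in component c /\ ((reg x = reg c /\ reg (edge x) = reg (edge c)) \/
  (reg x = reg (edge c) /\ reg (edge x) = reg c)) by case.
move: x cx; apply: connect_ind; first by split; [apply: orb_refl | left].
move=> y z [yc yE] /orP [] /eqP <-.
  by rewrite circle_edge (edgeK axD); split=> //; case: yE => -[-> ->]; auto.
rewrite circle_node; split=> //; have [_ nn] := circle_marking yc.
have r1 := reg_face axD y; have := reg_face axD (node y); rewrite nn => r2.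
by case: yE; rewrite r1 -r2 => -[-> ->]; auto.
Qed.

(** A chain of darts that meets the circle arrives at one of its two sides again, so the circle has
    at most two complementary pieces. *)
Lemma region_side (y : dart D) :
  connect (across c) (reg c) (reg y) \/ connect (across c) (reg (edge c)) (reg y).
Proof.
have := region_conn axD c y; move: y; apply: connect_ind; first by left.
have step y : connect (across c) (reg c) (reg y) \/ connect (across c) (reg (edge c)) (reg y) ->
   connect (across c) (reg c) (reg (edge y)) \/ connect (across c) (reg (edge c)) (reg (edge y)).
  have [yc|yc] := boolP (y \in component c).
    by have [[_ ->]|[_ ->]] := circle_sides yc; rewrite !connect0; auto.
  have yy : across c (reg y) (reg (edge y)) by apply/existsP; exists y; rewrite yc !eqxx.
  by case=> h; [left|right]; apply: connect_trans h (connect1 yy).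
move=> y z h /orP [/orP [] /eqP <-|/eqP <-] //; first exact: step.
by have := step (edge (node y)); rewrite (reg_face axD) (edgeK axD); apply.
Qed.

(** A Jordan curve theorem: [phi] is constant along steps that avoid the circle and differs on its
    two sides, and by [region_side] there is no third piece. *)
Lemma enclosesE phi r :
  (fun x => (x \in component c)%:R) =1 coboundary (@edge D) (@reg D) phi ->
  (exists x : dart D, reg x = r) ->
  encloses c r = (phi r != phi (outer D)).
Proof.
move=> cphi [x <-]; have [y yE] := outer_reg axD.
have inv a b : connect (across c) a b -> phi a = phi b.
  move: b; apply: connect_ind => // s t -> /existsP [z /and3P [zc /eqP <- /eqP <-]].
  apply/eqP; rewrite -F2_add_eq0; have := cphi z.
  by rewrite (negPf zc) /coboundary => <-.
have csym : connect_sym (across c).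
  apply: back_connect_sym => s t /existsP [z /and3P [zc /eqP <- /eqP <-]].
  by apply: connect1; apply/existsP; exists (edge z); rewrite circle_edge zc (edgeK axD) !eqxx.
have ne : phi (reg c) != phi (reg (edge c)).
  rewrite -F2_add_eq0; have := cphi c.
  by rewrite (_ : c \in component c) /= ?orb_refl // /coboundary => <-.
rewrite /encloses; congr (~~ _); apply/idP/eqP => [/inv //|].
have same a : connect (across c) a (reg x) -> connect (across c) a (outer D) ->
   connect (across c) (reg x) (outer D).
  by rewrite csym => h1 h2; apply: connect_trans h1 h2.
rewrite -yE in same *.
case: (region_side x) (region_side y) => [hx|hx] [hy|hy] => phixy.
- exact: same hx hy.
- by case/eqP: ne; rewrite (inv _ _ hx) (inv _ _ hy).
- by case/eqP: ne; rewrite (inv _ _ hx) (inv _ _ hy).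
- exact: same hx hy.
Qed.

Lemma circle_sum P : dual_pair P ->
  \sum_(x in component c) P x = ((essential c)%:R, (encloses_knotoid c)%:R).
Proof.
move=> dP; have [phi cphi] := circle_coboundary.
rewrite (sum_dual_pair dP cphi) !F2_neq_add /essential /encloses_knotoid.
rewrite !(enclosesE cphi) //; first by exists (leg_end D).
exact: inner_reg axD.
Qed.

End Circles.

(** * The annular state sum *)

Section Invariant.
Variables (F : fieldType) (A vx vv vt : F).

(* The parities g count the crossings of a loop with the paths to the inner    *)
(* boundary and to the leg.                                                    *)
Definition loop_weight (g : 'F_2 * 'F_2) : F :=
  if g.1 == 0 then if g.2 == 0 then - A ^+ 2 - A ^- 2 else vv
  else if g.2 == 0 then vx else vt.

Definition state_sum (D : diagram_data) (P : dart D -> 'F_2 * 'F_2) : F :=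
  bracket A loop_weight (@edge D) (@node D) (@is_over D) P.

(** A loop of any state is a cycle modulo 2 of [D] itself, hence a coboundary; its parities are
    differences of colours at the ends of the paths. *)
Lemma state_sum_indep (D : diagram_data) (P P' : dart D -> 'F_2 * 'F_2) :
  diagram_axioms D -> dual_pair P -> dual_pair P' -> state_sum P = state_sum P'.
Proof.
move=> ax dP dP'; apply: eq_bigr => K cK; congr (_ * _).
apply: eq_bigr => C CK; congr (loop_weight _).
have [phi Cphi] := planar ax (loop_cycle ax cK CK).
by rewrite !(sum_dual_pair _ Cphi).
Qed.

(** By [dual_pair_exists] the default 0 is never reached at a diagram. *)
Definition annular_state_sum (D : diagram_data) : F :=
  if [pick P : {ffun dart D -> 'F_2 * 'F_2} | dual_pairb P] is Some P
  then @state_sum D P else 0.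

Lemma annular_state_sumE (D : diagram_data) (P : dart D -> 'F_2 * 'F_2) :
  diagram_axioms D -> dual_pair P -> annular_state_sum D = state_sum P.
Proof.
move=> ax dP; rewrite /annular_state_sum; case: pickP => [P' /dual_pairP dP'|none].
  exact: state_sum_indep.
have /negP[] := none (finfun P); apply/dual_pairP.
by case: dP => h1 h2; split=> phi; [rewrite -h1 | rewrite -h2]; apply: eq_bigr => x _; rewrite ffunE.
Qed.

End Invariant.

(** * Isomorphisms and marking points *)

Lemma sum_codom (T T' : finType) (f : T -> T') (S : {set T'}) (g : T' -> 'F_2) :
  injective f -> (forall y, (y \in codom f) = (y \notin S)) ->
  (forall y, y \in S -> g y = 0) -> \sum_x g (f x) = \sum_y g y.
Proof.
move=> fi fS g0; rewrite [RHS](bigID (mem S)) /= [X in X + _]big1 ?add0r //.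
rewrite [RHS](eq_bigl (mem (f @: [set: T]))) => [|y].
  by rewrite [RHS]big_imset /= => [|x y _ _ /fi //]; apply: eq_bigl => x; rewrite inE.
rewrite -fS; apply/codomP/imsetP => -[x]; first by exists x.
by move=> _ ->; exists x.
Qed.

Section Isomorphism.
Variables (D D' : diagram_data) (S : {set dart D'}) (f : dart D -> dart D').
Hypothesis f_inj : injective f.
Hypothesis fS : forall y, (y \in codom f) = (y \notin S).
Hypothesis f_edge : forall x, f (edge x) = edge (f x).
Hypothesis f_reg : forall x y, (reg (f x) == reg (f y)) = (reg x == reg y).

Lemma dual_chain_iso P x y :
  (forall z phi, z \in S -> P z * coboundary (@edge D') (@reg D') phi z = 0) ->
  dual_chain (D := D') P (reg (f x)) (reg (f y)) ->
  dual_chain (D := D) (P \o f) (reg x) (reg y).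
Proof.
move=> P0 dP phi.
(* [phi] is carried over to the regions met by the image of [f] and extended by 0. *)
pose phi' r := if [pick z | reg (f z) == r] is Some z then phi (reg z) else 0.
have phiE z : phi' (reg (f z)) = phi (reg z).
  rewrite /phi'; case: pickP => [u|/(_ z)]; last by rewrite eqxx.
  by rewrite f_reg => /eqP ->.
rewrite -!phiE -dP -(sum_codom f_inj fS) => [|z zS]; last exact: P0.
by apply: eq_bigr => z _; rewrite /coboundary -f_edge !phiE.
Qed.

Hypothesis f_leg : f (leg_end D) = leg_end D'.
Hypothesis f_inner : forall x, (reg (f x) == inner D') = (reg x == inner D).
Hypothesis f_outer : forall x, (reg (f x) == outer D') = (reg x == outer D).
Hypothesis axD : diagram_axioms D.

Lemma dual_pair_iso P :
  (forall z phi, z \in S ->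
     (P z).1 * coboundary (@edge D') (@reg D') phi z = 0 /\
     (P z).2 * coboundary (@edge D') (@reg D') phi z = 0) ->
  dual_pair (D := D') P -> dual_pair (D := D) (P \o f).
Proof.
move=> P0 [d1 d2]; have [x xE] := inner_reg axD; have [y yE] := outer_reg axD.
have /eqP fx : reg (f x) == inner D' by rewrite f_inner xE.
have /eqP fy : reg (f y) == outer D' by rewrite f_outer yE.
split; rewrite -?xE -yE.
  apply: (@dual_chain_iso (fun z => (P z).1) x y) => [z phi /(P0 z phi) []//|].
  by rewrite fx fy.
apply: (@dual_chain_iso (fun z => (P z).2) (leg_end D) y) => [z phi /(P0 z phi) []//|].
by rewrite f_leg fy.
Qed.

End Isomorphism.

Section Moves.
Variables (F : fieldType) (A vx vv vt : F).
Local Notation w := (loop_weight A vx vv vt).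
Local Notation value := (annular_state_sum A vx vv vt).

Lemma node_injD (D : diagram_data) : diagram_axioms D -> injective (@node D).
Proof. by move=> ax; apply: node_inj (node4 ax). Qed.

Lemma annular_iso (D D' : diagram_data) :
  diagram_axioms D -> diagram_axioms D' -> @iso_off D D' set0 -> value D = value D'.
Proof.
move=> ax ax' [f [[fi fS] [fe fn] fo [fl _] [fr fin fout]]].
have [P dP] := dual_pair_exists ax'.
have dPf : dual_pair (P \o f).
  by apply: dual_pair_iso (fi) (fS) fe fr fl fin fout ax _ _ dP => z phi; rewrite inE.
rewrite (annular_state_sumE _ _ _ _ ax' dP) (annular_state_sumE _ _ _ _ ax dPf).
symmetry; apply: bracket_embed0 (fi) (fS) fe fn _ _ _ => //; try exact: node4; try exact: edgeK.
by move=> y; rewrite inE.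
Qed.

(** In every state [bypass] splits the pair {x, node x} off as a loop of value [w 0]; this factor is
    then cancelled. *)
Lemma annular_unmark (D D' : diagram_data) (x : dart D) : w 0 != 0 ->
  diagram_axioms D -> diagram_axioms D' ->
  marking_point x -> edge x != node x ->
  @iso_off D' (bypass x) [set x; node x] -> value D = value D'.
Proof.
move=> w00 ax ax' /andP [nx]; rewrite negbK => /eqP nnx exnx.
rewrite /is_endpoint in nx; rewrite /opposite in nnx.
case=> f [[fi fS] [fe fn] fo [fl _] [fr fin fout]].
have [Q dQ] := dual_pair_exists ax.
have eK := edgeK ax; have ei := inv_inj eK; have ni := node_injD ax.
set y := node x in nx exnx *.
have ny : node y = x by [].
have yx : y != x by [].
have exx := edge_neq ax x; have eyy := edge_neq ax y.
have eyx : edge y != x by rewrite -(inj_eq ei) eK eq_sym.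
have exy : edge x != edge y by rewrite (inj_eq ei) eq_sym.
(* The weights of [x] and [node x] are moved to the other halves of their edges. *)
pose P z := if (z == x) || (z == y) then 0 else
            if z == edge x then Q z + Q x else if z == edge y then Q z + Q y else Q z.
have Px : P x = 0 by rewrite /P eqxx.
have Py : P y = 0 by rewrite /P eqxx orbT.
have Pex : P (edge x) = Q (edge x) + Q x.
  by rewrite /P (negPf exx) (negPf exnx) eqxx.
have Pey : P (edge y) = Q (edge y) + Q y.
  by rewrite /P (negPf eyx) (negPf eyy) eq_sym (negPf exy) eqxx.
have PE z : z != x -> z != y -> z != edge x -> z != edge y -> P z = Q z.
  by rewrite /P => /negPf -> /negPf -> /negPf -> /negPf ->.
have PQ z : Q z + Q (edge z) = P z + P (edge z).
  have [->|zx] := eqVneq z x; first by rewrite Px Pex add0r addrC.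
  have [->|zy] := eqVneq z y; first by rewrite Py Pey add0r addrC.
  have [->|zex] := eqVneq z (edge x); first by rewrite eK Px Pex addr0.
  have [->|zey] := eqVneq z (edge y); first by rewrite eK Py Pey addr0.
  have ez u : (edge z == u) = (z == edge u) by rewrite -(inj_eq ei) eK.
  by rewrite !PE ?ez ?eK.
have dP : dual_pair P.
  case: dQ => d1 d2; split; [apply: dual_chain_edges ax _ _ _ _ d1 _|
                             apply: dual_chain_edges ax _ _ _ _ d2 _] => z.
    by have /(congr1 fst) := PQ z.
  by have /(congr1 snd) := PQ z.
have regex : reg (edge x) = reg y by rewrite -(reg_face ax y) ny.
have regey : reg (edge y) = reg x by rewrite -(reg_face ax x).
have bypassE z phi : coboundary (@edge (bypass x)) (@reg D) phi z =
    if (z == x) || (z == y) then coboundary (@edge (bypass x)) (@reg D) phi z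
    else coboundary (@edge D) (@reg D) phi z.
  case: ifP => // /negbT; rewrite negb_or => /andP [/negPf zx /negPf zy].
  rewrite /coboundary /= -/y zx zy; case: eqP => [->|_]; first by rewrite eK regey.
  by case: eqP => [->|_] //; rewrite eK regex.
have P0 z : (z == x) || (z == y) -> P z = 0 by rewrite /P => ->.
have bK (z : dart D) : @edge (bypass x) (@edge (bypass x) z) = z.
  rewrite /= -/y.
  have [->|zx] := eqVneq z x; first by rewrite (negPf yx) eqxx.
  have [->|zy] := eqVneq z y; first by rewrite eqxx.
  have [->|zex] := eqVneq z (edge x).
    by rewrite (negPf eyx) (negPf eyy) eq_sym (negPf exy) eqxx.
  have [->|zey] := eqVneq z (edge y).
    by rewrite (negPf exx) (negPf exnx) eqxx.
  have ez u : (edge z == u) = (z == edge u) by rewrite -(inj_eq ei) eK.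
  by rewrite !ez !eK (negPf zx) (negPf zy) (negPf zex) (negPf zey).
have dPb : dual_pair (D := bypass x) P.
  case: dP => d1 d2; split=> phi; [rewrite -d1 | rewrite -d2]; apply: eq_bigr => z _;
    rewrite bypassE; case: ifP => // zxy; by rewrite P0 // !mul0r.
have dPf : dual_pair (D := D') (P \o f).
  apply: (@dual_pair_iso D' (bypass x) _ f fi fS fe fr fl fin fout ax' P _ dPb) => z phi.
  by rewrite in_set2 => /P0 ->; rewrite !mul0r.
rewrite (annular_state_sumE _ _ _ _ ax dP) (annular_state_sumE _ _ _ _ ax' dPf).
apply: (mulfI w00); transitivity (state_sum A vx vv vt (D := bypass x) P).
  rewrite /state_sum /bracket big_distrr /=; apply: eq_bigr => K cK.
  rewrite mulrCA; congr (_ * _).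
  have sK := strand_invol (node4 ax) cK.
  have sx : strand (@node D) K x = y.
    by apply: strand_noncrossing => //; rewrite /crossing_at nnx eqxx.
  have bE : (@edge (bypass x)) =1 cut (strand (@node D) K) x (@edge D).
    by move=> z; rewrite /cut sx.
  (* Edges and vertices exchange roles in [loop_product_cut]: what is cut off is the marking
     point. *)
  rewrite (eq_loop_product _ _ bE (frefl _)) [RHS]loop_productC [RHS]loop_product_cut ?sx //.
    by rewrite (negPf exnx) loop_productC.
  by rewrite Px Py addr0.
rewrite /state_sum (@bracket_embed_loop _ A _ w _ _ (@edge D') (@node D') (@edge (bypass x))
  (@node (bypass x)) (@is_over D') (@is_over (bypass x)) f _ P (node4 ax) bK fi fS fe fn fo _ x) //.
- by rewrite big1 // => z; rewrite in_set2 => /P0.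
- by move=> z; rewrite in_set2 => /orP [] /eqP ->; rewrite /crossing_at /= ?ny ?nnx eqxx.
- apply/setP => z; rewrite in_set2 inE; apply/orP/idP => [[] /eqP ->|].
  + exact: connect0.
  + by apply: connect1; rewrite /link /= !eqxx.
  + move: z; apply: connect_ind; first by left.
    move=> z t [] /eqP -> /orP [] /eqP <- /=; rewrite -/y ?ny ?eqxx ?(negPf yx) ?eqxx; auto.
- apply/forall_inP => z; rewrite inE => zx.
  have : (z == x) || (z == y).
    move: z zx; apply: connect_ind; first by rewrite eqxx.
    by move=> z t /orP [] /eqP -> /orP [] /eqP <- /=; rewrite -/y ?ny ?eqxx ?(negPf yx) ?eqxx ?orbT.
  by case/orP => /eqP -> /=; rewrite -/y ?eqxx ?(negPf yx) ?ny ?eqxx ?yx //= 1?eq_sym yx.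
Qed.

End Moves.

(** * Skein relation, null-homotopic circles and R2 *)

Lemma uniq_cycle4 (T : finType) (n : T -> T) x :
  (forall y, n (n (n (n y))) = y) -> crossing_at n x -> uniq (cycle4 n x).
Proof.
move=> n4 cx; have inj := inj_eq (node_inj n4).
rewrite /= !inE !inj ![x == _]eq_sym (negPf (crossing_neq1 cx)) (negPf cx).
by rewrite (negPf (crossing_neq3 n4 cx)).
Qed.

Lemma mem_cycle4 (T : finType) (n : T -> T) x y : (y \in cycle4 n x) = (y \in vertex n x).
Proof. by rewrite !inE -!orbA. Qed.

Lemma disjoint_cycle4 (T : finType) (n : T -> T) x y :
  (forall y, n (n (n (n y))) = y) -> y \notin vertex n x ->
  ~~ has (mem (cycle4 n x)) (cycle4 n y).
Proof.
move=> n4 yx; apply/hasPn => z; rewrite mem_cycle4 => zy.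
by rewrite /= mem_cycle4; case/vertexP: zy => ->; rewrite ?(vertex_node n4).
Qed.

Section Moves.
Variables (F : fieldType) (A vx vv vt : F).
Local Notation w := (loop_weight A vx vv vt).
Local Notation value := (annular_state_sum A vx vv vt).

(** Functions on the merged regions give functions on the old ones with equal values on the two
    merged regions, so these identities are special cases of the old ones. *)
Lemma dual_pair_smooth (D : diagram_data) (x : dart D) P :
  dual_pair (D := D) P -> dual_pair (D := smooth x) P.
Proof.
case=> h1 h2; split=> phi.
  exact: (h1 (phi \o relabel (reg x) (reg (opposite x)))).
exact: (h2 (phi \o relabel (reg x) (reg (opposite x)))).
Qed.

Lemma annular_skein (D : diagram_data) (x : dart D) :
  diagram_axioms D -> diagram_axioms (smooth x) -> diagram_axioms (smooth (node x)) ->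
  is_crossing x -> is_over x ->
  value D = A * value (smooth x) + A^-1 * value (smooth (node x)).
Proof.
move=> ax axA axB cx ox; have [P dP] := dual_pair_exists ax.
rewrite (annular_state_sumE _ _ _ _ ax dP).
rewrite (annular_state_sumE _ _ _ _ axA (dual_pair_smooth x dP)).
rewrite (annular_state_sumE _ _ _ _ axB (dual_pair_smooth (node x) dP)).
by rewrite /state_sum (skein_alternating _ _ _ _ (node4 ax) (node_over ax) cx) ox.
Qed.

Lemma annular_null_circle (L D : diagram_data) (c : dart D) :
  diagram_axioms L -> diagram_axioms D -> disjoint_null_circle L c ->
  value D = (- A ^+ 2 - A ^- 2) * value L.
Proof.
move=> axL axD [/and3P [circ /negPf ness /negPf nenc]].
case=> f [[fi fS] [fe fn] fo [fl _] [fr fin fout]].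
have [P dP] := dual_pair_exists axD.
have dPM : dual_pair (D := merge_regions (reg c) (reg (edge c))) P.
  case: dP => h1 h2; split=> phi.
    exact: (h1 (phi \o relabel (reg c) (reg (edge c)))).
  exact: (h2 (phi \o relabel (reg c) (reg (edge c)))).
have side z : z \in component c -> forall phi,
    coboundary (@edge D) (fun x => relabel (reg c) (reg (edge c)) (reg x)) phi z = 0.
  move=> /(circle_sides axD circ) zc phi.
  have m : relabel (reg c) (reg (edge c)) (reg c) = reg c by rewrite /relabel; case: eqP.
  have m' : relabel (reg c) (reg (edge c)) (reg (edge c)) = reg c by rewrite /relabel eqxx.
  by rewrite /coboundary; case: zc => -[-> ->]; rewrite m m' F2_addxx.
have dPf : dual_pair (D := L) (P \o f).
  apply: (@dual_pair_iso L _ _ f fi fS fe fr fl fin fout axL P _ dPM) => z phi /side s.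
  by rewrite /= s !mulr0.
rewrite (annular_state_sumE _ _ _ _ axD dP) (annular_state_sumE _ _ _ _ axL dPf).
rewrite /state_sum (@bracket_embed_loop _ A _ w _ _ (@edge L) (@node L) (@edge D)
  (@node D) (@is_over L) (@is_over D) f (component c) P (node4 axD) (edgeK axD)
  fi fS fe fn fo _ c) //.
- by rewrite (circle_sum axD circ dP) ness nenc.
- by move=> y /(circle_marking circ) [_ ny]; rewrite /crossing_at ny eqxx.
- exact: node_injD.
- exact: circle_closed.
Qed.

Hypothesis A0 : A != 0.
Hypothesis d0 : - A ^+ 2 - A ^- 2 != 0.

Lemma annular_R2 (D : diagram_data) (x : dart D) :
  diagram_axioms D -> diagram_axioms (R2_remove x) -> is_bigon x ->
  value D = value (R2_remove x).
Proof.
move=> ax ax' /and5P [cx cy nxy /eqP fy /andP [/and3P [ri ro /forallP re] /eqP oxy]].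
set y := face x in cy nxy fy re oxy.
have n4 := node4 ax; have eK := edgeK ax.
have exy : edge (node x) = y by [].
have eyx : edge (node y) = x by [].
have nv : y \notin vertex (@node D) x.
  by move: nxy; rewrite -mem_cycle4.
have rxy : reg y = reg x by rewrite -exy reg_face.
have nyx : y != x by apply: contraNneq nv => ->; rewrite !inE eqxx.
have [P dP] := dual_pair_exists ax.
(* Loops around the crossing of [x] make the crossings of one side of the bigon even. The other side
   is then even too, because neither path ends in the bigon. *)
pose g (Q : dart D -> 'F_2) z := if z \in vertex (@node D) x then Q (node x) + Q y else 0.
pose P' z := ((P z).1 + g (fun u => (P u).1) z, (P z).2 + g (fun u => (P u).2) z).
have gn Q z : g Q (node z) = g Q z by rewrite /g vertex_node.
have dP' : dual_pair P'.
  case: dP => h1 h2; split.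
    exact: dual_chain_vertex ax _ _ _ _ h1 (gn _).
  exact: dual_chain_vertex ax _ _ _ _ h2 (gn _).
have sum0 Q a : a != reg x -> dual_chain (D := D) Q a (outer D) ->
    Q (node x) + Q y + (Q (node y) + Q x) = 0.
  move=> ra dQ; have := @dual_chain_region D ax Q a (outer D) (reg x) [:: x; y] dQ.
  rewrite eq_sym ra ro big_cons big_seq1 /= inE eq_sym nyx.
  have -> : edge y = node x by rewrite -exy eK.
  have -> : edge x = node y by rewrite -{1}eyx eK.
  move=> s0; rewrite -[RHS]s0 // => [|z]; last first.
    apply/idP/idP => [rz|]; first by have := re z; rewrite rz.
    by rewrite !inE => /orP [] /eqP ->; rewrite ?rxy.
  by rewrite addrC [Q (node y) + _]addrC [Q (node x) + _]addrC.
have zero Q a : a != reg x -> dual_chain (D := D) Q a (outer D) ->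
  (Q (node x) + g Q (node x)) + (Q y + g Q y) = 0 /\
  (Q (node y) + g Q (node y)) + (Q x + g Q x) = 0.
  move=> ra dQ; have s0 := sum0 Q a ra dQ.
  have gx : g Q x = Q (node x) + Q y by rewrite /g !inE eqxx.
  have gy : g Q y = 0 by rewrite /g (negPf nv).
  rewrite !gn gx gy !addr0; split.
    by rewrite addrA F2_addxx add0r F2_addxx.
  by rewrite addrA addrC.
have ra : reg x != inner D by [].
(* All corners of the bigon are at crossings, so the leg is not in it. *)
have rl : reg (leg_end D) != reg x.
  apply/eqP => lE; have := re (leg_end D); rewrite lE eqxx /= !inE => lxy.
  have := endpointE ax (leg_end D); rewrite eqxx /= => nl.
  by case/orP: lxy nl => /eqP -> /eqP nl; move: cx cy; rewrite /is_crossing /opposite !nl eqxx.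
have Pz : P' (node x) + P' y = 0 /\ P' (node y) + P' x = 0.
  have ra' : inner D != reg x by rewrite eq_sym.
  case: dP => h1 h2; have [z1 z2] := zero _ _ ra' h1; have [z3 z4] := zero _ _ rl h2.
  by split; [move: z1 z3 | move: z2 z4]; rewrite /P' => z z'; congr pair.
rewrite (annular_state_sumE _ _ _ _ ax dP').
rewrite (annular_state_sumE (D := R2_remove x) _ _ _ _ ax' (dual_pair_smooth _ (dual_pair_smooth _ dP'))).
rewrite /state_sum (@bracket_R2 _ A _ w A0 erefl d0 _ _ _ _ _ n4 eK (node_over ax) x y) //.
- rewrite cat_uniq !uniq_cycle4 // disjoint_cycle4 //.
- by case: Pz.
- by case: Pz.
Qed.

End Moves.

(** * R3 *)

Lemma vertex_sym (T : finType) (n : T -> T) x y :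
  (forall y, n (n (n (n y))) = y) -> (y \in vertex n x) = (x \in vertex n y).
Proof.
move=> n4; apply/vertexP/vertexP => -[] ->; rewrite ?n4.
all: by [constructor 1 | constructor 2; rewrite ?n4 | constructor 3; rewrite ?n4
        | constructor 4; rewrite ?n4].
Qed.

Section Triangle.
Variables (D : diagram_data) (x : dart D).
Hypothesis axD : diagram_axioms D.
Hypothesis tri : is_triangle x.
Local Notation n := (@node D).
Local Notation e := (@edge D).
Let y := face x.
Let z := face y.
Let t := triangle_corners x.
Let l := (cycle4 n x ++ cycle4 n y) ++ cycle4 n z.
Let n4 := node4 axD.

Lemma triangle_crossing : [/\ crossing_at n x, crossing_at n y & crossing_at n z].
Proof. by case/and5P: tri => /and3P []. Qed.

Lemma triangle_vertices :
  [/\ y \notin vertex n x, z \notin vertex n x & z \notin vertex n y].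
Proof. by case/and5P: tri => _ /and3P [h1 h2 h3] _ _ _; rewrite -!mem_cycle4. Qed.

Lemma triangle_face : face z = x.
Proof. by case/and5P: tri => _ _ /eqP. Qed.

Lemma triangle_uniq : uniq l.
Proof.
have [cx cy cz] := triangle_crossing; have [yx zx zy] := triangle_vertices.
rewrite /l cat_uniq; apply/and3P; split; last exact: uniq_cycle4.
  by rewrite cat_uniq !uniq_cycle4 ?disjoint_cycle4.
apply/hasPn => u uz; change (u \notin cycle4 n x ++ cycle4 n y); rewrite mem_cat negb_or.
have /hasPn /(_ u uz) := disjoint_cycle4 n4 zx; have /hasPn /(_ u uz) := disjoint_cycle4 n4 zy.
by rewrite /mem /= => -> ->.
Qed.

Lemma triangle_ind (Q : dart D -> Prop) : Q x -> Q y -> Q z -> forall c, c \in t -> Q c.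
Proof. by move=> qx qy qz c; rewrite !inE => /or3P [] /eqP ->. Qed.

Lemma face_corner c : c \in t -> face c \in t.
Proof. by move: c; apply: triangle_ind; rewrite ?triangle_face !inE eqxx ?orbT. Qed.

Lemma face3_corner c : c \in t -> face (face (face c)) = c.
Proof. by move: c; apply: triangle_ind; rewrite -/y -/z ?triangle_face. Qed.

Lemma corner_crossing c : c \in t -> crossing_at n c.
Proof. by have [cx cy cz] := triangle_crossing; move: c; apply: triangle_ind. Qed.

Lemma corner_vertex c u : c \in t -> u \in vertex n c -> (u \in t) = (u == c).
Proof.
move=> ct uc; apply/idP/eqP => [ut|->//].
have [yx zx zy] := triangle_vertices.
have yx' : x \notin vertex n y by rewrite vertex_sym.
have zx' : x \notin vertex n z by rewrite vertex_sym.
have zy' : y \notin vertex n z by rewrite vertex_sym.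
move: ut ct; rewrite !inE => /or3P [] /eqP uE /or3P [] /eqP cE; rewrite uE cE // in uc *.
- by rewrite uc in yx'.
- by rewrite uc in zx'.
- by rewrite uc in yx.
- by rewrite uc in zy'.
- by rewrite uc in zx.
- by rewrite uc in zy.
Qed.

Lemma in_triangle u :
  u \in l <-> exists2 c, c \in t & u \in vertex n c.
Proof.
rewrite /l !mem_cat !mem_cycle4; split=> [/orP [/orP []|]|[c + uc]].
- by exists x; rewrite // !inE eqxx.
- by exists y; rewrite // !inE eqxx ?orbT.
- by exists z; rewrite // !inE eqxx ?orbT.
by move=> ct; move: c ct uc; apply: triangle_ind => ->; rewrite ?orbT.
Qed.

Lemma corner_tests c : c \in t ->
  ((n c \in t = false) * (n (n c) \in t = false) * (n (n (n c)) \in t = false) * (c \in t))%type.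
Proof.
move=> ct; have cc := corner_crossing ct.
have nc := negPf (crossing_neq1 cc); have n3 := negPf (crossing_neq3 n4 cc).
have E u : u \in vertex n c -> (u \in t) = (u == c) by apply: corner_vertex.
have h1 : n c \in t = false by rewrite E ?nc // !inE eqxx ?orbT.
have h2 : n (n c) \in t = false by rewrite E ?(negPf cc) // !inE eqxx ?orbT.
have h3 : n (n (n c)) \in t = false by rewrite E ?n3 // !inE eqxx ?orbT.
by rewrite h1 h2 h3 ct.
Qed.

Lemma off_tests u : u \notin l ->
  ((u \in t = false) * (n u \in t = false) * (n (n u) \in t = false)
   * (n (n (n u)) \in t = false))%type.
Proof.
move=> ul; have off k : k \in t -> u \in vertex n k -> False.
  by move=> kt uk; case/negP: ul; apply/in_triangle; exists k.
do 3?split; apply/negbTE/negP => ut; apply: (off _ ut).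
- by rewrite !inE eqxx.
- by rewrite vertex_sym // !inE eqxx ?orbT.
- by rewrite vertex_sym // !inE eqxx ?orbT.
- by rewrite vertex_sym // !inE eqxx ?orbT.
Qed.

Lemma R3_swap_off u : u \notin l -> R3_swap x u = u.
Proof. by move=> /off_tests h; rewrite /R3_swap /opposite /prev_node -/t !h. Qed.

Lemma R3_swap_on c : c \in t ->
  [/\ R3_swap x c = prev_node (face (face c)), R3_swap x (n c) = opposite (face c),
      R3_swap x (n (n c)) = n (face (face c)) & R3_swap x (n (n (n c))) = face c].
Proof.
move=> ct; have h := corner_tests ct.
by rewrite /R3_swap /opposite /prev_node -/t ?n4 !h ?n4 ?h.
Qed.

(** The table of [R3_swap] on the twelve darts of the triangle, as used in [bracket_R3]. *)
Definition R3_positions : seq nat := [:: 11; 6; 9; 4; 3; 10; 1; 8; 7; 2; 5; 0]%N.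

Lemma R3_swapE : R3_swap x =1 extend l R3_positions id.
Proof.
move=> u; have [ul|ul] := boolP (u \in l); last by rewrite R3_swap_off ?extend_off.
have xt : x \in t by rewrite !inE eqxx.
have yt : y \in t by rewrite !inE eqxx ?orbT.
have zt : z \in t by rewrite !inE eqxx ?orbT.
have [s0 s1 s2 s3] := R3_swap_on xt; have [s4 s5 s6 s7] := R3_swap_on yt.
have [s8 s9 s10 s11] := R3_swap_on zt.
rewrite -(nth_index x ul); move: (index u l) (index_mem u l); rewrite ul => j jl.
have lt : (nth 0 R3_positions j < size l)%N.
  by do 12?[case: j jl => [//|j jl]].
rewrite extend_nth ?triangle_uniq // {lt}.
do 12?[case: j jl => [_|j jl]] => //=.
all: rewrite ?s0 ?s1 ?s2 ?s3 ?s4 ?s5 ?s6 ?s7 ?s8 ?s9 ?s10 ?s11 -?/y -?/z ?triangle_face -?/y -?/z //.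
Qed.

Lemma R3_swapK : involutive (R3_swap x).
Proof.
move=> u; rewrite !R3_swapE; have [ul|ul] := boolP (u \in l); last by rewrite !extend_off.
by rewrite extend_involK ?triangle_uniq.
Qed.

Definition triangle_side : seq (dart D) := [:: x; n x; y; n y; z; n z].

Lemma side_edge u : (e u \in triangle_side) = (u \in triangle_side).
Proof.
have eK := edgeK axD.
have ex : e x = n z by rewrite -{1}triangle_face eK.
have ey : e y = n x by rewrite /y /face eK.
have ez : e z = n y by rewrite /z /face eK.
suff side v : v \in triangle_side -> e v \in triangle_side.
  by apply/idP/idP => /side; rewrite ?eK.
rewrite !inE => /or4P [/eqP->|/eqP->|/eqP->|/or3P [] /eqP ->]; rewrite ?ex ?ey ?ez ?eqxx ?orbT //.
all: rewrite -1?[e (n x)]/y -1?[e (n y)]/z ?eqxx ?orbT //.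
by rewrite -[e (n z)]/(face z) triangle_face eqxx.
Qed.

(* R3_swap carries the six outer edges of the triangle to the new ones, and   *)
(* each keeps its regions.                                                    *)
Lemma R3_reg u : u \notin triangle_side ->
  reg (d := R3_move x) (R3_swap x u) = reg u.
Proof.
move=> us; rewrite /R3_move /= -/t /opposite /prev_node.
have [/in_triangle [c ct uc]|ul] := boolP (u \in l); last first.
  by have h := off_tests ul; rewrite R3_swap_off // !h.
have [s0 s1 s2 s3] := R3_swap_on ct; have f1 := face_corner ct; have f2 := face_corner f1.
have [h1 h2] := (corner_tests f1, corner_tests f2); have f3 := face3_corner ct.
have cs : (c \in triangle_side) && (n c \in triangle_side).
  by move: c ct {uc s0 s1 s2 s3 f1 f2 h1 h2 f3}; apply: triangle_ind; rewrite !inE !eqxx ?orbT.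
case/vertexP: uc => uE; rewrite uE in us *.
- by rewrite (andP cs).1 in us.
- by rewrite (andP cs).2 in us.
- by rewrite s2 !h2 !n4 h2 f3.
rewrite s3 !h1 -(reg_face axD (n (n (n c)))) n4 -[in RHS]f3.
by rewrite [face (face (face c))]/(e (n (face (face c)))) (edgeK axD).
Qed.

(** Only edges off the sides carry weight, and these keep their regions by [R3_reg], so the defining
    sum is unchanged term by term. *)
Lemma dual_chain_R3 (Q : dart D -> 'F_2) a b :
  {in triangle_side, forall u, Q u = 0} -> dual_chain (D := D) Q a b ->
  dual_chain (D := R3_move x) (Q \o R3_swap x) a b.
Proof.
move=> Q0 dQ phi; rewrite -dQ.
rewrite (reindex_inj (inv_inj R3_swapK)); apply: eq_bigr => u _.
have -> : (Q \o R3_swap x) (R3_swap x u) = Q u by rewrite /= R3_swapK.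
have [us|us] := boolP (u \in triangle_side).
  by rewrite Q0 // !mul0r.
congr (_ * _); rewrite /coboundary R3_reg //; congr (_ + phi _).
have -> : @edge (R3_move x) (R3_swap x u) = R3_swap x (e u) by rewrite /= R3_swapK.
by rewrite R3_reg // side_edge.
Qed.

Lemma triangle_corner_unique u : reg u = reg x -> u \in t.
Proof.
case/and5P: tri => _ _ _ /and3P [_ _ /forallP /(_ u) /implyP h] _ ru.
by apply: h; rewrite ru.
Qed.

Lemma triangle_leg : R3_swap x (leg_end D) = leg_end D /\ leg_end D \notin triangle_side
   /\ reg (leg_end D) != reg x.
Proof.
have legN : n (leg_end D) = leg_end D by apply/eqP; rewrite (endpointE axD) eqxx.
have legl : leg_end D \notin l.
  apply/negP => /in_triangle [c ct /(crossing_vertex n4)].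
  by rewrite (corner_crossing ct) /crossing_at !legN eqxx.
have side_l u : u \in triangle_side -> u \in l.
  rewrite /l !mem_cat !mem_cycle4 !inE => /or4P [->|->|->|/or3P [] ->]; rewrite ?orbT //.
split; [exact: R3_swap_off | split; first by apply: contra legl; apply: side_l].
apply: contra legl => /eqP /triangle_corner_unique lt.
by apply/in_triangle; exists (leg_end D); rewrite // !inE eqxx.
Qed.

Section Normalisation.
Variable Q : dart D -> 'F_2.

(** Loops around [y] correct the side from [x] to [y]; loops around [z] correct the next side,
    including the change made at [y]. *)
Definition triangle_shift u : 'F_2 :=
  if u \in vertex n y then Q (n x) + Q y
  else if u \in vertex n z then Q (n x) + Q y + (Q (n y) + Q z) else 0.

(* A path crosses the sides an even number of times in all, so adding loops    *)
(* around the crossings makes it cross each side evenly; it is then dropped.   *)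
Definition off_triangle u : 'F_2 :=
  if u \in triangle_side then 0 else Q u + triangle_shift u.

Lemma dual_chain_off a b : dual_chain (D := D) Q a b -> a != reg x -> b != reg x ->
  dual_chain (D := D) off_triangle a b.
Proof.
move=> dQ ax bx.
have [yx zx zy] := triangle_vertices.
have xy : x \notin vertex n y by rewrite vertex_sym.
have xz : x \notin vertex n z by rewrite vertex_sym.
have yz : y \notin vertex n z by rewrite vertex_sym.
have eK := edgeK axD.
have ex : e x = n z by rewrite -{1}triangle_face eK.
have ey : e y = n x by rewrite /y /face eK.
have ez : e z = n y by rewrite /z /face eK.
have rt u : (reg u == reg x) = (u \in t).
  apply/eqP/idP; first exact: triangle_corner_unique.
  by move: u; apply: triangle_ind => //; rewrite /z /y !(reg_face axD).
have ut : uniq t.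
  rewrite /t /triangle_corners /= !inE negb_or -/y -/z.
  apply/and3P; split=> //; first apply/andP; try split.
  - by apply: contraNneq yx => <-; rewrite !inE eqxx.
  - by apply: contraNneq zx => <-; rewrite !inE eqxx.
  - by apply: contraNneq zy => <-; rewrite !inE eqxx.
have rx : reg x != a by rewrite eq_sym.
have rx' : reg x != b by rewrite eq_sym.
(* The path meets the whole boundary of the triangle evenly, which settles the third side. *)
have := @dual_chain_region D axD Q a b (reg x) t dQ rx rx' ut rt.
rewrite !big_cons big_nil addr0 -/y -/z ex ey ez => s0.
have gn u : triangle_shift (n u) = triangle_shift u by rewrite /triangle_shift !vertex_node.
have gx : triangle_shift x = 0 by rewrite /triangle_shift (negPf xy) (negPf xz).
have gy : triangle_shift y = Q (n x) + Q y by rewrite /triangle_shift !inE eqxx.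
have gz : triangle_shift z = Q (n x) + Q y + (Q (n y) + Q z).
  by rewrite /triangle_shift (negPf zy) !inE eqxx.
have d1 := dual_chain_vertex axD dQ gn.
apply: dual_chain_edges axD _ _ _ _ d1 _ => u.
rewrite /off_triangle side_edge; case: ifP => // us; rewrite addr0.
have s1 : (Q x + triangle_shift x) + (Q (n z) + triangle_shift (n z)) = 0.
  rewrite gn gx gz; apply: etrans s0.
  by move: (Q x) (Q y) (Q z) (Q (n x)) (Q (n y)) (Q (n z)) => *; ring.
have s2 : (Q y + triangle_shift y) + (Q (n x) + triangle_shift (n x)) = 0.
  by rewrite gn gx gy addr0 [Q (n x) + Q y]addrC addrA F2_addxx add0r F2_addxx.
have s3 : (Q z + triangle_shift z) + (Q (n y) + triangle_shift (n y)) = 0.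
  rewrite !gn gy gz; apply: etrans (F2_addxx (Q (n x) + Q y + Q (n y) + Q z)).
  by move: (Q x) (Q y) (Q z) (Q (n x)) (Q (n y)) (Q (n z)) => *; ring.
move: us; rewrite !inE => /or4P [/eqP->|/eqP->|/eqP->|/or3P [] /eqP ->].
all: rewrite -?ex -?ey -?ez ?eK.
all: rewrite ?ex ?ey ?ez //.
all: by rewrite addrC.
Qed.

End Normalisation.
End Triangle.

Section Move.
Variables (F : fieldType) (A vx vv vt : F).
Local Notation w := (loop_weight A vx vv vt).
Local Notation value := (annular_state_sum A vx vv vt).
Hypothesis A0 : A != 0.
Hypothesis d0 : - A ^+ 2 - A ^- 2 != 0.

Lemma annular_R3 (D : diagram_data) (x : dart D) :
  diagram_axioms D -> diagram_axioms (R3_move x) -> is_triangle x ->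
  value D = value (R3_move x).
Proof.
move=> ax ax' tri; have [cx cy cz] := triangle_crossing tri.
have /and5P [_ _ _ /and3P [ri ro _] ov] := tri.
have [swl [sl rl]] := triangle_leg ax tri.
have [P [d1 d2]] := dual_pair_exists ax.
pose P' u := (off_triangle x (fun v => (P v).1) u, off_triangle x (fun v => (P v).2) u).
have d1' : dual_chain (fun u => (P' u).1) (inner D) (outer D).
  by apply: dual_chain_off => //; rewrite eq_sym.
have d2' : dual_chain (fun u => (P' u).2) (reg (leg_end D)) (outer D).
  by apply: dual_chain_off => //; rewrite eq_sym.
have P0 u : u \in triangle_side x -> P' u = 0 by rewrite /P' /off_triangle => ->.
have dP : dual_pair P' by [].
have dP' : dual_pair (D := R3_move x) (P' \o R3_swap x).
  split.
    by apply: (dual_chain_R3 ax tri) d1' => u /P0 ->.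
  have E : reg (d := R3_move x) (leg_end D) = reg (leg_end D).
    by rewrite -{1}swl; apply: R3_reg.
  rewrite (E : reg (leg_end (R3_move x)) = _).
  by apply: (dual_chain_R3 ax tri) d2' => u /P0 ->.
rewrite (annular_state_sumE _ _ _ _ ax dP) (annular_state_sumE _ _ _ _ ax' dP').
have P00 u v : u \in triangle_side x -> v \in triangle_side x -> P' u + P' v = 0.
  by move=> /P0 -> /P0 ->; rewrite addr0.
apply: (@bracket_R3 _ A _ w A0 erefl d0 _ _ _ _ _ (node4 ax) (edgeK ax) (node_over ax)
  (R3_swap x) x (face x) (face (face x))) => //.
- exact: triangle_uniq.
- exact: triangle_face.
- by apply: P00; rewrite !inE eqxx ?orbT.
- by apply: P00; rewrite !inE eqxx ?orbT.
- by apply: P00; rewrite !inE eqxx ?orbT.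
- exact: R3_swapE.
Qed.

End Move.

(** * Smoothings and deletions are planar *)

Lemma relabel_left (D : diagram_data) (a b : region D) : relabel a b a = a.
Proof. by rewrite /relabel; case: eqP. Qed.

Lemma relabel_right (D : diagram_data) (a b : region D) : relabel a b b = a.
Proof. by rewrite /relabel eqxx. Qed.

Lemma comp_relabel (D : diagram_data) (a b : region D) (phi : region D -> 'F_2) :
  phi a = phi b -> phi \o relabel a b =1 phi.
Proof. by move=> ab r; rewrite /= /relabel; case: eqP => [->|]. Qed.

(** A cycle of the smoothed graph is one of [D], hence the coboundary of some phi. It also meets the
    new vertex formed by [x] and [prev_node x] evenly, so phi agrees on the two merged regions. *)
Lemma smooth_axioms (D : diagram_data) (x : dart D) :
  diagram_axioms D -> is_crossing x -> diagram_axioms (smooth x).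
Proof.
move=> ax cx; have n4 := node4 ax.
have x1 := crossing_neq1 cx; have x3 := crossing_neq3 n4 cx.
have cE : reg (d := smooth x) (opposite x) = reg (d := smooth x) x.
  by rewrite /= relabel_left relabel_right.
have nE u : @node (smooth x) u = smoothed (@node D) x u by [].
split.
- exact: edgeK ax.
- exact: edge_neq ax.
- exact: (@smoothed4 _ (@node D) n4 x cx).
- exact: leg_head ax.
- move=> u; rewrite -(endpointE ax) nE /smoothed; case: ifP => // /orP [] /eqP ->.
    by rewrite (negPf x1) (negPf x3).
  by rewrite !(inj_eq (node_inj n4)) (negPf x1) (negPf x3).
- exact: alternating_smoothed n4 _ (node_over ax) cx.
- move=> u; rewrite nE /smoothed; case: ifP => [/orP [] /eqP ->|_] /=.
  + by rewrite (reg_face ax (opposite x)) relabel_left relabel_right.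
  + by rewrite n4 (reg_face ax x) relabel_left relabel_right.
  + by rewrite (reg_face ax u).
- by have [u uE] := inner_reg ax; exists u; rewrite /= uE.
- by have [u uE] := outer_reg ax; exists u; rewrite /= uE.
- move=> u v; have := region_conn ax u v; apply: connect_sub => {}u {}v.
  case/orP => [/orP [] /eqP <-|/eqP uv]; first 1 last.
  (* Where the link to the next dart is lost, it is replaced by passing through the merged region to
     the opposite corner. *)
  + have [ux|ux] := boolP ((u == x) || (u == node (node x))); last first.
      by apply: connect1; rewrite /link nE /smoothed (negPf ux) eqxx orbT.
    have opp u' v' : reg (d := smooth x) u' = reg (d := smooth x) v' ->
        connect (fun a b => link (@edge (smooth x)) (@node (smooth x)) a b
                            || (reg (d := smooth x) a == reg (d := smooth x) b)) u' v'.
      by move=> rE; apply: connect1; rewrite rE eqxx orbT.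
    case/orP: ux => /eqP ->.
      apply: connect_trans (opp _ _ (esym cE)) (connect1 _).
      by rewrite /link [@node (smooth x) _]nE /smoothed eqxx orbT n4 eqxx !orbT.
    apply: connect_trans (opp _ _ cE) (connect1 _).
    by rewrite /link [@node (smooth x) _]nE /smoothed !eqxx !orbT.
  + by apply: connect1; rewrite /= uv eqxx orbT.
  + by apply: connect1; rewrite /link eqxx.
move=> z [ze zn].
have zc : mod2_cycle (@edge D) (@node D) z.
  split=> // g gn; apply: zn => u; rewrite nE /smoothed.
  by case: ifP => _; rewrite !gn.
have [phi zphi] := planar ax zc.
have phix : phi (reg x) = phi (reg (opposite x)).
  apply/eqP; rewrite -F2_add_eq0; apply/eqP.
  pose C : {set dart D} := [set x; node (node (node x))].
  have : \sum_u z u * (u \in C)%:R = 0.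
    apply: zn => u; congr (_%:R); congr nat_of_bool.
    have sK := smoothed_on n4 cx.
    have s0 : smoothed (@node D) x x = node (node (node x)) by rewrite /smoothed eqxx.
    have s3 : smoothed (@node D) x (node (node (node x))) = x.
      by rewrite -s0 sK // !inE eqxx.
    have si : injective (smoothed (@node D) x) := node_inj (smoothed4 n4 cx).
    by rewrite nE !in_set2 -(inj_eq si u x) -(inj_eq si u (node (node (node x)))) s0 s3 orbC.
  move=> s0; rewrite -[RHS]s0 => {s0}.
  transitivity (\sum_(u in C) z u); last first.
    by rewrite big_mkcond; apply: eq_bigr => u _; case: ifP; rewrite ?mulr1 ?mulr0.
  rewrite /C big_setU1 ?inE 1?eq_sym //= big_set1 !zphi /coboundary.
  have -> : reg (edge x) = reg (node (node (node x))).
    by rewrite -(reg_face ax (node (node (node x)))) n4.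
  by rewrite (reg_face ax (opposite x)) addrA -(addrA (phi (reg x))) F2_addxx addr0.
exists phi => u; rewrite zphi /coboundary /=.
by rewrite !(comp_relabel phix _ : phi (relabel _ _ _) = _).
Qed.


Section DeleteCircle.
Variables (D : diagram_data) (c : dart D).
Hypothesis axD : diagram_axioms D.
Hypothesis circ : is_circle c.

Let off (x : dart D) := x \notin component c.
Local Notation offT := {x : dart D | off x}.

Let off_edge x : off x -> off (edge x).
Proof. by rewrite /off circle_edge. Qed.

Let off_node x : off x -> off (node x).
Proof. by rewrite /off circle_node. Qed.

Let off_endpoint x : node x = x -> off x.
Proof. by move=> nx; apply/negP => /(circle_marking circ) []; rewrite nx eqxx. Qed.

Let off_leg : off (leg_end D).
Proof. by apply/off_endpoint/eqP; rewrite (endpointE axD) eqxx. Qed.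

Let off_head : off (head_end D).
Proof. by apply/off_endpoint/eqP; rewrite (endpointE axD) eqxx orbT. Qed.

Local Notation relab := (relabel (reg c) (reg (edge c))).

Definition delete_circle : diagram_data :=
  @DiagramData offT
    (fun u => Sub (edge (val u)) (off_edge (valP u)))
    (fun u => Sub (node (val u)) (off_node (valP u)))
    (fun u => is_over (val u)) (region D) (fun u => relab (reg (val u)))
    (relab (inner D)) (relab (outer D))
    (Sub (leg_end D) off_leg) (Sub (head_end D) off_head).

Let codom_off y : (y \in codom (val : offT -> dart D)) = (y \notin component c).
Proof.
apply/codomP/idP => [[u ->]|yc]; first exact: (valP u).
by exists (Sub y yc).
Qed.

Lemma delete_circle_iso :
  @iso_off delete_circle (merge_regions (reg c) (reg (edge c))) (component c).
Proof.
exists (val : offT -> dart D); split=> //.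
by split; [exact: val_inj | exact: codom_off].
Qed.

Lemma relabel_circle x : x \in component c -> relab (reg x) = reg c.
Proof.
by case/(circle_sides axD circ) => -[-> _]; rewrite ?relabel_left ?relabel_right.
Qed.

(** A chain of darts from the circle to the leg must leave the circle, and it can do so only through
    a region beside it. *)
Lemma off_beside_circle : exists2 x, off x & relab (reg x) = reg c.
Proof.
have : leg_end D \in component c \/ exists2 x, off x & relab (reg x) = reg c.
  have := region_conn axD c (leg_end D); move: (leg_end D).
  apply: connect_ind; first by left; apply: orb_refl.
  move=> u v [uc|]; last by right.
  case/orP => [/orP [] /eqP <-|/eqP uv]; rewrite ?circle_edge ?circle_node; auto.
  have [vc|vc] := boolP (v \in component c); first by left.
  by right; exists v; rewrite // -uv relabel_circle.
by case=> //; rewrite (negPf off_leg).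
Qed.

Lemma delete_circle_axioms : diagram_axioms delete_circle.
Proof.
have [w0 w0c w0r] := off_beside_circle.
have touch r : (exists x : dart D, reg x = r) -> exists u : offT, relab (reg (val u)) = relab r.
  move=> [x <-]; have [xc|xc] := boolP (x \in component c).
    by exists (Sub w0 w0c); rewrite /= w0r relabel_circle.
  by exists (Sub x xc).
split.
- by move=> u; apply: val_inj; rewrite /= (edgeK axD).
- by move=> u; rewrite -val_eqE /= (edge_neq axD).
- by move=> u; apply: val_inj; rewrite /= (node4 axD).
- by rewrite -val_eqE /= (leg_head axD).
- by move=> u; rewrite -!val_eqE /= (endpointE axD).
- by move=> u cu; apply: (node_over axD); move: cu; rewrite /crossing_at -val_eqE.
- by move=> u; rewrite /= (reg_face axD).
- exact: touch (inner_reg axD).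
- exact: touch (outer_reg axD).
(* [h] collapses the circle to the dart [w0] beside it, so chains through the circle become chains
   off it. *)
- pose h (x : dart D) : offT := insubd (Sub w0 w0c) x.
  have hE x : off x -> val (h x) = x by move=> xc; rewrite insubdK.
  have hc x : x \in component c -> h x = Sub w0 w0c.
    by move=> xc; rewrite /h /insubd insubF // /off xc.
  have hr x : relab (reg (val (h x))) = relab (reg x).
    have [xc|xc] := boolP (x \in component c); last by rewrite hE.
    by rewrite hc //= w0r relabel_circle.
  move=> u v; rewrite -[u](valKd (Sub w0 w0c)) -[v](valKd (Sub w0 w0c)).
  have := region_conn axD (val u) (val v); apply: connect_map => x y.
  case/orP => [lxy|/eqP xy]; last first.
    by apply: connect1; rewrite /= !hr xy eqxx orbT.
  have [xc|xc] := boolP (x \in component c).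
    have yc : y \in component c by case/orP: lxy => /eqP <-; rewrite ?circle_edge ?circle_node.
    by rewrite -/(h x) -/(h y) !hc.
  apply: connect1; rewrite /link -!val_eqE /= !hE //; first by move: lxy; rewrite /link => ->.
  by case/orP: lxy => /eqP <-; [apply: off_edge | apply: off_node].
move=> z [ze zn].
(* Extension by zero is a cycle of [D]; it vanishes on the circle, so its colouring does not jump
   there and is compatible with the merged region. *)
pose z' (x : dart D) : 'F_2 := if insub x is Some u then z u else 0.
have z'E (u : offT) : z' (val u) = z u by rewrite /z' valK.
have z'0 x : x \in component c -> z' x = 0 by move=> xc; rewrite /z' insubF // /off xc.
have zc : mod2_cycle (@edge D) (@node D) z'.
  split=> [x|g gn].
    have [xc|xc] := boolP (x \in component c); first by rewrite !z'0 ?circle_edge.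
    by have := ze (Sub x xc); rewrite -!z'E /=.
  have fi : injective (val : offT -> dart D) by exact: val_inj.
  have fS := codom_off.
  rewrite -(sum_codom fi fS (g := fun x => z' x * g x)) => [|y yc]; last by rewrite z'0 ?mul0r.
  under eq_bigr do rewrite z'E; apply: (zn (fun u => g (val u))) => u.
  by rewrite /= gn.
have [phi zphi] := planar axD zc.
have phic : phi (reg c) = phi (reg (edge c)).
  apply/eqP; rewrite -F2_add_eq0; have := zphi c.
  by rewrite z'0 ?orb_refl // /coboundary => <-.
exists phi => u; rewrite -z'E zphi /coboundary /=.
by rewrite !(comp_relabel phic _ : phi (relabel _ _ _) = _).
Qed.

End DeleteCircle.

Definition trivial_knotoid : diagram_data :=
  @DiagramData bool negb id xpredT unit (fun=> tt) tt tt true false.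

Lemma trivial_knotoid_axioms : diagram_axioms trivial_knotoid.
Proof.
split=> //.
- exact: negbK.
- by case.
- by case.
- by move=> x; rewrite /crossing_at eqxx.
- by exists true.
- by exists true.
- by move=> u v; apply: connect1; rewrite eqxx orbT.
move=> z [_ zn]; exists (fun=> 0) => x; rewrite /coboundary addr0.
have := zn (fun y => (y == x)%:R) (fun=> erefl).
rewrite (bigD1 x) //= eqxx mulr1 big1 ?addr0 // => y /negPf ->.
by rewrite mulr0.
Qed.

Lemma is_trivial_knotoidP : is_trivial_knotoid trivial_knotoid.
Proof.
apply/andP; split; first by apply/forallP => x; rewrite /is_crossing /opposite eqxx.
apply/forallP => x; apply/negP => /forall_inP /(_ x).
by rewrite orb_refl => /(_ isT) /andP []; rewrite /is_endpoint eqxx.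
Qed.

(** * Uniqueness and Laurent polynomials *)

Section States.
Variables (F : fieldType) (A vx vv vt : F).
Local Notation value := (annular_state_sum A vx vv vt).

(** Without crossings the only choice is the empty set, and [circle_sum] sorts the loops by their
    two parities. *)
Lemma annular_state (D : diagram_data) : diagram_axioms D -> is_state D ->
  value D = (- A ^+ 2 - A ^- 2) ^+ ncircles (@null_homotopic D)
    * vx ^+ ncircles (@inner_essential D)
    * vv ^+ ncircles (@enclosing_nonessential D)
    * vt ^+ ncircles (@outer_essential D).
Proof.
move=> ax /forallP st; have [P dP] := dual_pair_exists ax.
rewrite (annular_state_sumE _ _ _ _ ax dP) /state_sum /bracket.
have nc x : crossing_at (@node D) x = false by apply/negbTE/st.
rewrite (big_pred1 set0) => [|K]; last first.
  apply/forallP/eqP => [cK|-> x]; last by rewrite nc inE.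
  by apply/setP => x; have := cK x; rewrite nc inE => /negbTE.
have -> : weight A (@is_over D) (set0 : {set dart D}) = 1.
  have e0 (p : pred (dart D)) : [set y in (set0 : {set dart D}) | p y] = set0.
    by apply/setP => x; rewrite !inE.
  by rewrite /weight !e0 cards0 expr0 invr1 mulr1.
rewrite mul1r.
have cl c : closed_at (@edge D) (@node D) c = is_circle c.
  apply/forall_inP/forall_inP => h x xc; have := h x xc.
    by case/andP => _ nx; rewrite /marking_point /is_endpoint nx /= st.
  by case/andP => nx _; rewrite (edge_neq ax).
have ei := inv_inj (edgeK ax); have ni := node_injD ax.
transitivity (\prod_(C in loops (@edge D) (@node D)) loop_weight A vx vv vt (\sum_(x in C) P x)).
  by apply: eq_loop_product => // x; rewrite /strand inE.
pose L := loops (@edge D) (@node D).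
pose S (C : {set dart D}) := \sum_(x in C) P x.
have count (Q : pred (dart D)) (q : pred ('F_2 * 'F_2)) :
    (forall c, Q c = is_circle c && q ((essential c)%:R, (encloses_knotoid c)%:R)) ->
    ncircles Q = #|[set C in L | q (S C)]|.
  move=> QE; apply: eq_card => C; apply/imsetP/idP => [[c + ->]|].
    rewrite unfold_in QE inE => /andP [circ qc].
    rewrite /S (circle_sum ax circ dP) qc andbT.
    by apply/imsetP; exists c; rewrite // closed_atE cl.
  rewrite inE => /andP [/imsetP [c + ->]]; rewrite closed_atE cl => circ.
  by rewrite /S (circle_sum ax circ dP) => qc; exists c; rewrite // unfold_in QE circ.
rewrite (count (@null_homotopic D) (fun g => (g.1 == 0) && (g.2 == 0))); last first.
  by move=> c; rewrite /null_homotopic /=;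
     case: (is_circle c) (essential c) (encloses_knotoid c) => -[] [].
rewrite (count (@inner_essential D) (fun g => (g.1 != 0) && (g.2 == 0))); last first.
  by move=> c; rewrite /inner_essential /=;
     case: (is_circle c) (essential c) (encloses_knotoid c) => -[] [].
rewrite (count (@enclosing_nonessential D) (fun g => (g.1 == 0) && (g.2 != 0))); last first.
  by move=> c; rewrite /enclosing_nonessential /=;
     case: (is_circle c) (essential c) (encloses_knotoid c) => -[] [].
rewrite (count (@outer_essential D) (fun g => (g.1 != 0) && (g.2 != 0))); last first.
  by move=> c; rewrite /outer_essential /=;
     case: (is_circle c) (essential c) (encloses_knotoid c) => -[] [].
rewrite -!prodr_const -/L.
rewrite (bigID (fun C => (S C).1 == 0)) /= (bigID (fun C => (S C).2 == 0)) /=.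
rewrite [X in _ * X](bigID (fun C => (S C).2 == 0)) /=.
rewrite mulrA -!mulrA; congr (_ * _); last rewrite mulrCA; last congr (_ * _); last congr (_ * _).
all: rewrite /loop_weight; apply: eq_big => C; rewrite ?inE ?andbA //.
all: rewrite -/(S C) -?andbA => /and3P [_ h1 h2].
all: by rewrite ?(eqP h1) ?(eqP h2) ?(negPf h1) ?(negPf h2) ?eqxx.
Qed.

Lemma annular_state_sum_closed (Q : F -> Prop) :
  Q 0 -> Q 1 -> (forall a b, Q a -> Q b -> Q (a + b)) ->
  (forall a b, Q a -> Q b -> Q (a * b)) ->
  Q A -> Q A^-1 -> Q (- A ^+ 2 - A ^- 2) -> Q vx -> Q vv -> Q vt ->
  forall D, Q (value D).
Proof.
move=> Q0 Q1 QD QM QA QV Qd Qx Qv Qt D; rewrite /annular_state_sum.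
case: pickP => // P _; rewrite /state_sum /bracket.
have QX a k : Q a -> Q (a ^+ k).
  by move=> Qa; elim: k => [|k IH]; rewrite ?expr0 // exprS; apply: QM.
apply: (big_ind Q) => // K _; apply: (QM _ _).
  by rewrite /weight -exprVn; apply: (QM _ _); apply: QX.
apply: (big_ind Q) => // C _; rewrite /loop_weight.
by case: ifP; case: ifP.
Qed.

End States.

Section Uniqueness.
Variables br br' : diagram -> {fraction {mpoly int[4]}}.
Hypotheses (H : annular_bracket br) (H' : annular_bracket br').

Definition crossings (D : diagram_data) := [set x : dart D | is_crossing x].

Lemma card_crossings_smooth (D : diagram_data) (x y : dart D) :
  diagram_axioms D -> is_crossing x -> y \in [:: x; node x] ->
  (#|crossings (smooth y)| < #|crossings D|)%N.
Proof.
move=> ax cx yx; have n4 := node4 ax.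
have cy : crossing_at (@node D) y.
  by move: yx; rewrite !inE => /orP [] /eqP ->; rewrite ?crossing_node.
apply: proper_card; apply/properP; split.
  apply/subsetP => u; rewrite !inE => cu.
  have := crossing_smoothed n4 cy u; rewrite /crossing_at /= => E.
  by move: cu; rewrite [is_crossing u]E => /andP [].
exists y; first by rewrite inE.
rewrite inE; have := crossing_smoothed n4 cy y; rewrite /crossing_at => E.
by rewrite [is_crossing _]E !inE eqxx andbF.
Qed.

Lemma annular_bracket_unique K : br' K = br K.
Proof.
(* Smoothing removes a crossing and keeps the darts; deleting a circle removes darts and creates no
   crossing. *)
have [m] := ubnP (#|crossings K| + #|dart K|)%N; elim: m K => // m IH K Km; have ax := diagram_ax K.
have [/existsP [x0 cx0]|nocross] := boolP [exists x, is_crossing (D := K) x].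
  have [x [cx ox]] : exists x : dart K, is_crossing x /\ is_over x.
    case ox: (is_over x0); first by exists x0.
    exists (node x0); split; last by rewrite (node_over ax) // ox.
    by move: cx0; rewrite -[is_crossing x0](crossing_node (node4 ax)).
  have cnx : is_crossing (node x) by rewrite [is_crossing _](crossing_node (node4 ax)).
  have axA := smooth_axioms ax cx; have axB := smooth_axioms ax cnx.
  pose DA := Diagram ((is_diagramP _).2 axA); pose DB := Diagram ((is_diagramP _).2 axB).
  rewrite (bracket_smoothing H (DA := DA) (DB := DB) cx ox) //.
  rewrite (bracket_smoothing H' (DA := DA) (DB := DB) cx ox) //.
  have lt y : y \in [:: x; node x] -> (#|crossings (smooth y)| + #|dart K| < m)%N.
    move=> yx; apply: leq_trans (ltnSE Km).
    by rewrite ltn_add2r; apply: card_crossings_smooth cx yx.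
  by rewrite !IH //; apply: lt; rewrite !inE eqxx ?orbT.
have st : is_state K by apply/forallP => x; apply: contra nocross => cx; apply/existsP; exists x.
have [n0|] := eqVneq (ncircles (@null_homotopic K)) 0%N.
  pose O := Diagram ((is_diagramP _).2 trivial_knotoid_axioms).
  rewrite (bracket_state H (O := O) st n0 is_trivial_knotoidP).
  rewrite (bracket_state H' (O := O) st n0 is_trivial_knotoidP).
  by rewrite (bracket_trivial H (O := O) is_trivial_knotoidP)
             (bracket_trivial H' (O := O) is_trivial_knotoidP).
rewrite /ncircles cards_eq0 => /set0Pn [C /imsetP [c cn _]].
have {}cn : null_homotopic c by [].
have circ : is_circle c by case/and3P: cn.
pose L := Diagram ((is_diagramP _).2 (delete_circle_axioms ax circ)).
have LK : @disjoint_null_circle L K c by split; last exact: delete_circle_iso.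
rewrite (bracket_null_circle H LK) (bracket_null_circle H' LK) IH //.
apply: leq_trans (ltnSE Km); rewrite -addnS; apply: leq_add.
  rewrite -(card_imset _ (val_inj : injective (val : dart L -> dart K))).
  apply: subset_leq_card; apply/subsetP => _ /imsetP [u uc ->].
  by move: uc; rewrite !inE /is_crossing -val_eqE.
rewrite card_sig; apply: proper_card; apply/properP; split; first exact/subsetP.
by exists c; rewrite // !inE negbK connect0.
Qed.

End Uniqueness.

Section Laurent.

Lemma varA_neq0 : varA != 0.
Proof.
rewrite /varA tofrac_eq0; apply/eqP => /(congr1 (meval (fun=> 1))).
by rewrite mevalXU meval0.
Qed.

(** Multiplied by -A^2 it becomes A^4 + 1, which takes the value 2 when all variables are 1. *)
Lemma loop_value_neq0 : loop_value != 0.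
Proof.
apply/eqP => /(congr1 ( *%R (- varA ^+ 2))).
rewrite mulr0 /loop_value mulrBr !mulNr opprK mulfV ?expf_neq0 ?varA_neq0 //.
rewrite mulrN opprK -exprD /varA => /eqP.
rewrite -tofracXn -tofrac1 -tofracD tofrac_eq0 => /eqP /(congr1 (meval (fun=> 1))).
by rewrite rmorphD rmorphXn /= mevalXU rmorph1 rmorph0 expr1n.
Qed.

Lemma laurent_tofrac (p : {mpoly int[4]}) : is_laurent (tofrac p).
Proof. by exists p, 0%N; rewrite expr0 divr1. Qed.

Lemma laurentD a b : is_laurent a -> is_laurent b -> is_laurent (a + b).
Proof.
move=> [p [i ->]] [q [j ->]].
exists (p * 'X_(inord 0) ^+ j + q * 'X_(inord 0) ^+ i), (i + j)%N.
by rewrite addf_div ?expf_neq0 ?varA_neq0 // exprD tofracD !tofracM !tofracXn.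
Qed.

Lemma laurentM a b : is_laurent a -> is_laurent b -> is_laurent (a * b).
Proof.
move=> [p [i ->]] [q [j ->]]; exists (p * q), (i + j)%N.
by rewrite mulf_div exprD tofracM.
Qed.

Lemma laurentV : is_laurent varA^-1.
Proof. by exists 1, 1%N; rewrite tofrac1 div1r. Qed.

Lemma laurent_loop_value : is_laurent loop_value.
Proof.
have N1 : is_laurent (-1) by rewrite -tofrac1 -tofracN; apply: laurent_tofrac.
rewrite /loop_value -mulN1r -[- varA ^- 2]mulN1r -exprVn !expr2.
have lA : is_laurent varA by apply: laurent_tofrac.
by apply: laurentD; apply: laurentM => //; apply: laurentM => //; apply: laurentV.
Qed.

End Laurent.

Theorem theorem3p2 :
  exists br : diagram -> {fraction {mpoly int[4]}},
    [/\ forall K : diagram, is_laurent (br K),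
        annular_bracket br,
        (forall br' : diagram -> {fraction {mpoly int[4]}},
            annular_bracket br' -> forall K : diagram, br' K = br K)
      & forall K K' : diagram, regular_isotopic K K' -> br K = br K'].
Proof.
pose br (K : diagram) := annular_state_sum varA varx varv vart K.
have A0 := varA_neq0; have d0 := loop_value_neq0.
have ax := diagram_ax.
have val_state (D : diagram) : is_state D -> br D =
    loop_value ^+ ncircles (@null_homotopic D)
    * varx ^+ ncircles (@inner_essential D)
    * varv ^+ ncircles (@enclosing_nonessential D)
    * vart ^+ ncircles (@outer_essential D) by apply: annular_state.
have triv (O : diagram) : is_trivial_knotoid O -> br O = 1.
  case/andP => st /forallP nc; rewrite val_state //.
  have n0 (Q : pred (dart O)) : (forall c, Q c -> is_circle c) -> ncircles Q = 0%N.
    move=> Qc; apply: eq_card0 => C; apply/negP => /imsetP [c cQ _].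
    by have := nc c; rewrite Qc.
  by rewrite !n0 ?expr0 ?mulr1 // => c /and3P [].
have H : annular_bracket br.
  split=> //.
  - move=> D DA DB x cx ox EA EB; rewrite /br EA EB.
    by apply: annular_skein => //; rewrite -?EA -?EB.
  - by move=> L D c; apply: annular_null_circle.
  - by move=> D O st n0 /triv ->; rewrite val_state // n0 expr0 mul1r mulr1.
exists br; split=> //.
- move=> K; apply: (annular_state_sum_closed (Q := is_laurent)).
  + by rewrite -tofrac0; apply: laurent_tofrac.
  + by rewrite -tofrac1; apply: laurent_tofrac.
  + exact: laurentD.
  + exact: laurentM.
  + exact: laurent_tofrac.
  + exact: laurentV.
  + exact: laurent_loop_value.
  + exact: laurent_tofrac.
  + exact: laurent_tofrac.
  + exact: laurent_tofrac.
- by move=> br' H' K; apply: annular_bracket_unique.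
move=> K K'; elim=> {K K'}.
- by move=> D D'; apply: annular_iso.
- by move=> D D' x mx ex; apply: annular_unmark.
- by move=> D D' x bx E; rewrite /br E; apply: (annular_R2 _ _ _ A0 d0 (ax D) _ bx); rewrite -E.
- by move=> D D' x tx E; rewrite /br E; apply: (annular_R3 _ _ _ A0 d0 (ax D) _ tx); rewrite -E.
- by move=> D D' _ ->.
- by move=> D D' D'' _ -> _ ->.
Qed.
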